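(* Let $\mathcal{L}_X=\mathcal{L}_X(d;m_1,\ldots,m_r)$ be a non-empty standard linear system with $C\cdot\mathcal{L}_X\geq 1$. Set $t_1:=\max\{0,m_2+m_3-d\}$ and $t_i:=\max\{0,m_1+m_i-d\}$ for $i=2,\ldots,r$. Then \[ \dim \mathcal{L}_X = v(\mathcal{L}_X) + \sum_{i=1}^r \binom{t_i+1}{3}. \]
   Context: The ground field is algebraically closed of characteristic $0$. Let $Q\subset\mathbb{P}^3$ be a smooth quadric and $B\in|-K_Q|$ a general anticanonical curve, i.e. $B$ is a smooth elliptic quartic curve. Let $p_1,\ldots,p_r$ be points in general position on $B$. Let $\pi:X\to\mathbb{P}^3$ be the blow-up of $\mathbb{P}^3$ along $p_1,\ldots,p_r$, let $H$ be the pull-back of a plane, $E_i$ the exceptional divisor over $p_i$, and $C\subset X$ the strict transform of $B$. For non-negative integers $m_1,\ldots,m_r$, write $\mathcal{L}_X(d;m_1,\ldots,m_r):=|dH-m_1E_1-\cdots-m_rE_r|$ (the complete linear system, and also its associated invertible sheaf), and $\dim$ for its projective dimension, $\dim=h^0-1$ (so $\dim=-1$ if it is empty). Its virtual dimension is \[ v(\mathcal{L}_X)=\binom{d+3}{3}-\sum_{i=1}^r\binom{m_i+2}{3}-1 . \] The system is called standard if $m_1\geq\cdots\geq m_r\geq 0$ and $2d\geq m_1+m_2+m_3+m_4$. Put $m_i=0$ for $i>r$. The intersection number of $C$ with the system is $C\cdot\mathcal{L}_X=4d-m_1-\cdots-m_r$. *)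

(* Defs.v *)
From HB Require Import structures.
From Stdlib Require Import Classical ClassicalEpsilon.
From mathcomp Require Import all_boot all_order all_algebra.
From mathcomp.multinomials Require Export mpoly.

Set Implicit Arguments.
Unset Strict Implicit.
Unset Printing Implicit Defensive.

Import GRing.Theory.
Local Open Scope ring_scope.

Section LinearSystem.
Variable K : fieldType.
Implicit Types (q g F : {mpoly K[4]}) (x : 'rV[K]_4).

(* Points of P^3 are represented by nonzero row vectors of length 4, and an
   r-tuple of points by an r x 4 matrix whose rows are nonzero; everything below
   is invariant under rescaling of the representatives. *)

Definition grad F x : 'rV[K]_4 := \row_j (F^`M(j)).@[x 0].

Definition smooth_quadric q : Prop :=
  q \is 2.-homog /\ forall x, x != 0 -> q.@[x 0] = 0 -> grad q x != 0.

(* By adjunction -K_Q = O_Q(2), and every member of |O_Q(2)| is cut out on Q by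
   a quadric, so an anticanonical curve is B = Q \cap {g = 0} with g a quadratic
   form.  The Jacobian criterion at every point of B says that B is a smooth
   curve (hence an elliptic quartic), and forces g not to be a multiple of q. *)
Definition smooth_anticanonical_curve q g : Prop :=
  g \is 2.-homog /\
  forall x, x != 0 -> q.@[x 0] = 0 -> g.@[x 0] = 0 ->
    \rank (col_mx (grad q x) (grad g x)) = 2.

Definition on_curve q g x : Prop := [/\ x != 0, q.@[x 0] = 0 & g.@[x 0] = 0].

(* The coordinate j of the point i is the variable of index mxvec_index i j. *)
Definition multihomogeneous r (f : {mpoly K[r * 4]}) : Prop :=
  exists e : 'I_r -> nat, forall (c : 'X_{1..r * 4}) (i : 'I_r),
    c \in msupp f -> (\sum_(j < 4) c (mxvec_index i j))%N = e i.

Definition zariski_open r (U : 'M[K]_(r, 4) -> Prop) : Prop :=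
  exists2 S : {mpoly K[r * 4]} -> Prop,
    forall f, S f -> multihomogeneous f &
    forall p : 'M[K]_(r, 4), (forall i, row i p != 0) ->
      (U p <-> exists2 f, S f & f.@[mxvec p 0] != 0).

(* P holds for points p_1, ..., p_r in general position on the curve
   B = {q = g = 0}: it holds on a nonempty Zariski open subset of B^r (which is
   dense, as B, and hence B^r, is irreducible). *)
Definition for_general_points q g r (P : 'M[K]_(r, 4) -> Prop) : Prop :=
  exists U : 'M[K]_(r, 4) -> Prop,
    [/\ zariski_open U,
        exists2 p, (forall i, on_curve q g (row i p)) & U p &
        forall p, (forall i, on_curve q g (row i p)) -> U p -> P p].

(* The charts of the blow-up of P^3 at x.  Near x, normalise the j-th homogeneous
   coordinate to x_j != 0; the k-th chart (k != j) of the blow-up then has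
   coordinates y_l (l != j) and its map to P^3 is
   y |-> (x_j, x_k + y_k, x_l + y_k y_l for l != j, k).
   In this chart the exceptional divisor E is {y_k = 0}. *)
Definition blowup_chart x (j k : 'I_4) : 4.-tuple {mpoly K[4]} :=
  [tuple (x 0 l)%:MP
         + (if l == j then 0 else if l == k then 'X_k else 'X_k * 'X_l) | l < 4].

(* The pull-back of F is a section of O(-mE), i.e. vanishes to order at least m
   along E. *)
Definition vanishes_along_exc x (m : nat) F : Prop :=
  forall j k : 'I_4, x 0 j != 0 -> k != j ->
    exists G, F \mPo blowup_chart x j k = 'X_k ^+ m * G.

(* Global sections of dH - m_1 E_1 - ... - m_r E_r on the blow-up of P^3 at the
   rows of p, inside H^0(X, dH) = H^0(P^3, O(d)). *)
Definition is_section r (p : 'M[K]_(r, 4)) d (m : r.-tuple nat)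
    (F : dhomog 4 K d) : Prop :=
  forall i, vanishes_along_exc (row i p) (tnth m i) F.

Lemma submod_vspace (vT : vectType K) (P : vT -> Prop) :
  P 0 -> (forall a u v, P u -> P v -> P (a *: u + v)) ->
  exists V : {vspace vT}, forall v, v \in V <-> P v.
Proof.
move=> P0 Plin.
have step n : (exists V : {vspace vT}, forall v, v \in V <-> P v) \/
    exists2 V : {vspace vT}, (forall v, v \in V -> P v) & (n <= \dim V)%N.
  elim: n => [|n [|[V VP leV]]]; [| by left |].
    by right; exists 0%VS => // v; rewrite memv0 => /eqP->.
  have [all_in|/not_all_ex_not[w Hw]] := classic (forall v, P v -> v \in V).
    by left; exists V => v; split; [apply: VP | apply: all_in].
  have [Pw wV] := imply_to_and _ _ Hw.
  right; exists (V + <[w]>)%VS.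
    move=> _ /memv_addP[u uV [_ /vlineP[a ->] ->]].
    by rewrite addrC; apply: Plin => //; apply: VP.
  apply: leq_ltn_trans leV _; rewrite ltnNge; apply/negP => le_dim.
  apply: wV; have /eqP-> : V == (V + <[w]>)%VS.
    by rewrite eqEdim addvSl le_dim.
  by apply: (subvP (addvSr V <[w]>)); apply: memv_line.
have [//|[V _]] := step (\dim {:vT}).+1.
by rewrite ltnNge dimvS ?subvf.
Qed.

Lemma sections_exist r (p : 'M[K]_(r, 4)) d (m : r.-tuple nat) :
  exists V : {vspace dhomog 4 K d}, forall F : dhomog 4 K d, F \in V <-> is_section p m F.
Proof.
apply: submod_vspace => [|a F G FP GP] i j k xj kj.
  by exists 0; rewrite /= comp_mpoly0 mulr0.
have [F' eF] := FP i j k xj kj; have [G' eG] := GP i j k xj kj.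
exists (a *: F' + G').
by rewrite /= comp_mpolyD comp_mpolyZ eF eG mulrDr scalerAr.
Qed.

Definition H0 r (p : 'M[K]_(r, 4)) d (m : r.-tuple nat) :
    {vspace dhomog 4 K d} :=
  proj1_sig (constructive_indefinite_description _ (sections_exist p d m)).

Lemma mem_H0 r (p : 'M[K]_(r, 4)) d (m : r.-tuple nat) (F : dhomog 4 K d) :
  F \in H0 p d m <-> is_section p m F.
Proof. by rewrite /H0; case: constructive_indefinite_description. Qed.

Definition linsys_dim r (p : 'M[K]_(r, 4)) d (m : r.-tuple nat) : int :=
  (\dim (H0 p d m))%:Z - 1.

Definition linsys_nonempty r (p : 'M[K]_(r, 4)) d (m : r.-tuple nat) : Prop :=
  exists2 F : dhomog 4 K d, F != 0 & F \in H0 p d m.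

End LinearSystem.

(* Indices are shifted: the multiplicity m_i is nth 0 m i.-1, which is 0 for
   i > r. *)

Definition virtual_dim r (d : nat) (m : r.-tuple nat) : int :=
  'C(d + 3, 3)%:Z - \sum_(i < r) 'C(tnth m i + 2, 3)%:Z - 1.

Definition standard r (d : nat) (m : r.-tuple nat) : Prop :=
  sorted geq m /\
  (nth 0 m 0 + nth 0 m 1 + nth 0 m 2 + nth 0 m 3 <= 2 * d)%N.

Definition C_dot_linsys r (d : nat) (m : r.-tuple nat) : int :=
  (4 * d)%N%:Z - \sum_(i < r) (tnth m i)%:Z.

(* The truncated subtraction of nat is max {0, _ - _}. *)
Definition line_excess r (d : nat) (m : r.-tuple nat) (i : 'I_r) : nat :=
  if val i == 0%N then (nth 0 m 1 + nth 0 m 2 - d)%N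
  else (nth 0 m 0 + tnth m i - d)%N.

(* Main.v *)
(** Restricting forms of degree d to Q has kernel Q times the forms of degree
    d - 2, so the dimension is bounded by that of (d - 2; m_i - 1) plus that of
    the system induced on Q.  On Q, parametrised by (u, v), one restricts
    further: to B, written y^2 = f(s) with f a quartic, where sections of degree
    4d - sum m_i >= 1 form a space of at most that dimension (the curve is not
    rational, i.e. f is not a square); to the conic through p_1, p_2, p_3 when
    there are only three points; and, when m_1 is too large, by splitting off the
    tangent plane section at p_1.  Each kernel is identified by counting
    dimensions.  The induction ends with at most four points, taken as coordinate
    points, where monomials are counted by inclusion-exclusion.  Conversely, when
    a fifth or later point p_s is added to V_S, the sum V_S + V_s lies in
    V_1 + V_s, whose dimension is that of a two-point system; this gives the
    lower bound.  *)
From HB Require Import structures.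
From Stdlib Require Import ClassicalEpsilon.
Require Import Defs.
From mathcomp Require Import all_boot all_order all_algebra ring zify.
Set Implicit Arguments.
Unset Strict Implicit.
Unset Printing Implicit Defensive.

(** * Non-increasing multiplicities and the dimension recursions *)

(** Both sides of the formula obey one recursion: passing from (d; m_i) to (d - 2; m_i - 1) keeps
    every m_1 + m_i - d, hence every contributing t_i, while the binomials change by (d + 1)^2 and
    m_i (m_i + 1) / 2, the dimension count on the quadric. The recursion preserves only m_1 <= d +
    1, one more than a non-empty system allows; in the extreme case the space is zero and the
    inequality is checked directly. The double cover comes from linear algebra: the pencil of
    quadrics through B contains a cone over a smooth conic with vertex off Q, and projection from
    the vertex makes B a double cover of that conic. Riemann-Roch on B is replaced by the absence of
    a pencil of degree 1, proved with the norms a^2 - b^2 f. This is where C.L >= 1 enters: in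
    degree 0 the trivial bundle has a section although the count gives none. Generality of the
    points amounts to finitely many polynomial conditions that depend on neither d nor the m_i, so
    one open set serves all systems. *)

Section NonIncreasing.
Variable r : nat.
Implicit Types n : nat -> nat.

Definition multseq n := (forall i, n i.+1 <= n i) /\ (forall i, r <= i -> n i = 0).

Lemma multseq_le n i j : multseq n -> i <= j -> n j <= n i.
Proof.
move=> [h _] ij; rewrite -(subnK ij); elim: (j - i) => // k IH.
by rewrite addSn; apply: leq_trans (h _) IH.
Qed.

Lemma multseq_pred n : multseq n -> multseq (fun i => (n i).-1).
Proof.
move=> [h h0]; split=> [i|i /h0 -> //].
by have := h i; clear; lia.
Qed.

Definition msum n := \sum_(i < r) n i.

Lemma msum_tail n k : multseq n -> n k = 0 -> \sum_(k <= i < r) n i = 0.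
Proof.
move=> hn nk0; rewrite big_nat_cond big1 // => i /andP[/andP[ki _] _].
by have := multseq_le hn ki; rewrite nk0 leqn0 => /eqP.
Qed.

Lemma msum_trunc n k : multseq n -> n k = 0 -> msum n <= \sum_(i < k) n i.
Proof.
move=> hn nk0; rewrite /msum -!(big_mkord xpredT n).
have [kr|rk] := leqP k r; last first.
  by rewrite [X in _ <= X](big_cat_nat _ (ltnW rk)) //= leq_addr.
by rewrite (big_cat_nat _ kr) //= (msum_tail hn nk0) addn0.
Qed.

(** By monotonicity the entries 0, ..., k are all positive, and each of them loses 1. *)
Lemma msum_pred n k : multseq n -> 0 < n k -> msum (fun i => (n i).-1) + k.+1 <= msum n.
Proof.
move=> hn nk0.
have kr : k.+1 <= r.
  by rewrite ltnNge; apply/negP => /(proj2 hn) e; rewrite e in nk0.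
have -> : msum n = \sum_(i < r) ((n i).-1 + (0 < n i)%N).
  by apply: eq_bigr => i _; case: (n i) => //= c; rewrite addn1.
rewrite big_split /= leq_add2l -(big_mkord xpredT (fun i => (0 < n i)%N : nat)).
rewrite (big_cat_nat _ kr) //=; apply: leq_trans (leq_addr _ _).
rewrite big_mkord (eq_bigr (fun=> 1)) => [|i _]; first by rewrite sum1_card card_ord.
by rewrite (leq_trans nk0) // multseq_le // -ltnS.
Qed.

Lemma msum_predE n : \sum_(i < r) 'C(n i + 1, 2) =
  \sum_(i < r) 'C((n i).-1 + 1, 2) + msum n.
Proof.
rewrite /msum -big_split; apply: eq_bigr => i _ /=.
by case: (n i) => // k; rewrite /= !addn1 binS bin1.
Qed.

Lemma sum9 n : \sum_(i < 9) n i = n 0 + n 1 + n 2 + n 3 + (n 4 + n 5 + n 6 + n 7 + n 8).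
Proof. by rewrite !big_ord_recl big_ord0 /= !addnA addn0. Qed.

Lemma sum7 n : \sum_(i < 7) n i = n 0 + n 1 + n 2 + n 3 + (n 4 + n 5 + n 6).
Proof. by rewrite !big_ord_recl big_ord0 /= !addnA addn0. Qed.

(* Standardness bounds the intersection number with C from below as soon as few
   multiplicities are nonzero. *)
Lemma msum_pred_lt d n : multseq n -> n 0 + n 1 + n 2 + n 3 <= 2 * d.+2 ->
  msum n < 4 * d.+2 -> 0 < (n 3).-1 -> msum (fun i => (n i).-1) < 4 * d.
Proof.
move=> hn hs lt n3.
(* Eight positive entries lower the sum by 8, the drop from 4 (d + 2) to 4 d. Otherwise at most
   seven entries count: the first four contribute at most 2 d, and comparing n 4, n 5, n 6 with n 0,
   n 1, n 2 bounds the rest by 2 d - 1, because n 3 >= 2. *)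
have [n7|n7] := posnP (n 7); last first.
  by have := msum_pred hn n7; move: lt; clear; lia.
have hp := multseq_pred hn.
have := msum_trunc hp (k := 7); rewrite n7 => /(_ erefl); rewrite (sum7 (fun i => (n i).-1)).
have h41 := multseq_le hn (isT : 0 <= 4); have h52 := multseq_le hn (isT : 1 <= 5).
have h63 := multseq_le hn (isT : 2 <= 6).
have [h1 h2 h3] : [/\ n 1 <= n 0, n 2 <= n 1 & n 3 <= n 2] by split; apply: (proj1 hn).
move: h1 h2 h3 h41 h52 h63 hs n3; move: (msum _) (n 0) (n 1) (n 2) (n 3) (n 4) (n 5) (n 6).
by clear; lia.
Qed.
End NonIncreasing.

(* q d n stands for the dimension of the space of forms of degree d whose
   restriction to Q has multiplicity n i at the i-th point, and z d for that of
   the forms vanishing on Q. *)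
Section QuadricBound.
Variables (r : nat) (q : nat -> (nat -> nat) -> nat) (z : nat -> nat).
Hypothesis q0_le : forall n, q 0 n <= 1.
Hypothesis q0_eq0 : forall n, 0 < n 0 -> q 0 n = 0.
(** In these inequalities the dimension of the system induced on Q is q - z; the terms in [z] are
    moved across to avoid natural subtraction. The constant [(2 * d.+1).+1] counts the coefficients
    of a form of degree d + 1 restricted to a conic. *)
Hypothesis conic : forall d n, (forall i, 3 <= i -> n i = 0) ->
  n 0 + n 1 + n 2 <= (2 * d.+1).+1 ->
  q d.+1 n + z d + (n 0 + n 1 + n 2) <= z d.+1 + q d (fun i => (n i).-1) + (2 * d.+1).+1.
Hypothesis elliptic : forall d n, msum r n < 4 * d.+2 ->
  q d.+2 n + z d + msum r n <= z d.+2 + q d (fun i => (n i).-1) + 4 * d.+2.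
Hypothesis tangent : forall d n, n 0 = d.+2 ->
  q d.+1 n + z d <= z d.+1 + q d (fun i => if i == 0 then d else n i).
Hypothesis r_gt2 : 2 < r.

Lemma msum3 n : multseq r n -> n 3 = 0 -> msum r n = n 0 + n 1 + n 2.
Proof.
move=> hn n3; rewrite /msum -(big_mkord xpredT n) (big_cat_nat _ r_gt2) //=.
by rewrite (msum_tail hn n3) addn0 big_mkord !big_ord_recl big_ord0 /= addn0 addnA.
Qed.

(** Each conic step imposes n 0 + n 1 + n 2 conditions on 2 d + 3 = (d + 2)^2 - (d + 1)^2
    coefficients, so the estimates telescope. The bounds n 0 <= d + 1 and n 0 + n 1 + n 2 <= 2 d + 1
    survive the step. *)
Lemma quadric_bound_conic d n : multseq r n -> n 3 = 0 -> n 0 <= d.+1 ->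
  n 0 + n 1 + n 2 <= (2 * d).+1 ->
  q d n + \sum_(i < r) 'C(n i + 1, 2) <= z d + d.+1 ^ 2.
Proof.
elim: d n => [|d IH] n hn n3 n0 hs.
  have [h1 h2] : n 1 <= n 0 /\ n 2 <= n 1 by split; apply: (proj1 hn).
  have e1 : n 1 = 0 by move: hs h1 h2; clear; lia.
  rewrite exp1n; have -> : \sum_(i < r) 'C(n i + 1, 2) = n 0.
    have r0 : 0 < r by move: r_gt2; clear; lia.
    rewrite (bigD1 (Ordinal r0)) //= big1 ?addn0 => [|i i0].
      by move: n0; case: (n 0) => [|[|]].
    have i1 : 1 <= i by rewrite lt0n; apply: contraNneq i0 => e; apply/eqP/val_inj.
    by have := multseq_le hn i1; rewrite e1 leqn0 => /eqP ->.
  case: (posnP (n 0)) => [->|n0p]; first by rewrite addn0 (leq_trans (q0_le n)) ?leq_addl.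
  by rewrite q0_eq0 // add0n (leq_trans n0) ?leq_addl.
have hi i : 3 <= i -> n i = 0.
  by move=> /(multseq_le hn); rewrite n3 leqn0 => /eqP.
have := conic hi hs.
have [h1 h2] : n 1 <= n 0 /\ n 2 <= n 1 by split; apply: (proj1 hn).
have := IH (fun i => (n i).-1) (multseq_pred hn).
rewrite n3 => /(_ erefl) /=.
have p0 : (n 0).-1 <= d.+1 by move: n0; clear; lia.
have ps : (n 0).-1 + (n 1).-1 + (n 2).-1 <= (2 * d).+1 by move: n0 h1 h2 hs; clear; lia.
move=> /(_ p0 ps); rewrite msum_predE msum3 // !expnS !expn0.
by move: (\sum_(i < r) _); clear; lia.
Qed.

(** Elliptic steps are applied until at most three points remain. Such a step keeps the hypotheses
    except when n 0 equals the degree, which is repaired by one tangent step. *)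
Lemma quadric_bound d n : multseq r n -> n 0 <= d ->
  n 0 + n 1 + n 2 + n 3 <= 2 * d -> msum r n < 4 * d ->
  q d n + \sum_(i < r) 'C(n i + 1, 2) <= z d + d.+1 ^ 2.
Proof.
elim/ltn_ind: d n => d IH n hn n0 hs lt.
have [n3|n3] := posnP (n 3).
  by apply: quadric_bound_conic => //; move: n0 hs; clear; lia.
have [h1 h2 h3] : [/\ n 1 <= n 0, n 2 <= n 1 & n 3 <= n 2] by split; apply: (proj1 hn).
have hp := multseq_pred hn.
case: d IH n0 hs lt => [|[|d]] IH n0 hs lt; try by move: h1 h2 h3 n3 n0 hs; clear; lia.
have ell := elliptic lt.
suff : q d (fun i => (n i).-1) + \sum_(i < r) 'C((n i).-1 + 1, 2) <= z d + d.+1 ^ 2.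
  by move: ell; rewrite msum_predE !expnS !expn0; move: (\sum_(i < r) _) (msum r n); clear; lia.
have [nd|nd] := leqP (n 0) d.+1.
  have [n3'|n3'] := posnP (n 3).-1.
    by apply: quadric_bound_conic => //; move: nd hs n3 h1 h2 h3; clear; lia.
  apply: IH => //; try by move: nd hs n3 h1 h2 h3; clear; lia.
  exact: msum_pred_lt lt n3'.
(* After the elliptic step the first point has multiplicity one more than the degree. The tangent
   plane section there splits off, lowering the degree by 1 and this multiplicity by 2 while leaving
   the other multiplicities unchanged. *)
have nd2 : n 0 = d.+2 by move: n0 nd; clear; lia.
case: d IH n0 hs lt ell nd nd2 => [|d] IH n0 hs lt ell nd nd2.
  by move: h1 h2 h3 n3 n0 hs nd2; clear; lia.
have := @tangent d (fun i => (n i).-1); rewrite nd2 => /(_ erefl) tan.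
pose k i := if i == 0 then d else (n i).-1.
have hk : multseq r k.
  split=> [[|i]|[|i] ir] /=; rewrite /k /=.
  - by move: hs nd2 n3 h1 h2 h3; clear; lia.
  - by have := proj1 hn i.+1; clear; lia.
  - by move: (proj2 hn 0 ir); rewrite nd2.
  - by rewrite (proj2 hn).
have split0 (G : nat -> nat) : \sum_(i < r) G (n i).-1 + G d = \sum_(i < r) G (k i) + G d.+2.
  have r0 : 0 < r by move: r_gt2; clear; lia.
  rewrite !(bigD1 (Ordinal r0) isT) /= nd2 {1}/k /=.
  rewrite [in RHS](eq_bigr (fun i : 'I_r => G (n i).-1)) => [|i i0]; last first.
    by rewrite /k; case: eqP => // e; case/eqP: i0; apply: val_inj.
  by move: (\sum_(i < r | _) _) (G _) (G _); clear; lia.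
have kb : q d k + \sum_(i < r) 'C(k i + 1, 2) <= z d + d.+1 ^ 2.
  have [n3'|n3'] := posnP (n 3).-1.
    by apply: quadric_bound_conic; rewrite // /k /=; move: hs nd2 h1 h2 h3 n3; clear; lia.
  apply: IH => //; try by rewrite /k /=; move: hs nd2 h1 h2 h3 n3; clear; lia.
  have sk : msum r (fun i => (n i).-1) + d = msum r k + d.+2 by apply: (split0 id).
  (* With ten positive entries the elliptic step lowers the sum by 10 and the tangent step by 2,
     together 12, the drop from 4 (d + 3) to 4 d. Otherwise nine entries remain, and n 0 = d + 3
     with standardness gives n 1 + n 2 + n 3 <= d + 3, which bounds them all by monotonicity. *)
  have [n9|n9] := posnP (n 9); last first.
    by have := msum_pred hn n9; move: lt sk; clear; lia.
  have := msum_trunc hp (k := 9); rewrite n9 => /(_ erefl).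
  rewrite (sum9 (fun i => (n i).-1)) nd2 /=.
  have h4 := multseq_le hn (isT : 1 <= 4); have h5 := multseq_le hn (isT : 2 <= 5).
  have h6 := multseq_le hn (isT : 3 <= 6); have h7 := multseq_le hn (isT : 1 <= 7).
  have h8 := multseq_le hn (isT : 2 <= 8).
  move: h4 h5 h6 h7 h8 h2 h3 hs n3' sk; rewrite nd2.
  move: (msum _ _) (msum _ _) (n 1) (n 2) (n 3) (n 4) (n 5) (n 6) (n 7) (n 8).
  by clear; lia.
(* Lowering a multiplicity from d + 2 to d removes 2 d + 3 = (d + 2)^2 - (d + 1)^2 conditions, so
   the tangent step leaves the expected dimension unchanged. *)
have e1 : \sum_(i < r) 'C((n i).-1 + 1, 2) = \sum_(i < r) 'C(k i + 1, 2) + (2 * d + 3).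
  have := split0 (fun a => 'C(a + 1, 2)).
  have -> : 'C(d.+2 + 1, 2) = 'C(d + 1, 2) + (2 * d + 3).
    by rewrite !addn1 (binS d.+2) (binS d.+1) !bin1; clear; lia.
  by move: (\sum_(i < r) _) (\sum_(i < r) _); clear; lia.
move: tan kb; rewrite e1 !expnS !expn0 -/k; move: (\sum_(i < r) _); clear; lia.
Qed.
End QuadricBound.

(** The multiplicity forced along the line joining the points 0 and [i]. Index 0, which gives no
    such line, is used for the line joining the points 1 and 2. *)
Definition excess (n : nat -> nat) d i :=
  if i == 0 then n 1 + n 2 - d else n 0 + n i - d.

(* x d n stands for the dimension of the space of forms of degree d with
   multiplicity n i at the i-th point. *)
Section Space.
Variables (r : nat) (x : nat -> (nat -> nat) -> nat).
Implicit Types n : nat -> nat.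

Lemma sum_supp n (G : nat -> nat) k : multseq r n -> (forall i, n i = 0 -> G i = 0) ->
  n k = 0 -> \sum_(i < r) G i = \sum_(i < k) G i.
Proof.
move=> hn hG nk; rewrite -!(big_mkord xpredT G).
have tail a b : n a = 0 -> \sum_(a <= i < b) G i = 0.
  move=> na; rewrite big_nat_cond big1 // => i /andP[/andP[ai _] _]; apply: hG.
  by have := multseq_le hn ai; rewrite na leqn0 => /eqP.
have nr : n r = 0 by exact: (proj2 hn r (leqnn r)).
have [kr|/ltnW rk] := leqP k r.
  by rewrite (big_cat_nat (leq0n k) kr) //= (tail _ r nk) addn0.
by rewrite [RHS](big_cat_nat (leq0n r) rk) //= (tail _ k nr) addn0.
Qed.

(** The excess itself may be 1 here, when n 0 = d + 1, so only the binomial coefficient vanishes. *)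
Lemma excess0 n d i : multseq r n -> n 0 <= d.+1 -> n i = 0 -> 'C(excess n d i + 1, 3) = 0.
Proof.
rewrite /excess => hn n0; case: eqP => [->|_] ni; last first.
  by rewrite bin_small // ni addn0; move: n0; clear; lia.
have h1 := multseq_le hn (isT : 0 <= 1); have h2 := multseq_le hn (isT : 0 <= 2).
by rewrite bin_small //; move: h1 h2; rewrite ni; clear; lia.
Qed.

Lemma bin2_eq0 a : a = 0 -> 'C(a + 2, 3) = 0.
Proof. by move->. Qed.

Definition std d n := n 0 + n 1 + n 2 + n 3 <= 2 * d.

Hypothesis toric : forall d n, multseq r n -> n 4 = 0 -> std d n -> n 0 <= d.+1 ->
  x d n + ('C(n 0 + 2, 3) + 'C(n 1 + 2, 3) + 'C(n 2 + 2, 3) + 'C(n 3 + 2, 3)) =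
  'C(d + 3, 3) + ('C(n 0 + n 1 - d + 1, 3) + 'C(n 0 + n 2 - d + 1, 3) +
    'C(n 0 + n 3 - d + 1, 3) + 'C(n 1 + n 2 - d + 1, 3) +
    'C(n 1 + n 3 - d + 1, 3) + 'C(n 2 + n 3 - d + 1, 3)).

Lemma sum4 (G : nat -> nat) : \sum_(i < 4) G i = G 0 + G 1 + G 2 + G 3.
Proof. by rewrite !big_ord_recl big_ord0 /= !addnA addn0. Qed.

Lemma toric_dim d n : multseq r n -> n 4 = 0 -> std d n -> n 0 <= d.+1 ->
  x d n + \sum_(i < r) 'C(n i + 2, 3) = 'C(d + 3, 3) + \sum_(i < r) 'C(excess n d i + 1, 3).
Proof.
move=> hn n4 hs n0.
rewrite (sum_supp (G := fun i => 'C(n i + 2, 3)) hn (fun i => @bin2_eq0 (n i)) n4).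
rewrite (sum_supp (G := fun i => 'C(excess n d i + 1, 3)) hn (fun i => @excess0 n d i hn n0) n4).
rewrite (sum4 (fun i => 'C(n i + 2, 3))) (sum4 (fun i => 'C(excess n d i + 1, 3))).
rewrite toric //; congr (_ + _); rewrite /excess /=.
have h1 := multseq_le hn (isT : 0 <= 1); have h2 := multseq_le hn (isT : 1 <= 2).
have h3 := multseq_le hn (isT : 2 <= 3).
have e13 : n 1 + n 3 - d = 0 by move: hs h1 h2 h3; rewrite /std; clear; lia.
have e23 : n 2 + n 3 - d = 0 by move: hs h1 h2 h3; rewrite /std; clear; lia.
rewrite e13 e23 !add0n [X in _ + X]bin_small // [X in _ + X + _]bin_small // !addn0.
by rewrite addnC !addnA.
Qed.

Hypothesis x_large : forall d n, multseq r n -> n 0 = d.+1 -> x d n = 0.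
Hypothesis x_quadric : forall d n, multseq r n -> 0 < n 4 -> std d.+2 n -> n 0 <= d.+2 ->
  msum r n < 4 * d.+2 ->
  x d.+2 n + \sum_(i < r) 'C(n i + 1, 2) <= x d (fun i => (n i).-1) + d.+3 ^ 2.

(** The dimension count of restriction to a quadric: forms of degree d + 2 modulo the multiples of
    its equation are the forms of bidegree (d + 2, d + 2). *)
Lemma bin3_sq d : 'C(d.+2 + 3, 3) = 'C(d + 3, 3) + d.+3 ^ 2.
Proof.
have e : d.+2 + 3 = d.+4.+1 by rewrite addn3.
rewrite e addn3 !binS !bin1 !bin0 expnS expn1.
have h2 : 'C(d, 2) * 2 = d * d.-1.
  by clear; elim: d => // d IH; rewrite binS bin1 mulnDl IH; case: d {IH} => // d /=; lia.
move: h2; move: 'C(d, 2) 'C(d, 3); case: d e => [|d] _ /= a b; lia.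
Qed.

(** The disjunction is what the recursion preserves: the bound on the sum can be lost only when n 3
    = 1, and then at most three points remain and the toric count applies. Standardness is kept
    since n 4 > 0 makes the first four entries drop. *)
Lemma space_upper d n : multseq r n -> std d n -> n 0 <= d.+1 ->
  n 4 = 0 \/ msum r n < 4 * d ->
  x d n + \sum_(i < r) 'C(n i + 2, 3) <= 'C(d + 3, 3) + \sum_(i < r) 'C(excess n d i + 1, 3).
Proof.
elim/ltn_ind: d n => d IH n hn hs n0 hC.
have [n4|n4] := posnP (n 4); first by rewrite toric_dim.
have [h1 h2 h3 h4] : [/\ n 1 <= n 0, n 2 <= n 1, n 3 <= n 2 & n 4 <= n 3].
  by split; apply: (proj1 hn).
have {hC} lt : msum r n < 4 * d by case: hC => // e; rewrite e in n4.
have r0 : 0 < r by rewrite lt0n; apply: contraTneq n4 => r0; rewrite (proj2 hn) // r0.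
move: n0; rewrite leq_eqVlt => /predU1P[nd|n0].
  (* Now 'C(n 0 + 2, 3) equals 'C(d + 3, 3), and the excess at i > 0 is n i + 1, so the two sides
     match term by term up to the non-negative term of index 0. *)
  rewrite x_large // add0n !(bigD1 (Ordinal r0) isT) /= nd.
  have -> : d.+1 + 2 = d + 3 by clear; lia.
  rewrite leq_add2l; apply: leq_trans (leq_addl _ _).
  apply: leq_sum => i i0; rewrite /excess nd.
  case: eqP => [e|_]; first by case/eqP: i0; apply: val_inj.
  by apply: leq_bin2l; clear; lia.
case: d IH hs n0 lt => [|[|d]] IH hs n0 lt; try by move: hs h1 h2 h3 h4 n4; rewrite /std; clear; lia.
have hp := multseq_pred hn.
have := x_quadric hn n4 hs n0 lt.
have : x d (fun i => (n i).-1) + \sum_(i < r) 'C((n i).-1 + 2, 3) <=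
    'C(d + 3, 3) + \sum_(i < r) 'C(excess (fun i => (n i).-1) d i + 1, 3).
  apply: IH => //.
  - by move: hs h1 h2 h3 h4 n4; rewrite /std; clear; lia.
  - by move: n0; clear; lia.
  have [n3|n3] := posnP (n 3).-1; last by right; apply: msum_pred_lt lt n3.
  by left; move: n3 h4; clear; lia.
have -> : \sum_(i < r) 'C(n i + 2, 3) =
    \sum_(i < r) 'C((n i).-1 + 2, 3) + \sum_(i < r) 'C(n i + 1, 2).
  rewrite -big_split; apply: eq_bigr => i _ /=.
  by case: (n i) => // k /=; rewrite !addn2 !addn1 binS.
(* Two multiplicities drop by 1 and the degree by 2, so the excess is unchanged where n i > 0; where
   n i = 0 both binomial coefficients vanish. *)
have -> : \sum_(i < r) 'C(excess (fun i => (n i).-1) d i + 1, 3) =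
    \sum_(i < r) 'C(excess n d.+2 i + 1, 3).
  apply: eq_bigr => i _; have [ni|ni] := posnP (n i).
    rewrite !(@excess0 _ _ i) //; first by move: n0; clear; lia.
    - by move: n0; clear; lia.
    by rewrite ni.
  rewrite /excess; case: eqP => _; congr 'C(_ + 1, 3); last by move: ni n4 h1 h2 h3 h4; clear; lia.
  by move: n4 h1 h2 h3 h4; clear; lia.
rewrite bin3_sq; move: (x _ _) (x _ _) (\sum_(i < r) _) (\sum_(i < r) _).
by move: (\sum_(i < r) _) ('C(d + 3, 3)) (d.+3 ^ 2); clear; lia.
Qed.

Definition trunc s n i := if i < s then n i else 0.

Hypothesis x_ext : forall d n n', (forall i, i < r -> n i = n' i) -> x d n = x d n'.
Hypothesis x_add : forall d n s, multseq r n -> 3 < s -> s < r -> n 0 <= d.+1 ->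
  x d (trunc s n) + 'C(n 0 + n s - d + 1, 3) <= x d (trunc s.+1 n) + 'C(n s + 2, 3).

Lemma trunc_multseq s n : multseq r n -> multseq r (trunc s n).
Proof.
move=> [h h0]; split=> [i|i ir]; rewrite /trunc; last by rewrite h0 ?if_same.
by case: ltnP => // si; rewrite (ltnW si) h.
Qed.

(** Equality holds for the first four points, and by [x_add] each later point [s] costs at most its
    own conditions less the correction of the line joining it to the point 0. *)
Lemma space_lower d n : multseq r n -> std d n -> n 0 <= d.+1 ->
  'C(d + 3, 3) + \sum_(i < r) 'C(excess n d i + 1, 3) <= x d n + \sum_(i < r) 'C(n i + 2, 3).
Proof.
move=> hn hs n0.
have base : 'C(d + 3, 3) + \sum_(i < 4) 'C(excess n d i + 1, 3) =
    x d (trunc 4 n) + \sum_(i < 4) 'C(n i + 2, 3).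
  have h4 := trunc_multseq 4 hn.
  have := toric_dim h4 erefl hs n0.
  rewrite (sum_supp (G := fun i => 'C(trunc 4 n i + 2, 3)) (k := 4) h4 (fun i => @bin2_eq0 _)) //.
  rewrite (sum_supp (G := fun i => 'C(excess (trunc 4 n) d i + 1, 3)) h4 (fun i => @excess0 _ d i h4 n0) (k := 4)) //.
  rewrite (sum4 (fun i => 'C(trunc 4 n i + 2, 3))) (sum4 (fun i => 'C(excess (trunc 4 n) d i + 1, 3))).
  by rewrite (sum4 (fun i => 'C(n i + 2, 3))) (sum4 (fun i => 'C(excess n d i + 1, 3))) => ->.
have [r4|r4] := leqP r 4.
  have e4 : n 4 = 0 by apply: (proj2 hn).
  by rewrite toric_dim.
have step s : 4 <= s -> s <= r -> 'C(d + 3, 3) + \sum_(i < s) 'C(excess n d i + 1, 3) <=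
    x d (trunc s n) + \sum_(i < s) 'C(n i + 2, 3).
  elim: s => // s IH; rewrite leq_eqVlt => /predU1P[[<-] _|s4 sr]; first by rewrite base.
  have := IH s4 (ltnW sr); have := x_add hn s4 sr n0.
  rewrite !big_ord_recr /= {3}/excess; case: eqP => [s0|_]; first by rewrite s0 in s4.
  move: (x _ _) (x _ _) (\sum_(i < s) _) (\sum_(i < s) _) ('C(d + 3, 3)) ('C(n s + 2, 3)).
  by move: ('C(n 0 + n s - d + 1, 3)); clear; lia.
have := step r (ltnW r4) (leqnn r); rewrite (@x_ext d (trunc r n) n) // => i ir.
by rewrite /trunc ir.
Qed.
End Space.

Import GRing.Theory.
Local Open Scope ring_scope.

(** * Multiplicity of a polynomial at a point *)

Lemma rmorph_mmap n (R : nzRingType) (A B : comNzRingType) (psi : {rmorphism A -> B})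
    (f : {rmorphism R -> A}) (h : 'I_n -> A) (p : {mpoly R[n]}) :
  psi (mmap f h p) = mmap (psi \o f) (psi \o h) p.
Proof.
rewrite /mmap rmorph_sum; apply: eq_bigr => m _ /=.
rewrite rmorphM /mmap1 rmorph_prod; congr (_ * _).
by apply: eq_bigr => i _; rewrite rmorphXn.
Qed.

Lemma eq_mmap n (R A : nzRingType) (f f' : R -> A) (h h' : 'I_n -> A) (p : {mpoly R[n]}) :
  f =1 f' -> h =1 h' -> mmap f h p = mmap f' h' p.
Proof.
move=> ef eh; rewrite /mmap; apply: eq_bigr => m _.
by rewrite ef (mmap1_eq _ eh).
Qed.

Lemma mmap_meval n (K : comNzRingType) (v : 'I_n -> K) (p : {mpoly K[n]}) : mmap idfun v p = p.@[v].
Proof. by []. Qed.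

Section HomogMmap.
Variables (n d : nat) (R : nzRingType) (A : comNzRingType) (f : {rmorphism R -> A}).

Lemma mmap1_scale (c : A) (h : 'I_n -> A) (m : 'X_{1..n}) :
  mmap1 (fun i => c * h i) m = c ^+ mdeg m * mmap1 h m.
Proof.
rewrite /mmap1 mdegE -prodrXr -big_split /=.
by apply: eq_bigr => i _; rewrite exprMn.
Qed.

Lemma mmap_scale (c : A) (h : 'I_n -> A) (p : {mpoly R[n]}) : p \is d.-homog ->
  mmap f (fun i => c * h i) p = c ^+ d * mmap f h p.
Proof.
move=> /dhomogP hp; rewrite /mmap mulr_sumr big_seq [RHS]big_seq.
by apply: eq_bigr => m /hp /= dm; rewrite mmap1_scale dm mulrCA.
Qed.
End HomogMmap.

Section Order.
Variable R : idomainType.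
Implicit Types A B G : {poly R}.

Lemma polyX_factor A : A`_0 = 0 -> exists A', A = 'X * A'.
Proof.
move=> A0; exists (\poly_(i < (size A).-1) A`_i.+1).
apply/polyP => -[|i]; rewrite coefXM //= coef_poly.
case: ltnP => // le; rewrite nth_default //.
by apply: leq_trans (leqSpred _) _; rewrite ltnS.
Qed.

Lemma Xn_mul_unit A B m : A`_0 != 0 -> (exists G, A * B = 'X^m * G) ->
  exists B', B = 'X^m * B'.
Proof.
move=> A0; elim: m B => [|m IH] B [G eG]; first by exists B; rewrite expr0 mul1r.
have B0 : B`_0 = 0.
  have := congr1 (fun p : {poly R} => p`_0) eG.
  rewrite coef0M exprS -mulrA coefXM eqxx => /eqP.
  by rewrite mulf_eq0 (negPf A0) => /eqP.
have [B1 eB] := polyX_factor B0.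
have [|B' eB'] := IH B1.
  exists G; apply: (mulfI (negbT (polyX_eq0 R))).
  by rewrite [RHS]mulrA -exprS -eG eB mulrCA.
by exists B'; rewrite eB eB' mulrA -exprS.
Qed.

Lemma Xn_mul A B m e : ~ (exists A', A = 'X^(e.+1) * A') ->
  (exists G, A * B = 'X^m * G) -> exists B', B = 'X^(m - e) * B'.
Proof.
elim: e A m => [|e IH] A m nA eAB; have [A0|A0] := eqVneq A`_0 0.
- by have [A1 eA] := polyX_factor A0; case: nA; exists A1; rewrite expr1.
- by rewrite subn0; apply: Xn_mul_unit eAB.
- have [A1 eA] := polyX_factor A0; case: m eAB => [|m] [G eG].
    by exists B; rewrite expr0 mul1r.
  rewrite subSS; apply: (IH A1).
    by move=> [A' eA']; apply: nA; exists A'; rewrite eA eA' mulrA -exprS.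
  exists G; apply: (mulfI (negbT (polyX_eq0 R))).
  by rewrite [RHS]mulrA -exprS -eG eA -!mulrA.
- have [B' ->] := Xn_mul_unit A0 eAB.
  have [le|/ltnW le] := leqP m e.+1.
    by exists ('X^m * B'); rewrite (eqP le) expr0 mul1r.
  by exists ('X^(e.+1) * B'); rewrite mulrA -exprD subnK.
Qed.
End Order.

Section Mult.
Variables (K : fieldType) (n : nat).
Implicit Types (x : 'I_n -> K) (F H : {mpoly K[n]}).

Definition gline x : {mpoly K[n]} -> {poly {mpoly K[n]}} :=
  mmap (polyC \o @mpolyC n K) (fun i => (x i)%:MP%:P + 'X * ('X_i)%:P).

HB.instance Definition _ x := GRing.RMorphism.copy (gline x)
  (mmap (polyC \o @mpolyC n K) (fun i => (x i)%:MP%:P + 'X * ('X_i)%:P)).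

Lemma gline_mmap x k (f : {rmorphism K -> {mpoly K[n]}}) h (p : {mpoly K[k]}) :
  gline x (mmap f h p) = mmap (gline x \o f) (gline x \o h) p.
Proof. exact: (rmorph_mmap (gline x)). Qed.

(* Multiplicity at least m at x: the order in t of F(x + t Z) for a generic Z. *)
Definition mult F x m := exists G, gline x F = 'X^m * G.

Lemma gline_eval F x (A : comNzRingType) (f : {rmorphism K -> A}) (t : A) (z : 'I_n -> A) :
  mmap f (fun i => f (x i) + t * z i) F = (map_poly (mmap f z) (gline x F)).[t].
Proof.
pose ev : {rmorphism {poly {mpoly K[n]}} -> A} := horner_eval t \o map_poly (mmap f z).
rewrite -[RHS]/(ev (gline x F)) /gline rmorph_mmap.
apply: eq_mmap => [c|i] /=; rewrite /horner_eval.
  by rewrite map_polyC hornerC /= mmapC.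
rewrite rmorphD rmorphM /= !map_polyC map_polyX /= !mmapC mmapX mmap1U.
by rewrite hornerD hornerM hornerX !hornerC.
Qed.

Lemma mult_subst F x m : mult F x m ->
  forall (A : comNzRingType) (f : {rmorphism K -> A}) (t : A) (z : 'I_n -> A),
  exists G, mmap f (fun i => f (x i) + t * z i) F = t ^+ m * G.
Proof.
move=> [G eG] A f t z; exists (map_poly (mmap f z) G).[t].
by rewrite gline_eval eG rmorphM /= rmorphXn /= map_polyX hornerM hornerXn.
Qed.

Lemma mult0 F x : mult F x 0.
Proof. by exists (gline x F); rewrite expr0 mul1r. Qed.

Lemma multW F x m m' : (m' <= m)%N -> mult F x m -> mult F x m'.
Proof.
move=> le [G eG]; exists ('X^(m - m') * G).
by rewrite eG mulrA -exprD subnKC.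
Qed.

Lemma mult_lin F H x m a : mult F x m -> mult H x m -> mult (a *: F + H) x m.
Proof.
move=> [G eG] [G' eG']; exists (a%:MP%:P * G + G').
by rewrite rmorphD /= eG' /gline mmapZ /= -/(gline x F) eG mulrDr mulrCA.
Qed.

Lemma mult_zero x m : mult 0 x m.
Proof. by exists 0; rewrite rmorph0 mulr0. Qed.

Lemma mult_mul F H x m : mult F x m -> mult (H * F) x m.
Proof.
by move=> [G eG]; exists (gline x H * G); rewrite rmorphM /= eG mulrCA.
Qed.

(** The order in t is additive because the coefficients of [gline] lie in a domain; the negated
    hypothesis says that H has order at most [e]. *)
Lemma mult_div H F x m e : ~ mult H x e.+1 -> mult (H * F) x m -> mult F x (m - e).
Proof.
move=> nH [G eG]; apply: (Xn_mul nH); exists G.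
by rewrite -rmorphM.
Qed.

Lemma mult_eval F x m y : mult F x m ->
  'X^m %| mmap polyC (fun i => (x i)%:P + 'X * y i) F.
Proof.
move=> /mult_subst/(_ {poly K} polyC 'X y) [G ->].
exact: dvdp_mulr.
Qed.

End Mult.

Lemma mmap_congr n (R : nzRingType) (A : comNzRingType) (f : {rmorphism R -> A})
    (t : A) (a b : 'I_n -> A) (p : {mpoly R[n]}) :
  exists G, mmap f (fun i => a i + t * b i) p = mmap f a p + t * G.
Proof.
pose P : {poly A} := mmap (polyC \o f) (fun i => (a i)%:P + 'X * (b i)%:P) p.
have PE s : P.[s] = mmap f (fun i => a i + s * b i) p.
  rewrite -[LHS]/(horner_eval s P) rmorph_mmap.
  by apply: eq_mmap => [c|i] /=; rewrite /horner_eval !hornerE.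
have [Q eQ] : exists Q, P = (P.[0])%:P + 'X * Q.
  exists (drop_poly 1 P); rewrite -{1}[P](poly_take_drop 1) expr1 commr_polyX.
  congr (_ + _); apply/polyP => i; rewrite coef_take_poly coefC horner_coef0.
  by case: i.
exists Q.[t]; rewrite -PE {1}eQ !hornerE PE; congr (_ + _).
by apply: eq_mmap => // i; rewrite mul0r addr0.
Qed.

Section Mult.
Variables (K : fieldType).

(** The generic line through c x is c times the line through x with direction Z / c, and homogeneity
    extracts c^d. *)
Lemma mult_scale n d (F : {mpoly K[n]}) (x y : 'I_n -> K) c m : F \is d.-homog ->
  c != 0 -> (forall i, y i = c * x i) -> mult F x m -> mult F y m.
Proof.
move=> hF c0 ey mF.
have [G eG] := mult_subst mF (polyC \o @mpolyC n K) 'X (fun i => (c^-1 *: 'X_i)%:P).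
exists (c%:MP%:P ^+ d * G).
rewrite mulrCA -eG /gline -mmap_scale //.
apply: eq_mmap => // i; rewrite ey mulrDr; congr (_ + _).
  by rewrite -polyCM -mpolyCM.
have idn (A : comNzRingType) (a b t z : A) : a * b = 1 -> t * z = a * (t * (b * z)).
  by move=> ab; rewrite mulrCA [a * _]mulrA ab mul1r.
rewrite -mul_mpolyC polyCM; apply: idn.
by rewrite -polyCM -mpolyCM (divff c0) mpolyC1 polyC1.
Qed.

Lemma gline_const n (x : 'I_n -> K) (H : {mpoly K[n]}) :
  exists z, gline x H = (H.@[x])%:MP%:P + 'X * z.
Proof.
have [G eG] := mmap_congr (polyC \o @mpolyC n K) 'X (fun i => (x i)%:MP%:P)
  (fun i => ('X_i)%:P) H.
exists G; rewrite /gline eG; congr (_ + _).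
pose f : {rmorphism K -> {poly {mpoly K[n]}}} := polyC \o @mpolyC n K.
by rewrite -[RHS]/(f _) /meval rmorph_mmap.
Qed.

Lemma mult_comp n k (F : {mpoly K[n]}) (h : n.-tuple {mpoly K[k]}) (x : 'I_n -> K)
    (u : 'I_k -> K) m : (forall i, x i = (tnth h i).@[u]) ->
  mult F x m -> mult (F \mPo h) u m.
Proof.
move=> ex mF.
have /fin_all_exists [z ez] : forall i, exists z, gline u (tnth h i) = (x i)%:MP%:P + 'X * z.
  by move=> i; rewrite ex; apply: gline_const.
have [G eG] := mult_subst mF (polyC \o @mpolyC k K) 'X z.
exists G; rewrite -eG gline_mmap.
by apply: eq_mmap => [c|i] /=; rewrite ?ez // /gline mmapC.
Qed.

Lemma poly_low_coef (R : nzRingType) (P : {poly R}) m :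
  (forall i, (i < m)%N -> P`_i = 0) -> exists G, P = 'X^m * G.
Proof.
move=> h; exists (drop_poly m P); rewrite -{1}[P](poly_take_drop m) commr_polyXn.
suff -> : take_poly m P = 0 by rewrite add0r.
by apply/polyP => i; rewrite coef_take_poly coef0; case: ltnP => // /h.
Qed.

Lemma mult_vanishes (x : 'rV[K]_4) m F :
  mult F (x 0) m -> vanishes_along_exc x m F.
Proof.
move=> mF j k xj kj.
have [G eG] := mult_subst mF (@mpolyC 4 K) 'X_k
  (fun l => if l == j then 0 else if l == k then 1 else 'X_l).
exists G; rewrite -eG; apply: eq_mmap => // l.
rewrite tnth_mktuple; case: ifP => [_|_]; first by rewrite mulr0.
by case: ifP => [/eqP->|_]; rewrite ?mulr1.
Qed.

(* The generic line x + t Z is moved into the chart by dividing it by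
   c = 1 + eta t, which keeps its j-th coordinate constant; e is the inverse of c
   modulo t^m. *)
Lemma vanishes_mult_field (L : fieldType) (io : {rmorphism {mpoly K[4]} -> L})
    (x : 'rV[K]_4) m d F : injective io -> x != 0 -> F \is d.-homog ->
  vanishes_along_exc x m F -> mult F (x 0) m.
Proof.
move=> inj_io x0 hF vF.
have io_eq0 P : (io P == 0) = (P == 0) by rewrite -(inj_eq inj_io) rmorph0.
have [j xj] : exists j, x 0 j != 0 by apply/rV0Pn.
have [k kj] : exists k : 'I_4, k != j.
  by case: (eqVneq j 0) => [->|h]; [exists 1 | exists 0; rewrite eq_sym].
have [G eG] := vF j k xj kj.
pose f : {rmorphism K -> {poly L}} := polyC \o io \o @mpolyC 4 K.
have fE a : f a = (io a%:MP)%:P by [].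
pose Z (l : 'I_4) : L := io 'X_l.
pose xL (l : 'I_4) : L := io (x 0 l)%:MP.
have xLj : xL j != 0 by rewrite io_eq0 mpolyC_eq0.
(* Then x + t Z = (1 + eta t) x + t Z', where Z' has vanishing j-th coordinate and therefore stays
   in the chart x_j constant. *)
pose eta := Z j / xL j.
pose Z' l := Z l - eta * xL l.
have Z'j : Z' j = 0 by rewrite /Z' /eta divfK // subrr.
have Z'k : Z' k != 0.
  apply/eqP => Z'k0.
  have : io ((x 0 j)%:MP * 'X_k - (x 0 k)%:MP * 'X_j) = 0.
    rewrite rmorphB !rmorphM /= -/(xL j) -/(xL k) -/(Z j) -/(Z k).
    have -> : xL j * Z k - xL k * Z j = xL j * Z' k.
      by rewrite /Z' /eta; field.
    by rewrite Z'k0 mulr0.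
  move/eqP; rewrite io_eq0 => /eqP/(congr1 (mcoeff U_(k))).
  rewrite mcoeffB !mcoeffCM !mcoeffXU eqxx eq_sym (negPf kj).
  by rewrite mulr0 subr0 mulr1 mcoeff0 => /eqP; rewrite (negPf xj).
pose e : {poly L} := \sum_(s < m) (- (eta%:P * 'X)) ^+ s.
pose c : {poly L} := 1 + eta%:P * 'X.
have ec : c * e = 1 - (- eta%:P) ^+ m * 'X^m.
  rewrite -exprMn mulNr; set y := - (eta%:P * 'X).
  have -> : c = - (y - 1) by rewrite opprB /y opprK.
  by rewrite mulNr -subrX1 opprB.
(* The chart coordinates of x + e t Z': y_k = e t Z'_k and y_l = Z'_l / Z'_k. Divisibility of the
   pull-back by y_k^m thus becomes divisibility by t^m. *)
pose z l := if l == k then e * 'X * (Z' k)%:P else (Z' l / Z' k)%:P.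
have key : mmap f (fun l => f (x 0 l) + e * 'X * (Z' l)%:P) F =
    (e * 'X * (Z' k)%:P) ^+ m * mmap f z G.
  have := congr1 (mmap f z) eG.
  rewrite rmorphM rmorphXn /= mmapX mmap1U {2}/z eqxx => <-.
  rewrite /comp_mpoly (rmorph_mmap (mmap f z)); apply: eq_mmap => [a|l].
    by rewrite /= mmapC.
  rewrite [RHS]/= tnth_mktuple mmapD mmapC; congr (_ + _).
  case: eqVneq => [->|lj]; first by rewrite rmorph0 Z'j mulr0.
  case: eqVneq => [->|lk]; first by rewrite mmapX mmap1U /z eqxx.
  rewrite rmorphM /= !mmapX !mmap1U /z eqxx (negPf lk) -!mulrA -polyCM.
  by rewrite [Z' k * _]mulrCA divff // mulr1.
(* Since c e = 1 - (- eta)^m t^m, the point c (x + e t Z') differs from x + t Z by a multiple of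
   t^m, which does not affect divisibility by t^m. *)
have [G2 eG2] := mmap_congr f 'X^m (fun l => f (x 0 l) + 'X * (Z l)%:P)
  (fun l => - (- eta%:P) ^+ m * ('X * (Z' l)%:P)) F.
have [G3 eG3] : exists G3, mmap f (fun l => f (x 0 l) + 'X * (Z l)%:P) F = 'X^m * G3.
  exists (c ^+ d * ((e * (Z' k)%:P) ^+ m * mmap f z G) - G2).
  rewrite mulrBr; apply/eqP; rewrite eq_sym subr_eq -eG2; apply/eqP.
  transitivity (c ^+ d * mmap f (fun l => f (x 0 l) + e * 'X * (Z' l)%:P) F).
    rewrite key mulrCA; congr (_ * _); rewrite mulrA -exprMn; congr (_ ^+ _ * _).
    by rewrite mulrCA mulrA.
  rewrite -mmap_scale //; apply: eq_mmap => // l.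
  have -> : c * (f (x 0 l) + e * 'X * (Z' l)%:P) =
      c * f (x 0 l) + (c * e) * ('X * (Z' l)%:P) by rewrite mulrDr !mulrA.
  rewrite ec /c fE -/(xL l) /Z' polyCB (polyCM eta).
  have idn (A : comNzRingType) (h t a b mu T : A) : (1 + h * t) * a +
      (1 - mu * T) * (t * (b - h * a)) = a + t * b + T * (- mu * (t * (b - h * a))).
    by ring.
  exact: idn.
apply: poly_low_coef => i im.
apply/eqP; rewrite -io_eq0; apply/eqP.
have e3 : mmap f (fun l => f (x 0 l) + 'X * (Z l)%:P) F = map_poly io (gline (x 0) F).
  rewrite /gline (rmorph_mmap (map_poly io)); apply: eq_mmap => [a|l].
    by rewrite /= map_polyC.
  by rewrite /= rmorphD rmorphM /= !map_polyC map_polyX.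
have := congr1 (fun p : {poly L} => p`_i) eG3.
by rewrite e3 coef_map coefXnM im.
Qed.

Lemma vanishes_mult (x : 'rV[K]_4) m d F : x != 0 -> F \is d.-homog ->
  vanishes_along_exc x m F -> mult F (x 0) m.
Proof.
have inj : injective (@tofrac {mpoly K[4]} : {rmorphism _ -> _}).
  by move=> a b /eqP; rewrite tofrac_eq => /eqP.
exact: (vanishes_mult_field inj).
Qed.

End Mult.

(** * Polynomials vanishing at points of a double cover of the line *)

Section DimBounds.
Variables (K : fieldType) (vT : vectType K).
Implicit Types U V W : {vspace vT}.

Lemma dim_le_ker N (g : {linear vT -> 'rV[K]_N}) U W :
  (forall v, v \in U -> g v = 0 -> v \in W) -> (\dim U <= N + \dim W)%N.
Proof.
move=> h; rewrite -(limg_ker_dim (linfun g) U) addnC leq_add //.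
  have := dimvS (subvf (linfun g @: U)%VS).
  by rewrite dimvf /dim /= mul1n.
apply: dimvS; apply/subvP => v; rewrite memv_cap memv_ker => /andP[vU].
by rewrite lfunE /= => /eqP; apply: h.
Qed.

Lemma dim_ge2P U : (1 < \dim U)%N -> exists u v, [/\ u \in U, v \in U &
  forall a b, a *: u + b *: v = 0 -> a = 0 /\ b = 0].
Proof.
move=> dU; exists (vbasis U)`_0, (vbasis U)`_1.
have sz := size_tuple (vbasis U).
have mem i : (i < \dim U)%N -> (vbasis U)`_i \in U.
  by move=> iU; apply/vbasis_mem/mem_nth; rewrite sz.
have dU0 : (0 < \dim U)%N by apply: ltn_trans dU.
split; [exact: mem | exact: mem |].
have /freeP fr := basis_free (vbasisP U).
move=> a b eab.
pose k (i : 'I_(\dim U)) := if val i == 0%N then a else if val i == 1%N then b else 0.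
have := fr k; rewrite (bigD1 (Ordinal dU0)) //= (bigD1 (Ordinal dU)) //= {1 2}/k /=.
rewrite big1 => [|i /andP[i0 i1]]; last first.
  rewrite /k -val_eqE /= in i0 *; rewrite -val_eqE /= in i1.
  by rewrite (negPf i0) (negPf i1) scale0r.
rewrite addr0 => /(_ eab) h.
by split; [have := h (Ordinal dU0) | have := h (Ordinal dU)].
Qed.
End DimBounds.

Section PolyOrder.
Variable K : fieldType.
Implicit Types (P Q : {poly K}) (s : K).

(** The Taylor coefficient of order [i] at [s]. *)
Definition tcoef s i P := (P \Po ('X + s%:P))`_i.

Lemma tcoef_lin s i a P Q : tcoef s i (a *: P + Q) = a * tcoef s i P + tcoef s i Q.
Proof. by rewrite /tcoef comp_polyD comp_polyZ coefD coefZ. Qed.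

Lemma XsubC_expP s m P :
  reflect (forall i, (i < m)%N -> tcoef s i P = 0) (('X - s%:P) ^+ m %| P).
Proof.
apply: (iffP idP) => [/dvdpP[Q ->] i im|h].
  rewrite /tcoef comp_polyM rmorphXn /= comp_polyB comp_polyX comp_polyC.
  by rewrite addrK coefMXn im.
rewrite -[P](comp_polyXaddC_K P s).
have -> : ('X - s%:P) ^+ m = 'X^m \Po ('X - s%:P) by rewrite rmorphXn /= comp_polyX.
apply: dvdp_comp_poly.
rewrite -[X in _ %| X](poly_take_drop m) dvdp_addr ?dvdp_mull //.
suff -> : take_poly m (P \Po ('X + s%:P)) = 0 by apply: dvdp0.
by apply/polyP => i; rewrite coef_take_poly coef0; case: ltnP => // /h.
Qed.

Lemma coprimep_prodl (I : Type) (r : seq I) (P : pred I) (F : I -> {poly K}) Q :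
  (forall i, P i -> coprimep (F i) Q) -> coprimep (\prod_(i <- r | P i) F i) Q.
Proof.
move=> h; elim/big_ind: _ => [|a b ha hb|]; first exact: coprime1p.
  by rewrite coprimepMl ha hb.
exact: h.
Qed.

Variables (I : finType) (s : I -> K).
Hypothesis s_inj : injective s.

Lemma prod_XsubC_dvdp (m : I -> nat) P :
  (forall i, ('X - (s i)%:P) ^+ m i %| P) -> \prod_i ('X - (s i)%:P) ^+ m i %| P.
Proof.
move=> h; rewrite -big_enum; have := enum_uniq I; elim: (enum I) => [|i r IH] /=.
  by rewrite big_nil dvd1p.
move=> /andP[ir ur]; rewrite big_cons Gauss_dvdp ?h ?IH //.
rewrite coprimep_sym big_seq; apply: coprimep_prodl => j jr.
apply/coprimep_expl/coprimep_expr/coprimep_XsubC2.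
by rewrite subr_eq0; apply: contraNneq ir => /s_inj ->.
Qed.

Lemma size_prod_XsubC_exp (m : I -> nat) :
  size (\prod_i ('X - (s i)%:P) ^+ m i) = (\sum_i m i).+1.
Proof.
rewrite size_prod => [|i _]; last by rewrite expf_neq0 ?polyXsubC_eq0.
rewrite (eq_bigr (fun i => m i + 1)%N) => [|i _]; last first.
  by rewrite size_exp_XsubC addn1.
by rewrite big_split /= sum1_card -addSn addnK.
Qed.

Lemma monic_prod_XsubC_exp (m : I -> nat) : \prod_i ('X - (s i)%:P) ^+ m i \is monic.
Proof. by apply: monic_prod => i _; rewrite monic_exp ?monicXsubC. Qed.

Lemma dvdp_size_eq0 (m : I -> nat) P : (forall i, ('X - (s i)%:P) ^+ m i %| P) ->
  (size P <= \sum_i m i)%N -> P = 0.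
Proof.
move=> h le; apply/eqP; apply: contraTT le => P0.
rewrite -ltnNge -size_prod_XsubC_exp; apply: dvdp_leq => //.
exact: prod_XsubC_dvdp.
Qed.

(** Division by the product of the (X - s_i)^(m_i) maps U, modulo W, injectively into the
    polynomials of size at most n minus the sum of the m_i. *)
Lemma dim_poly_vanish (vT : vectType K) (A : {linear vT -> {poly K}})
    (U W : {vspace vT}) n (m : I -> nat) :
  (forall v, v \in U -> (size (A v) <= n)%N) ->
  (forall v i, v \in U -> ('X - (s i)%:P) ^+ m i %| A v) ->
  (forall v, v \in U -> A v = 0 -> v \in W) ->
  (\sum_i m i <= n)%N -> (\dim U + \sum_i m i <= n + \dim W)%N.
Proof.
move=> hs hd hk le; set D := \prod_i ('X - (s i)%:P) ^+ m i.
pose g0 v : 'rV[K]_(n - \sum_i m i) := poly_rV (A v %/ D).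
have g_lin : linear g0.
  by move=> a u v; rewrite /g0 linearP divpD divpZl linearP.
pose g : {linear vT -> 'rV[K]_(n - \sum_i m i)} :=
  HB.pack g0 (GRing.isLinear.Build _ _ _ _ g0 g_lin).
have : (\dim U <= (n - \sum_i m i) + \dim W)%N.
  apply: (@dim_le_ker _ _ _ g) => v vU gv; apply: hk => //.
  have dv : D %| A v by apply: prod_XsubC_dvdp => i; apply: hd.
  rewrite -(divpK dv); have := congr1 (@rVpoly _ _) gv.
  rewrite poly_rV_K => [->|]; first by rewrite linear0 mul0r.
  rewrite size_divp ?monic_neq0 ?monic_prod_XsubC_exp // size_prod_XsubC_exp.
  exact: leq_sub2r (hs v vU).
lia.
Qed.
End PolyOrder.

Section Elliptic.
Variables (K : fieldType) (f : {poly K}).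
Hypothesis (f_nsq : forall h : {poly K}, f <> h ^+ 2) (f_size : (size f <= 5)%N).
Implicit Types a b : {poly K}.

(** The difference a^2 - b^2 f is the norm of a + b y, and adjoining a square root y of the
    non-square f to K(s) gives a field. *)
Lemma norm_eq0 a b : a ^+ 2 = b ^+ 2 * f -> a = 0 /\ b = 0.
Proof.
have [-> |b0] := eqVneq b 0.
  by rewrite expr0n mul0r => /eqP; rewrite sqrf_eq0 => /eqP.
move=> e; have : b %| a by rewrite -(@dvdp_pexp2r _ _ _ 2) // e dvdp_mulr.
move=> /dvdpP[h eh]; case: (f_nsq (h := h)).
by apply: (mulfI (expf_neq0 2 b0)); rewrite -e eh exprMn mulrC.
Qed.

Lemma common_factor a b a' b' : a * b' = a' * b -> (a, b) != 0 ->
  exists u u' al be, [/\ (al, be) != 0, a = u * al, b = u * be, a' = u' * al & b' = u' * be].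
Proof.
move=> e ab0; pose u := gcdp a b.
have u0 : u != 0.
  by apply: contraNneq ab0 => /eqP; rewrite gcdp_eq0 => /andP[/eqP-> /eqP->].
have [/dvdpP[al ea] /dvdpP[be eb]] := (dvdp_gcdl a b, dvdp_gcdr a b).
rewrite -/u in ea eb.
have cop : coprimep al be.
  have := gcdp_mul2r al be u; rewrite -ea -eb -/u => /eqp_size.
  have g0 : gcdp al be != 0.
    apply: contraNneq ab0 => /eqP; rewrite gcdp_eq0 => /andP[/eqP al0 /eqP be0].
    by rewrite ea eb al0 be0 !mul0r.
  rewrite size_mul // => h; rewrite /coprimep; apply/eqP; move: h g0 u0.
  by rewrite -!size_poly_gt0; lia.
have e' : al * b' = a' * be.
  by apply: (mulfI u0); rewrite [LHS]mulrA [u * al]mulrC -ea e eb; ring.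
have ab'0 : (al, be) != 0.
  by apply: contraNneq ab0 => -[al0 be0]; rewrite ea eb al0 be0 !mul0r.
have [al0|al0] := eqVneq al 0.
  have be0 : be != 0 by apply: contraNneq ab'0 => ->; rewrite al0.
  have : be %| b'.
    by move: cop; rewrite al0 coprime0p => /eqp_dvdl ->; apply: dvd1p.
  move=> /dvdpP[u' eu']; exists u, u', al, be; split=> //; try by rewrite mulrC.
  by apply: (mulIf be0); rewrite -e' al0 mulr0 !mul0r.
have : al %| a'.
  by rewrite -(Gauss_dvdpl _ cop) -e' dvdp_mulr.
move=> /dvdpP[u' eu']; exists u, u', al, be; split=> //; try by rewrite mulrC.
by apply: (mulfI al0); rewrite e' eu'; ring.
Qed.

Variables (I : finType) (s : I -> K) (Y : I -> {poly K}).
Hypothesis s_inj : injective s.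

(* The elliptic curve y^2 = f(s) carries no pencil of degree 1: the ratio of two
   members would be a function of s only, so that they would share a divisor
   whose norm has too small a degree. *)
Lemma pencil_dep d (m : I -> nat) a b a' b' :
  (0 < d)%N -> (\sum_i m i).+1 = (4 * d)%N ->
  (forall i, ('X - (s i)%:P) ^+ m i %| Y i ^+ 2 - f) ->
  (size a <= (2 * d).+1)%N -> (size b <= (2 * d).-1)%N ->
  (size a' <= (2 * d).+1)%N -> (size b' <= (2 * d).-1)%N ->
  (forall i, ('X - (s i)%:P) ^+ m i %| a + b * Y i) ->
  (forall i, ('X - (s i)%:P) ^+ m i %| a' + b' * Y i) ->
  exists l l', (l, l') != 0 /\ (l *: a + l' *: a' = 0 /\ l *: b + l' *: b' = 0).
Proof.
move=> d0 sm hY sa sb sa' sb' va va'.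
have [ab0|ab0] := eqVneq (a, b) 0.
  exists 1, 0; case: ab0 => -> ->; rewrite !scaler0 !scale0r !addr0; split=> //.
  by apply/eqP => -[] /eqP; rewrite oner_eq0.
have smul (p q : {poly K}) : (size (p * q)%R <= (size p + size q).-1)%N by apply: size_polyMleq.
(* The difference equals (a + b y) b' - (a' + b' y) b, so it inherits 4 d - 1 zeros, while its
   degree is at most 4 d - 2. *)
have w0 : a * b' = a' * b.
  apply/eqP; rewrite -subr_eq0; apply/eqP; apply: (dvdp_size_eq0 s_inj (m := m)) => [i|].
    have -> : a * b' - a' * b = (a + b * Y i) * b' - (a' + b' * Y i) * b by ring.
    by rewrite dvdp_sub // dvdp_mulr.
  apply: leq_trans (size_polyD _ _) _; rewrite size_polyN geq_max.
  have := smul a b'; have := smul a' b; move: sm; move: (\sum_i m i)%N => S sm.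
  move: (size (a * b')) (size (a' * b)) => n1 n2.
  lia.
have [u [u' [al [be [ab'0 ea eb ea' eb']]]]] := common_factor w0 ab0.
pose h := gcdp u u'.
have u0 : u != 0 by apply: contraNneq ab0 => u0; rewrite ea eb u0 !mul0r.
have h0 : h != 0 by rewrite gcdp_eq0 (negPf u0).
have vh i : ('X - (s i)%:P) ^+ m i %| h * (al + be * Y i).
  rewrite -(eqp_dvdr _ (gcdp_mul2r _ _ _)) dvdp_gcd.
  by rewrite !mulrDr !mulrA -ea -eb -ea' -eb' va va'.
have vn i : ('X - (s i)%:P) ^+ m i %| (h * al) ^+ 2 - (h * be) ^+ 2 * f.
  have -> : (h * al) ^+ 2 - (h * be) ^+ 2 * f =
    (h * (al + be * Y i)) * (h * (al - be * Y i)) + (h * be) ^+ 2 * (Y i ^+ 2 - f) by ring.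
  by apply: dvdp_add; [apply: dvdp_mulr | apply: dvdp_mull].
have nz_norm : (h * al) ^+ 2 - (h * be) ^+ 2 * f != 0.
  apply: contraNneq ab'0 => /eqP; rewrite subr_eq0 => /eqP/norm_eq0[/eqP ha /eqP hb].
  by rewrite !mulf_eq0 (negPf h0) in ha hb; rewrite (eqP ha) (eqP hb).
(* When h has the larger of the two degrees, its cofactors in u and u' are constants, and the same
   relation kills both pairs. *)
have lin_dep : (size h = maxn (size u) (size u')) ->
    exists l l', (l, l') != 0 /\ l *: u + l' *: u' = 0.
  move=> sh; have [/dvdpP[c ec] /dvdpP[c' ec']] := (dvdp_gcdl u u', dvdp_gcdr u u').
  rewrite -/h in ec ec'.
  have sc : (size c <= 1)%N.
    have [->|c0] := eqVneq c 0; first by rewrite size_poly0.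
    have := size_mul c0 h0; rewrite -ec; have := leq_maxl (size u) (size u'); rewrite -sh.
    by move: h0; rewrite -size_poly_gt0; move: (size u) (size c) (size h) => *; lia.
  have sc' : (size c' <= 1)%N.
    have [->|c0] := eqVneq c' 0; first by rewrite size_poly0.
    have := size_mul c0 h0; rewrite -ec'; have := leq_maxr (size u) (size u'); rewrite -sh.
    by move: h0; rewrite -size_poly_gt0; move: (size u') (size c') (size h) => *; lia.
  have cu := size1_polyC sc; have cu' := size1_polyC sc'.
  exists (- c'`_0), c`_0; split.
    apply: contraNneq u0 => -[_ c00].
    by rewrite ec cu c00 mul0r.
  rewrite ec ec' cu cu' !coefC /= !mul_polyC !scalerA -scalerDl.
  by rewrite mulrC mulrN addNr scale0r.
have [sh|sh] := eqVneq (size h) (maxn (size u) (size u')).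
  have [l [l' [ll e]]] := lin_dep sh; exists l, l'; split=> //.
  by rewrite ea eb ea' eb' !scalerAl -!mulrDl e !mul0r.
(* When h has smaller degree, h (al + be y) still has all 4 d - 1 common zeros, but its norm has
   degree at most 4 d - 2. *)
case/eqP: nz_norm; apply: (dvdp_size_eq0 s_inj (m := m)) => //.
have sh' : (size h < maxn (size u) (size u'))%N.
  rewrite ltn_neqAle sh leq_max; have [u'0|u'0] := eqVneq u' 0.
    by rewrite /h u'0 gcdp0 leqnn.
  by rewrite (dvdp_leq u0 (dvdp_gcdl _ _)).
have bound (x : {poly K}) N : (size (u * x)%R <= N)%N -> (size (u' * x)%R <= N)%N -> (size (h * x)%R <= N.-1)%N.
  have [->|x0] := eqVneq x 0; first by rewrite !mulr0 size_poly0.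
  rewrite (size_mul u0 x0) (size_mul h0 x0); have [u'0|u'0] := eqVneq u' 0.
    move=> + _; move: sh' x0 u0; rewrite u'0 size_poly0 maxn0 -!size_poly_gt0.
    by move: (size u) (size x) (size h) => *; lia.
  rewrite (size_mul u'0 x0); move: sh' x0 u0 u'0; rewrite -!size_poly_gt0.
  by move: (size u) (size u') (size x) (size h) => *; lia.
have bal : (size (h * al)%R <= 2 * d)%N.
  by apply: (bound al (2 * d).+1); rewrite -?ea -?ea'.
have bbe : (size (h * be)%R <= (2 * d).-2)%N by apply: (bound be (2 * d).-1); rewrite -?eb -?eb'.
apply: leq_trans (size_polyD _ _) _; rewrite size_polyN geq_max !expr2.
apply/andP; split.
  have := smul (h * al) (h * al); move: sm bal.
  by move: (\sum_i m i)%N (size (h * al)%R) (size (h * al * (h * al))%R) => *; lia.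
have [->|be0] := eqVneq (h * be) 0; first by rewrite !mul0r size_poly0.
have := smul (h * be) (h * be); have := smul (h * be * (h * be)) f.
move: be0 f_size sm bbe; rewrite -size_poly_gt0.
move: (\sum_i m i)%N (size (h * be)%R) (size (h * be * (h * be))%R) (size f).
by move: (size (h * be * (h * be) * f)%R) => *; lia.
Qed.

(** If a complement of W in U were too large, imposing further zeros at the single point [s i0]
    until 4 d - 1 are prescribed would still leave two independent members, contrary to
    [pencil_dep]. No order exceeds 4 d, so lifts of y to that precision suffice. *)
Lemma dim_elliptic_vanish (vT : vectType K) (A B : {linear vT -> {poly K}})
    (U W : {vspace vT}) d (m : I -> nat) :
  (0 < d)%N -> (\sum_i m i < 4 * d)%N ->
  (forall i, ('X - (s i)%:P) ^+ (4 * d) %| Y i ^+ 2 - f) ->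
  (forall v, v \in U -> (size (A v) <= (2 * d).+1)%N) ->
  (forall v, v \in U -> (size (B v) <= (2 * d).-1)%N) ->
  (forall v i, v \in U -> ('X - (s i)%:P) ^+ m i %| A v + B v * Y i) ->
  (forall v, v \in U -> A v = 0 -> B v = 0 -> v \in W) ->
  #|I| != 0%N ->
  (\dim U + \sum_i m i <= 4 * d + \dim W)%N.
Proof.
move=> d0 lt hY hA hB hv hW; rewrite -lt0n => /card_gt0P[i0 _].
pose U1 := (U :\: W)%VS.
have U1U : (U1 <= U)%VS by apply: diffvSl.
have U1W v : v \in U1 -> v \in W -> v = 0.
  move=> v1 v2; apply/eqP; rewrite -memv0 -(capv_diff U W) memv_cap.
  by rewrite v1 v2.
have dU := dimv_cap_compl U W; rewrite -/U1 in dU.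
have dUW : (\dim (U :&: W) <= \dim W)%N by apply: dimvS; apply: capvSr.
suff : (\dim U1 + \sum_i m i <= 4 * d)%N by lia.
rewrite leqNgt; apply/negP => big.
pose k := (4 * d - (\sum_i m i).+1)%N.
pose g0 v : 'rV[K]_k := \row_(j < k) tcoef (s i0) (m i0 + j) (A v + B v * Y i0).
have g_lin : linear g0.
  move=> a u v; apply/rowP => j; rewrite !mxE -tcoef_lin; congr tcoef.
  by rewrite !linearP /= mulrDl scalerDr -scalerAl addrACA.
pose g : {linear vT -> 'rV[K]_k} := HB.pack g0 (GRing.isLinear.Build _ _ _ _ g0 g_lin).
pose U2 := (U1 :&: lker (linfun g))%VS.
have dU2 : (1 < \dim U2)%N.
  have : (\dim U1 <= k + \dim U2)%N.
    apply: (@dim_le_ker _ _ _ g) => v vU1 gv; rewrite memv_cap vU1 memv_ker lfunE.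
    exact/eqP.
  by rewrite /k; lia.
have [u [v [uU vU indep]]] := dim_ge2P dU2.
pose m' i := if i == i0 then (m i0 + k)%N else m i.
have sm' : (\sum_i m' i).+1 = (4 * d)%N.
  rewrite (bigD1 i0) //= /m' eqxx (eq_bigr m) => [|i /negPf ->//].
  have : (m i0 + \sum_(i | i != i0) m i)%N = (\sum_i m i)%N by rewrite [RHS](bigD1 i0).
  by rewrite /k; lia.
have m'le i : (m' i <= 4 * d)%N.
  by rewrite -sm' (bigD1 i) //= leqW // leq_addr.
have van w i : w \in U2 -> ('X - (s i)%:P) ^+ m' i %| A w + B w * Y i.
  rewrite memv_cap memv_ker lfunE /= => /andP[w1 /eqP gw].
  have wU : w \in U by apply: (subvP U1U).
  rewrite /m'; case: eqVneq => [->|_]; last exact: hv.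
  apply/XsubC_expP => j jl; have [jm|mj] := ltnP j (m i0).
    by move/XsubC_expP: (hv w i0 wU); apply.
  have jk : (j - m i0 < k)%N by lia.
  have := congr1 (fun r : 'rV_k => r 0 (Ordinal jk)) gw.
  by rewrite !mxE /= subnKC.
have inU w : w \in U2 -> w \in U by rewrite memv_cap => /andP[/(subvP U1U)].
have [] := @pencil_dep d m' (A u) (B u) (A v) (B v) d0 sm'.
- by move=> i; apply: dvdp_trans (hY i); apply: dvdp_exp2l; apply: m'le.
- exact/hA/inU.
- exact/hB/inU.
- exact/hA/inU.
- exact/hB/inU.
- by move=> i; apply: van.
- by move=> i; apply: van.
move=> l [l' [ll [eA eB]]].
have w0 : l *: u + l' *: v = 0.
  have wU2 : l *: u + l' *: v \in U2 by rewrite memvD ?memvZ.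
  apply: U1W; first by move: wU2; rewrite memv_cap => /andP[].
  by apply: hW; [apply: inU | rewrite linearD !linearZ | rewrite linearD !linearZ].
by have [l0 l'0] := indep _ _ w0; rewrite l0 l'0 eqxx in ll.
Qed.

(** Newton's iteration, gaining one order per step; it divides by 2 y. *)
Lemma sqrt_lift (x y : K) M : (2 : K) != 0 -> y != 0 -> y ^+ 2 = f.[x] ->
  exists2 Z : {poly K}, ('X - x%:P) ^+ M %| Z ^+ 2 - f & Z.[x] = y.
Proof.
move=> two0 y0 ey; elim: M => [|M [Z dZ Zx]].
  by exists y%:P; rewrite ?expr0 ?dvd1p ?hornerC.
case: M dZ => [|M] dZ.
  exists Z => //; rewrite expr1 dvdp_XsubCl rootE !hornerE Zx.
  by rewrite ey subrr.
have /dvdpP[q eq] := dZ.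
exists (Z - (q.[x] / (2 * y))%:P * ('X - x%:P) ^+ M.+1); last first.
  by rewrite !hornerE Zx subrr exprS mul0r mulr0 subr0.
set c := _ / _.
have -> : (Z - c%:P * ('X - x%:P) ^+ M.+1) ^+ 2 - f =
   (Z ^+ 2 - f) - ((c + c)%:P * Z) * ('X - x%:P) ^+ M.+1
   + (c%:P ^+ 2 * ('X - x%:P) ^+ M) * ('X - x%:P) ^+ M.+2.
  by rewrite !exprS polyCD; ring.
rewrite eq -mulrBl; apply: dvdp_add; last exact: dvdp_mull.
rewrite [_ ^+ M.+2]exprS; apply: dvdp_mul => //; rewrite dvdp_XsubCl rootE hornerD hornerN hornerM hornerC Zx /c.
by apply/eqP; field; rewrite y0 two0.
Qed.
End Elliptic.

(** * Forms of a given degree and restriction maps *)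

Section PredSpace.
Variables (K : fieldType) (vT : vectType K) (P : vT -> Prop).
Hypothesis P_lin : P 0 /\ forall a u v, P u -> P v -> P (a *: u + v).

Definition pred_space : {vspace vT} :=
  proj1_sig (constructive_indefinite_description _ (submod_vspace P_lin.1 P_lin.2)).

Lemma mem_pred_space v : v \in pred_space <-> P v.
Proof. by rewrite /pred_space; case: constructive_indefinite_description. Qed.
End PredSpace.

Section Restriction.
Variables (K : fieldType) (V V' : vectType K) (mu : {linear V' -> V}).
Hypothesis mu_inj : injective mu.

Lemma dim_limg_inj (U : {vspace V'}) : \dim (linfun mu @: U) = \dim U.
Proof.
apply: limg_dim_eq; have /lker0P : injective (linfun mu).
  by move=> u v; rewrite !lfunE => /mu_inj.
by move=> /eqP ->; rewrite capv0.
Qed.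

(** The dimension formula for Z + mu W', whose intersection term contains mu Z'. In the restriction
    steps [mu] multiplies by the equation of the curve, and Z and Z' are the forms vanishing on
    Q. *)
Lemma dim_extension (W Z : {vspace V}) (W' Z' : {vspace V'}) :
  (forall w, w \in W -> exists2 v, v \in W' & w - mu v \in Z) ->
  (Z' <= W')%VS -> (forall v, v \in Z' -> mu v \in Z) ->
  (\dim W + \dim Z' <= \dim Z + \dim W')%N.
Proof.
move=> hW ZW hZ.
have sub1 : (W <= Z + linfun mu @: W')%VS.
  apply/subvP => w /hW[v vW' wZ]; rewrite -(subrK (mu v) w).
  by rewrite memv_add // -[mu v](lfunE mu) memv_img.
have sub2 : (linfun mu @: Z' <= Z :&: linfun mu @: W')%VS.
  rewrite subv_cap limgS // andbT; apply/subvP => _ /memv_imgP[v vZ ->].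
  by rewrite lfunE hZ.
have := dimvS sub1; have := dimvS sub2; have := dimv_sum_cap Z (linfun mu @: W').
by rewrite !dim_limg_inj; lia.
Qed.

(** The space Z + mu V' lies in the kernel of [rho]; surjectivity of [rho] and the inequality make
    its dimension at least that of the kernel, so the two coincide. *)
Lemma ker_extension N (rho : {linear V -> 'rV[K]_N}) (Z : {vspace V}) (Z' : {vspace V'}) :
  (forall z, z \in Z -> rho z = 0) -> (forall v, rho (mu v) = 0) ->
  (forall v, mu v \in Z -> v \in Z') ->
  (forall j, exists w, rho w = delta_mx 0 j) ->
  (\dim {: V} + \dim Z' <= N + \dim Z + \dim {: V'})%N ->
  forall w, rho w = 0 -> exists v, w - mu v \in Z.
Proof.
move=> hZ hmu hZ' hs dims.
have dimN : (N <= \dim (limg (linfun rho)))%N.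
  suff -> : limg (linfun rho) = fullv by rewrite dimvf /dim /= mul1n.
  apply/eqP; rewrite eqEsubv subvf /=; apply/subvP => y _.
  rewrite [y]row_sum_delta; apply: memv_suml => j _; apply: memvZ.
  by have [w <-] := hs j; rewrite -(lfunE rho) memv_img ?memvf.
set S := (Z + limg (linfun mu))%VS.
have sub : (S <= lker (linfun rho))%VS.
  apply/subvP => _ /memv_addP[z zZ [_ /memv_imgP[v _ ->] ->]].
  by rewrite memv_ker !lfunE /= linearD hZ // hmu addr0.
have dcap : (\dim (Z :&: limg (linfun mu)) <= \dim Z')%N.
  rewrite -(dim_limg_inj Z'); apply: dimvS; apply/subvP => w; rewrite memv_cap.
  move=> /andP[wZ /memv_imgP[v _ ev]]; rewrite ev memv_img // hZ' //.
  by rewrite -[mu v](lfunE mu) -ev.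
have eqS : S = lker (linfun rho).
  apply/eqP; rewrite eqEdim sub /=.
  have := limg_ker_dim (linfun rho) fullv; rewrite capfv.
  have := dimv_sum_cap Z (limg (linfun mu)); rewrite -/S dim_limg_inj.
  lia.
move=> w rw; have : w \in S by rewrite eqS memv_ker lfunE /= rw.
move=> /memv_addP[z zZ [_ /memv_imgP[v _ ->] ->]]; exists v.
by rewrite lfunE /= addrK.
Qed.
End Restriction.

Section Forms.
Variable K : fieldType.
Local Notation R d := (dhomog 4 K d).

Lemma dim_forms d : \dim {: R d} = 'C(d + 3, 3).
Proof. by rewrite dimvf /dim /= -bin_sub ?leq_addr // addKn. Qed.

Section Hmul.
Variables (e : nat) (h : {mpoly K[4]}) (hh : h \is e.-homog) (d : nat).

Definition hmul (F : R d) : R (e + d) := DHomog (dhomogM hh (dhomog_is_dhomog F)).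

Lemma hmulE F : hmul F = h * F :> {mpoly K[4]}. Proof. by []. Qed.

Lemma hmul_linear : linear hmul.
Proof.
by move=> a u v; apply: val_inj; rewrite /= mulrDr scalerAr.
Qed.
HB.instance Definition _ := GRing.isLinear.Build K (R d) (R (e + d)) _ hmul hmul_linear.

Lemma hmul_inj : h != 0 -> injective hmul.
Proof. by move=> h0 F G /(congr1 val) /= /(mulfI h0) e1; apply: val_inj. Qed.
End Hmul.

Definition linform (c : 'I_4 -> K) : {mpoly K[4]} := \sum_l c l *: 'X_l.

Lemma linform_homog c : linform c \is 1.-homog.
Proof. by apply: rpred_sum => l _; rewrite dhomogZ // dhomogX /= mdeg1. Qed.

Lemma mmap_linform (A : comNzRingType) (f : {rmorphism K -> A}) x c :
  mmap f x (linform c) = \sum_l f (c l) * x l.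
Proof.
rewrite raddf_sum; apply: eq_bigr => l _.
by rewrite /= mmapZ mmapX mmap1U.
Qed.

(** The k-th coordinate of a vector with respect to the rows of [M]. *)
Definition coordform (M : 'M[K]_4) k := linform (fun l => invmx M l k).

Lemma mmap_coordform (A : comNzRingType) (f : {rmorphism K -> A}) (M : 'M[K]_4) w x k :
  M \in unitmx -> (forall l, x l = \sum_k f (M k l) * w k) ->
  mmap f x (coordform M k) = w k.
Proof.
move=> uM ex; rewrite mmap_linform.
under eq_bigr do rewrite ex mulr_sumr.
rewrite exchange_big /=.
have inner i : \sum_l f (invmx M l k) * (f (M i l) * w i) = (i == k)%:R * w i.
  under eq_bigr do rewrite mulrA -rmorphM [invmx M _ _ * _]mulrC [_ * w i]mulrC.
  rewrite -mulr_sumr -rmorph_sum /= mulrC; congr (_ * _).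
  have := congr1 (fun B : 'M_4 => B i k) (mulmxV uM); rewrite !mxE => ->.
  by rewrite rmorph_nat.
rewrite (eq_bigr _ (fun i _ => inner i)) (bigD1 k) //= eqxx mul1r big1 ?addr0 // => i ik.
by rewrite (negPf ik) mul0r.
Qed.
End Forms.

(** * Forms on a parametrised quadric *)

Section Bidegree.
Variable K : fieldType.
Implicit Types (P Q : {mpoly K[2]}) (m : 'X_{1..2}).

Definition bideg d P := forall m, m \in msupp P -> forall k, (m k <= d)%N.

Lemma bideg0 d : bideg d 0.
Proof. by move=> m; rewrite msupp0. Qed.

Lemma bidegD d P Q : bideg d P -> bideg d Q -> bideg d (P + Q).
Proof. by move=> hP hQ m /msuppD_le; rewrite mem_cat => /orP[/hP|/hQ]. Qed.

Lemma bidegZ d a P : bideg d P -> bideg d (a *: P).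
Proof. by move=> hP m /msuppZ_le /hP. Qed.

Lemma bidegM d e P Q : bideg d P -> bideg e Q -> bideg (d + e) (P * Q).
Proof.
move=> hP hQ m /msuppM_le /allpairsP[[m1 m2] /= [m1P m2Q ->]] k.
by rewrite mnmDE leq_add ?hP ?hQ.
Qed.

Lemma bideg1 : bideg 0 1.
Proof. by move=> m; rewrite msupp1 inE => /eqP -> k; rewrite mnm0E. Qed.

Lemma bidegX e P n : bideg e P -> bideg (n * e) (P ^+ n).
Proof.
move=> hP; elim: n => [|n IH]; first by rewrite expr0 mul0n; apply: bideg1.
by rewrite exprS mulSn; apply: bidegM.
Qed.

Definition mn2 (i j : nat) : 'X_{1..2} := [multinom if val k == 0 then i else j | k < 2].

Lemma mn2E m : m = mn2 (m 0) (m 1).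
Proof.
apply/mnmP => k; rewrite mnmE; case: eqP => k0; congr (m _); apply: val_inj => //.
by case: k k0 => -[|[]].
Qed.

Lemma mn2_inj i j i' j' : mn2 i j = mn2 i' j' -> i = i' /\ j = j'.
Proof.
by move=> /mnmP e; split; [have := e 0 | have := e 1]; rewrite !mnmE.
Qed.

Lemma mpolyX2 i j : 'X_[mn2 i j] = 'X_0 ^+ i * 'X_1 ^+ j :> {mpoly K[2]}.
Proof.
rewrite mpolyXE_id !big_ord_recl big_ord0 mulr1 !mnmE /=; congr (_ ^+ _ * _ ^+ _).
Qed.

Lemma bideg_eq0 d P : bideg d P -> (forall i j : 'I_d.+1, P@_(mn2 i j) = 0) -> P = 0.
Proof.
move=> hP h; apply/mpolyP => m; rewrite mcoeff0; apply/eqP.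
apply: contraT; rewrite -mcoeff_msupp => mP.
have := h (inord (m 0)) (inord (m 1)).
rewrite !inordK ?ltnS ?(hP m) // -mn2E => /eqP.
by rewrite mcoeff_eq0 mP.
Qed.
End Bidegree.

Section Param.
Variables (K : fieldType) (M : 'M[K]_4).
Hypothesis uM : M \in unitmx.
Local Notation R d := (dhomog 4 K d).

Definition segre (k : 'I_4) : {mpoly K[2]} :=
  if val k == 0%N then 1 else if val k == 1%N then 'X_0
  else if val k == 2 then 'X_1 else 'X_0 * 'X_1.

(** The affine chart (u, v) -> (1, u, v, uv) of the Segre quadric, moved into place by [M]. *)
Definition qparam : 4.-tuple {mpoly K[2]} := [tuple \sum_k M k l *: segre k | l < 4].

Local Notation pb := (comp_mpoly qparam).

Lemma pb_coordform k : pb (coordform M k) = segre k.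
Proof.
apply: mmap_coordform uM _ => l; rewrite tnth_mktuple.
by apply: eq_bigr => i _; rewrite mul_mpolyC.
Qed.

Lemma segre_bideg k : bideg 1 (segre k).
Proof.
have hX (i : 'I_2) : bideg 1 ('X_i : {mpoly K[2]}).
  move=> m; rewrite msuppX inE => /eqP -> j; rewrite mnm1E.
  by case: (_ == _).
rewrite /segre; case: ifP => _.
  by move=> m; rewrite msupp1 inE => /eqP -> i; rewrite mnm0E.
case: ifP => _ //; case: ifP => _ //.
move=> m /msuppM_le /allpairsP[[m1 m2] /= []].
rewrite !msuppX !inE => /eqP -> /eqP -> -> j; rewrite mnmDE !mnm1E.
by case: j => -[|[]].
Qed.

Lemma pb_bideg d (F : R d) : bideg d (pb F).
Proof.
have hphi l : bideg 1 (tnth qparam l).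
  rewrite tnth_mktuple; elim/big_ind: _ => [|P Q|k _]; [exact: bideg0 | exact: bidegD |].
  exact/bidegZ/segre_bideg.
have /dhomogP hF := dhomog_is_dhomog F.
rewrite comp_mpolyE big_seq.
elim/big_ind: _ => [|P Q|m /hF dm]; [exact: bideg0 | exact: bidegD |].
apply: bidegZ; rewrite -dm /= mdegE.
elim: (index_enum _) => [|l s IH]; first by rewrite !big_nil; apply: bideg1.
rewrite !big_cons; apply: bidegM IH.
by rewrite -[X in bideg X _]muln1; apply: bidegX.
Qed.

(** The pair U, V is left arbitrary so that the lemma serves both for the variables u, v and for u -
    u0, v - v0 centred at a point of Q. *)
Lemma segre_surj (U V : {mpoly K[2]}) (c : nat -> {mpoly K[4]}) d i j :
  (forall k, c k \is 1.-homog) ->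
  [/\ pb (c 0) = 1, pb (c 1) = U, pb (c 2) = V & pb (c 3) = U * V] ->
  (i <= d)%N -> (j <= d)%N -> exists F : R d, pb F = U ^+ i * V ^+ j.
Proof.
move=> hc [e0 e1 e2 e3] id jd; pose a := minn i j.
pose F := c 3 ^+ a * c 1 ^+ (i - a) * c 2 ^+ (j - a) * c 0 ^+ (d - maxn i j).
have hcX k n : c k ^+ n \is n.-homog.
  by rewrite -[n in n.-homog]mul1n; apply/dhomogMn.
have hF : F \is d.-homog.
  have -> : d = (a + (i - a) + (j - a) + (d - maxn i j))%N by rewrite /a; lia.
  by rewrite !dhomogM.
exists (DHomog hF); rewrite /= /F !rmorphM !rmorphXn /= e0 e1 e2 e3.
rewrite expr1n mulr1 exprMn -mulrA mulrACA mulrC -!mulrA -!exprD.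
by rewrite mulrA -exprD mulrC !subnKC ?geq_minl ?geq_minr.
Qed.

Lemma pb_surj d i j : (i <= d)%N -> (j <= d)%N ->
  exists F : R d, pb F = 'X_0 ^+ i * 'X_1 ^+ j.
Proof.
apply: (@segre_surj _ _ (fun k => coordform M (inord k))) => [k|].
  exact: linform_homog.
by rewrite !pb_coordform /segre /= !inordK.
Qed.

Section Kernel.
Variable d : nat.

Lemma kerpb_lin : (fun F : R d => pb F = 0) 0 /\
  forall a (F G : R d), pb F = 0 -> pb G = 0 -> pb (a *: F + G) = 0.
Proof.
split=> [|a F G hF hG]; first exact: comp_mpoly0.
by rewrite /= comp_mpolyD comp_mpolyZ hF hG scaler0 addr0.
Qed.

Definition kerpb : {vspace R d} := pred_space kerpb_lin.

Lemma mem_kerpb (F : R d) : F \in kerpb <-> pb F = 0.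
Proof. exact: mem_pred_space. Qed.

Lemma dim_kerpb : (\dim kerpb + d.+1 ^ 2 = 'C(d + 3, 3))%N.
Proof.
pose g0 (F : R d) : 'M[K]_d.+1 := \matrix_(i, j) (pb F)@_(mn2 i j).
have g_lin : linear g0.
  move=> a F G; apply/matrixP => i j.
  by rewrite !mxE /= comp_mpolyD comp_mpolyZ mcoeffD mcoeffZ.
pose g : {linear R d -> 'M[K]_d.+1} := HB.pack g0 (GRing.isLinear.Build _ _ _ _ g0 g_lin).
have -> : kerpb = lker (linfun g).
  apply/vspaceP => F; rewrite memv_ker lfunE /=.
  apply/idP/eqP => [/mem_kerpb F0|g0F].
    by apply/matrixP => i j; rewrite !mxE F0 mcoeff0.
  apply/mem_kerpb; apply: (bideg_eq0 (@pb_bideg d F)) => i j.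
  by have := congr1 (fun B : 'M[K]_d.+1 => B i j) g0F; rewrite !mxE.
have := limg_ker_dim (linfun g) fullv; rewrite capfv dim_forms.
suff -> : limg (linfun g) = fullv by rewrite dimvf /dim /= mulnn.
apply/eqP; rewrite eqEsubv subvf /=; apply/subvP => B _.
rewrite [B]matrix_sum_delta; apply: memv_suml => i _; apply: memv_suml => j _.
apply: memvZ; have [F eF] := @pb_surj d i j (ltn_ord i) (ltn_ord j).
suff -> : delta_mx i j = linfun g F by rewrite memv_img ?memvf.
rewrite lfunE; apply/matrixP => k l; rewrite !mxE /= eF -mpolyX2 mcoeffX.
congr (_%:R); congr nat_of_bool; apply/andP/eqP => [[/eqP -> /eqP ->] //|].
by move=> /mn2_inj[e1 e2]; split; apply/eqP/val_inj.
Qed.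
End Kernel.

Section Points.
Variables (r : nat) (pt : 'I_r -> 'I_2 -> K).

Lemma qsys_lin d (m : 'I_r -> nat) :
  (fun F : R d => forall i, mult (pb F) (pt i) (m i)) 0 /\
  forall a (F G : R d), (forall i, mult (pb F) (pt i) (m i)) ->
    (forall i, mult (pb G) (pt i) (m i)) -> forall i, mult (pb (a *: F + G)) (pt i) (m i).
Proof.
split=> [i|a F G hF hG i]; first by rewrite comp_mpoly0; apply: mult_zero.
by rewrite /= comp_mpolyD comp_mpolyZ; apply: mult_lin.
Qed.

Definition qsys d m : {vspace R d} := pred_space (qsys_lin d m).

Lemma mem_qsys d m (F : R d) :
  F \in qsys d m <-> forall i, mult (pb F) (pt i) (m i).
Proof. exact: mem_pred_space. Qed.

Lemma kerpb_qsys d m : (kerpb d <= qsys d m)%VS.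
Proof.
apply/subvP => F /mem_kerpb F0; apply/mem_qsys => i.
by rewrite F0; apply: mult_zero.
Qed.

Section Step.
Variables (e d : nat) (h : {mpoly K[4]}).
Hypotheses (hh : h \is e.-homog) (h0 : pb h != 0).

Lemma hmul_pb (F : R d) : pb (hmul hh F) = pb h * pb F.
Proof. exact: rmorphM. Qed.

Lemma h_neq0 : h != 0.
Proof. by apply: contraNneq h0 => ->; rewrite comp_mpoly0. Qed.

(** On Q the members of W are multiples of h, and the quotients are again forms. The negated
    hypothesis bounds the order of h at a point by m - m', so the quotient keeps multiplicity m';
    nothing is asked where m' is 0. *)
Lemma qsys_step (W : {vspace R (e + d)}) (m m' : 'I_r -> nat) :
  (W <= qsys (e + d) m)%VS ->
  (forall i, (0 < m' i)%N -> ~ mult (pb h) (pt i) (m i - m' i).+1) ->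
  (forall i, m' i <= m i)%N ->
  (forall F, F \in W -> exists B : R d, pb F = pb h * pb B) ->
  (\dim W + \dim (kerpb d) <= \dim (kerpb (e + d)) + \dim (qsys d m'))%N.
Proof.
move=> WS nh le hW; apply: (@dim_extension _ _ _ (@hmul K e h hh d) (@hmul_inj K e h hh d h_neq0)).
- move=> F FW; have [B eB] := hW F FW; exists B; last first.
    by apply/mem_kerpb; rewrite /= comp_mpolyB eB rmorphM subrr.
  apply/mem_qsys => i; have [->|m'0] := posnP (m' i); first exact: mult0.
  rewrite -(subKn (le i)); apply: (mult_div (nh i m'0)).
  by rewrite -eB; move/(subvP WS)/mem_qsys: FW; apply.
- exact: kerpb_qsys.
by move=> F /mem_kerpb F0; apply/mem_kerpb; rewrite hmul_pb F0 mulr0.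
Qed.

(* The kernel of a restriction map is found by counting dimensions. *)
Lemma restriction_ker N (rho : {linear R (e + d) -> 'rV[K]_N}) :
  (forall F : R (e + d), pb F = 0 -> rho F = 0) -> (forall B, rho (hmul hh B) = 0) ->
  (forall j, exists F, rho F = delta_mx 0 j) ->
  ((e + d).+1 ^ 2 <= N + d.+1 ^ 2)%N ->
  forall F : R (e + d), rho F = 0 -> exists B : R d, pb F = pb h * pb B.
Proof.
move=> hZ hB hs dims F rF.
have hZ1 (G : R (e + d)) : G \in kerpb (e + d) -> rho G = 0 by move=> /mem_kerpb; apply: hZ.
have hZ2 (G : R d) : hmul hh G \in kerpb (e + d) -> G \in kerpb d.
  move=> /mem_kerpb; rewrite hmul_pb => /eqP; rewrite mulf_eq0 (negPf h0) /=.
  by move=> /eqP G0; apply/mem_kerpb.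
have dims' : (\dim {: R (e + d)} + \dim (kerpb d) <= N + \dim (kerpb (e + d)) + \dim {: R d})%N.
  by rewrite !dim_forms -(dim_kerpb (e + d)) -(dim_kerpb d); lia.
have [B hFB] := ker_extension (@hmul_inj K e h hh d h_neq0) hZ1 hB hZ2 hs dims' rF.
exists B; move/mem_kerpb: hFB; rewrite /= comp_mpolyB rmorphM.
by move=> /eqP; rewrite subr_eq0 => /eqP.
Qed.
End Step.
End Points.
End Param.

(** [Q k] is any family of additive conditions compatible with products; it is instantiated with
    degree bounds, with the weights on the double cover and with homogeneity. *)
Lemma mmap_graded n (K A : comNzRingType) (f : {rmorphism K -> A}) (x : 'I_n -> A)
    (Q : nat -> A -> Prop) e d F :
  F \is d.-homog ->
  (forall k, Q k 0) -> (forall k a b, Q k a -> Q k b -> Q k (a + b)) ->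
  (forall k c a, Q k a -> Q k (f c * a)) -> Q 0%N 1 ->
  (forall k l a b, Q k a -> Q l b -> Q (k + l)%N (a * b)) ->
  (forall i, Q e (x i)) -> Q (d * e)%N (mmap f x F).
Proof.
move=> /dhomogP hF Q0 QD QZ Q1 QM Qx; rewrite /mmap big_seq.
elim/big_ind: _ => [|a b|m /hF dm]; [exact: Q0 | exact: QD | apply: QZ].
have QX k a : Q e a -> Q (k * e)%N (a ^+ k).
  move=> Qa; elim: k => [|k IH]; first by rewrite mul0n expr0.
  by rewrite exprS mulSn; apply: QM.
rewrite -dm /= mdegE /mmap1.
elim: (index_enum _) => [|l s IH]; first by rewrite !big_nil mul0n.
by rewrite !big_cons mulnDl; apply: QM (QX _ _ _) IH.
Qed.

Lemma size_polyM_leq (R : nzRingType) (p q : {poly R}) k l :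
  (size p <= k.+1)%N -> (size q <= l.+1)%N -> (size (p * q)%R <= (k + l).+1)%N.
Proof.
move=> hp hq; apply: leq_trans (size_polyMleq _ _) _.
by move: (size p) (size q) hp hq => *; lia.
Qed.

Section PolyEval.
Variable K : fieldType.
Implicit Types (F : {mpoly K[4]}).

Lemma dvdp_mmap n (E : {poly K}) (a b : 'I_n -> {poly K}) (F : {mpoly K[n]}) :
  (forall i, E %| a i - b i) -> E %| mmap polyC a F - mmap polyC b F.
Proof.
move=> h; have /fin_all_exists [q eq] : forall i, exists q, a i = b i + E * q.
  by move=> i; have /dvdpP[q e] := h i; exists q; rewrite mulrC -e subrKC.
have [G eG] := mmap_congr polyC E b q F.
rewrite (eq_mmap (f' := polyC) (h' := fun i => b i + E * q i) F) // eG addrC addKr.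
exact: dvdp_mulr.
Qed.

Lemma size_mmap n e d (x : 'I_n -> {poly K}) (F : {mpoly K[n]}) : F \is d.-homog ->
  (forall l, size (x l) <= e.+1)%N -> (size (mmap polyC x F) <= (d * e).+1)%N.
Proof.
move=> hF hx; apply: (@mmap_graded _ _ _ _ x (fun k (p : {poly K}) => (size p <= k.+1)%N) e d F hF) => //.
- by move=> k; rewrite size_poly0.
- by move=> k a b ha hb; apply: leq_trans (size_polyD _ _) _; rewrite geq_max ha.
- by move=> k c a ha; rewrite mul_polyC; apply: leq_trans (size_scale_leq _ _) _.
- by rewrite size_poly1.
by move=> k l a b; apply: size_polyM_leq.
Qed.

Lemma quadratic_surj (A : comNzRingType) (f : {rmorphism K -> A}) (x : 'I_4 -> A) (t : A)
    (L : nat -> {mpoly K[4]}) d k :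
  (forall j, L j \is 1.-homog) -> (forall j, (j < 3)%N -> mmap f x (L j) = t ^+ j) ->
  (k <= 2 * d)%N -> exists2 F, F \is d.-homog & mmap f x F = t ^+ k.
Proof.
move=> hL eL kd; pose a := k./2; pose b : nat := odd k.
have ek : k = (b + 2 * a)%N by rewrite mul2n odd_double_half.
have hc j n : L j ^+ n \is n.-homog.
  by rewrite -[n in n.-homog]mul1n; apply/dhomogMn.
have b1 : (b <= 1)%N by rewrite /b; case: odd.
have dE : d = (b + a + (d - (b + a)))%N by lia.
exists (L 1%N ^+ b * L 2%N ^+ a * L 0%N ^+ (d - (b + a))).
  by rewrite [X in X.-homog]dE !dhomogM.
rewrite !rmorphM !rmorphXn /= !eL // expr0 expr1n mulr1 -!exprM -exprD ek.
by rewrite mul1n.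
Qed.

Lemma poly_rV_Xn n k (kn : (k < n)%N) : poly_rV 'X^k = delta_mx 0 (Ordinal kn) :> 'rV[K]_n.
Proof.
by apply/rowP => j; rewrite !mxE coefXn /= eq_sym -val_eqE eq_sym.
Qed.
End PolyEval.

Section Curve.
Variables (K : fieldType) (M : 'M[K]_4).
Local Notation R d := (dhomog 4 K d).
Local Notation pb := (comp_mpoly (qparam M)).

Definition pt2 (u v : K) (k : 'I_2) : K := if val k == 0%N then u else v.

Definition segreA (A : nzRingType) (U V : A) (k : 'I_4) : A :=
  if val k == 0%N then 1 else if val k == 1%N then U
  else if val k == 2 then V else U * V.

Definition lincomb (A : comNzRingType) (f : K -> A) (w : 'I_4 -> A) (l : 'I_4) : A :=
  \sum_k f (M k l) * w k.

Lemma mmap_pb (A : comNzRingType) (f : {rmorphism K -> A}) (x : 'I_2 -> A) (F : {mpoly K[4]}) :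
  mmap f x (pb F) = mmap f (lincomb f (segreA (x 0) (x 1))) F.
Proof.
rewrite /comp_mpoly (rmorph_mmap (mmap f x)); apply: eq_mmap => [c|l] /=.
  by rewrite mmapC.
rewrite tnth_mktuple raddf_sum; apply: eq_bigr => k _.
rewrite /= mmapZ; congr (_ * _); rewrite /segre /segreA.
case: ifP => _; first by rewrite rmorph1.
case: ifP => _; first by rewrite mmapX mmap1U.
by case: ifP => _; rewrite ?rmorphM /= ?mmapX ?mmap1U.
Qed.

Lemma lincomb_scale (A : comNzRingType) (f : K -> A) c w l :
  lincomb f (fun k => c * w k) l = c * lincomb f w l.
Proof. by rewrite mulr_sumr; apply: eq_bigr => k _; rewrite mulrCA. Qed.

(* Order of contact of a form with a curve lying, to order m at t0, on the
   quadric. *)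
Lemma curve_order N (F : {mpoly K[4]}) (sig : 'I_4 -> {poly K}) (t0 u0 v0 : K) m :
  F \is N.-homog -> (sig 0).[t0] != 0 ->
  (sig 1).[t0] = u0 * (sig 0).[t0] -> (sig 2).[t0] = v0 * (sig 0).[t0] ->
  ('X - t0%:P) ^+ m %| sig 1 * sig 2 - sig 0 * sig 3 ->
  mult (pb F) (pt2 u0 v0) m ->
  ('X - t0%:P) ^+ m %| mmap polyC (lincomb polyC sig) F.
Proof.
move=> hF s0 s1 s2 rel mF; case: m rel mF => [|m] rel mF.
  by rewrite expr0 dvd1p.
set E := ('X - t0%:P) ^+ m.+1.
have cop : coprimep (sig 0) E by apply: coprimep_expr; rewrite coprimep_XsubC rootE.
(* C inverts sig 0 modulo E. Scaling by C moves the curve, up to multiples of E, into the chart (1,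
   U, V, UV), where the order of contact is read off from the multiplicity at (u0, v0). *)
have [C CE] : exists C, E %| C * sig 0 - 1.
  have /Bezout_eq1_coprimepP[[C D] /= e] := cop.
  by exists C; rewrite -e opprD addNKr -mulNr dvdp_mull.
have Ct : C.[t0] * (sig 0).[t0] = 1.
  have : 'X - t0%:P %| C * sig 0 - 1 by apply: dvdp_trans CE; rewrite /E exprS dvdp_mulr.
  by rewrite dvdp_XsubCl rootE !hornerE subr_eq0 => /eqP.
have Ecop : coprimep E C.
  rewrite coprimep_sym; apply: coprimep_expr; rewrite coprimep_XsubC rootE.
  by apply: contraTneq (oner_neq0 K) => C0; rewrite -Ct C0 mul0r eqxx.
rewrite -(Gauss_dvdpr _ (coprimep_expr N Ecop)) -mmap_scale //.
pose U := C * sig 1; pose V := C * sig 2.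
have hU : exists z, U = u0%:P + ('X - t0%:P) * z.
  have : 'X - t0%:P %| U - u0%:P.
    by rewrite dvdp_XsubCl rootE hornerD hornerN hornerM hornerC s1 mulrCA Ct mulr1 subrr.
  by move=> /dvdpP[z e]; exists z; rewrite mulrC -e subrKC.
have hV : exists z, V = v0%:P + ('X - t0%:P) * z.
  have : 'X - t0%:P %| V - v0%:P.
    by rewrite dvdp_XsubCl rootE hornerD hornerN hornerM hornerC s2 mulrCA Ct mulr1 subrr.
  by move=> /dvdpP[z e]; exists z; rewrite mulrC -e subrKC.
have key : E %| mmap polyC (lincomb polyC (segreA U V)) F.
  have [[zu eU] [zv eV]] := (hU, hV).
  have [G] := mult_subst mF polyC ('X - t0%:P) (fun k => if val k == 0%N then zu else zv).
  rewrite mmap_pb /pt2 /= -eU -eV => ->; exact: dvdp_mulr.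
rewrite -[X in _ %| X](subrK (mmap polyC (lincomb polyC (segreA U V)) F)).
apply: dvdp_add key; apply: dvdp_mmap => l.
rewrite -lincomb_scale /lincomb -sumrB.
elim/big_ind: _ => [|p q|k _]; [exact: dvdp0 | exact: dvdp_add |].
rewrite -mulrBr; apply: dvdp_mull; rewrite /segreA.
have -> : sig k = sig (inord k) by rewrite inord_val.
case: eqP => [->|k0]; first by rewrite (_ : inord 0 = 0) //; apply: val_inj; rewrite /= inordK.
case: eqP => [->|k1].
  by rewrite (_ : inord 1 = 1) ?subrr //; apply: val_inj; rewrite /= inordK.
case: eqP => [->|k2].
  by rewrite (_ : inord 2 = 2) ?subrr //; apply: val_inj; rewrite /= inordK.
have k3 : val k = 3 by case: k k0 k1 k2 => -[|[|[|[|]]]].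
rewrite k3 (_ : inord 3 = 3); last by apply: val_inj; rewrite /= inordK.
have -> : C * sig 3 - U * V = - (C * C) * (sig 1 * sig 2 - sig 0 * sig 3)
    - C * sig 3 * (C * sig 0 - 1) by rewrite /U /V; ring.
by apply: dvdp_sub; apply: dvdp_mull.
Qed.
End Curve.

(** * The conic, elliptic and tangent-plane steps *)

Section Eval.
Variables (K : fieldType) (M : 'M[K]_4).
Hypothesis uM : M \in unitmx.
Local Notation R d := (dhomog 4 K d).
Local Notation pb := (comp_mpoly (qparam M)).

Definition lf4 (a0 a1 a2 a3 : K) : {mpoly K[4]} :=
  a0 *: coordform M 0 + a1 *: coordform M 1 + a2 *: coordform M 2 + a3 *: coordform M 3.

Lemma lf4_homog a0 a1 a2 a3 : lf4 a0 a1 a2 a3 \is 1.-homog.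
Proof. by rewrite !(rpredD, dhomogZ) // linform_homog. Qed.

Lemma mmap_lf4 (A : comNzRingType) (f : {rmorphism K -> A}) w a0 a1 a2 a3 :
  mmap f (lincomb M f w) (lf4 a0 a1 a2 a3) =
    f a0 * w 0 + f a1 * w 1 + f a2 * w 2 + f a3 * w 3.
Proof. by rewrite !mmapD !mmapZ !(mmap_coordform _ uM (fun l => erefl _)). Qed.

Definition curve_ev d (sig : 'I_4 -> {poly K}) (F : R d) : {poly K} :=
  mmap polyC (lincomb M polyC sig) F.

Lemma curve_ev_linear d sig : linear (@curve_ev d sig).
Proof. by move=> a F G; rewrite /curve_ev mmapD mmapZ mul_polyC. Qed.
HB.instance Definition _ d sig :=
  GRing.isLinear.Build K (R d) {poly K} _ (@curve_ev d sig) (curve_ev_linear sig).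

Lemma pb_lf4 a0 a1 a2 a3 : pb (lf4 a0 a1 a2 a3) =
  a0%:MP + a1 *: 'X_0 + a2 *: 'X_1 + a3 *: ('X_0 * 'X_1).
Proof.
rewrite !comp_mpolyD !comp_mpolyZ !pb_coordform //.
by congr (_ + _ + _ + _); rewrite /segre /= -mul_mpolyC mulr1.
Qed.

Lemma lf4_not_mult2 a0 a1 a2 a3 (u v : K) : a2 + a3 * u != 0 ->
  ~ mult (pb (lf4 a0 a1 a2 a3)) (pt2 u v) 2.
Proof.
move=> nz /mult_eval - /(_ (fun k => if val k == 0%N then 0 else 1)).
rewrite mmap_pb mmap_lf4 /segreA /pt2 /=.
set P := (X in _ %| X).
have -> : P = (a0 + a1 * u + a2 * v + a3 * u * v)%:P + (a2 + a3 * u)%:P * 'X.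
  by rewrite /P !(polyCD, polyCM); ring.
move=> /dvdpP[q] /(congr1 (fun p : {poly K} => p`_1)).
rewrite coefMXn coefD coefC coefCM coefX /= add0r mulr1.
by move/eqP: nz.
Qed.
End Eval.

Section Conic.
Variables (K : fieldType) (M : 'M[K]_4).
Hypothesis uM : M \in unitmx.
Local Notation R d := (dhomog 4 K d).
Local Notation pb := (comp_mpoly (qparam M)).
Variables (r : nat) (u v : 'I_r -> K) (i0 i1 i2 : 'I_r).
Hypothesis (u_uniq : uniq [:: u i0; u i1; u i2]) (v_uniq : uniq [:: v i0; v i1; v i2]).
Let pt i := pt2 (u i) (v i).

(* Restriction to the conic cut out on the quadric by the plane through three
   points: the graph of the Moebius transformation sending u i to v i. *)
Lemma conic_step d (m : 'I_r -> nat) :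
  (forall i, i \notin [:: i0; i1; i2] -> m i = 0%N) ->
  (m i0 + m i1 + m i2 <= (2 * d.+1).+1)%N ->
  (\dim (qsys M pt d.+1 m) + \dim (kerpb M d) + (m i0 + m i1 + m i2) <=
   \dim (kerpb M d.+1) + \dim (qsys M pt d (fun i => (m i).-1)) + (2 * d.+1).+1)%N.
Proof.
move=> hm le.
pose U1 := u i1 - u i0; pose U2 := u i2 - u i0.
pose V1 := v i1 - v i0; pose V2 := v i2 - v i0.
have [U10 U20 U12] : [/\ U1 != 0, U2 != 0 & U1 != U2].
  move: u_uniq; rewrite /= !inE negb_or andbT => /andP[/andP[a b] c].
  by split; rewrite ?subr_eq0 1?eq_sym // (inj_eq (addIr _)) eq_sym.
have [V10 V20 V12] : [/\ V1 != 0, V2 != 0 & V1 != V2].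
  move: v_uniq; rewrite /= !inE negb_or andbT => /andP[/andP[a b] c].
  by split; rewrite ?subr_eq0 1?eq_sym // (inj_eq (addIr _)) eq_sym.
(* Centred at the first point, the map t -> A t / (c t + D0) sends 0, U1, U2 to 0, V1, V2. *)
pose c := U1 * V2 - U2 * V1; pose D0 := U1 * U2 * (V1 - V2); pose A := V1 * V2 * (U1 - U2).
have D00 : D0 != 0 by rewrite !mulf_neq0 // subr_eq0.
have A0 : A != 0 by rewrite !mulf_neq0 // subr_eq0.
have DU1 : V1 * (c * U1 + D0) = A * U1 by rewrite /c /D0 /A; ring.
have DU2 : V2 * (c * U2 + D0) = A * U2 by rewrite /c /D0 /A; ring.
have D10 : c * U1 + D0 != 0.
  by apply/eqP => h; move/eqP: DU1; rewrite h mulr0 eq_sym mulf_eq0 (negPf A0) (negPf U10).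
have D20 : c * U2 + D0 != 0.
  by apply/eqP => h; move/eqP: DU2; rewrite h mulr0 eq_sym mulf_eq0 (negPf A0) (negPf U20).
pose D : {poly K} := c%:P * 'X + D0%:P.
pose su : {poly K} := (u i0)%:P + 'X.
pose sv : {poly K} := (v i0)%:P * D + A%:P * 'X.
pose sig (k : 'I_4) := if val k == 0%N then D else if val k == 1%N then su * D
  else if val k == 2 then sv else su * sv.
(* The expansion of (v - v0) (c (u - u0) + D0) = A (u - u0), with (u0, v0) the first point. *)
pose h := lf4 M (c * u i0 * v i0 - v i0 * D0 + A * u i0) (- (c * v i0) - A) (D0 - c * u i0) c.
have hh : h \is 1.-homog by apply: lf4_homog.
pose T (k : 'I_3) : K := if val k == 0%N then 0 else if val k == 1%N then U1 else U2.
pose J (k : 'I_3) := if val k == 0%N then i0 else if val k == 1%N then i1 else i2.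
have T_inj : injective T.
{   move=> [[|[|[|//]]] ?] [[|[|[|//]]] ?]; rewrite /T /= => /eqP e; apply: val_inj => //=.
  all: by exfalso; move: e; apply/negP; rewrite // eq_sym. }
have TJ k : [/\ u (J k) = u i0 + T k, c * T k + D0 != 0 &
    v (J k) * (c * T k + D0) = v i0 * (c * T k + D0) + A * T k].
  case: k => -[|[|[|//]]] ?; rewrite /T /J /=.
  - by rewrite addr0 mulr0 add0r mulr0 addr0.
  - by split=> //; [rewrite /U1; ring | rewrite -DU1 /V1; ring].
  - by split=> //; [rewrite /U2; ring | rewrite -DU2 /V2; ring].
have hmult k : ~ mult (pb h) (pt (J k)) 2.
  have [eu nz _] := TJ k; apply: lf4_not_mult2 => //.
  by rewrite (_ : _ + _ = c * T k + D0) // eu; ring.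
have pbh0 : pb h != 0.
  apply/eqP => pbh; apply: (hmult 0); rewrite pbh; exact: mult_zero.
have ev_h : mmap polyC (lincomb M polyC sig) h = 0.
  rewrite mmap_lf4 // /sig /= /sv /su /D.
  clearbody c D0 A; rewrite !(polyCD, polyCB, polyCM, polyCN); ring.
pose n := (2 * d.+1).+1.
pose rho0 (F : R d.+1) : 'rV[K]_n := poly_rV (curve_ev M sig F).
have rho_lin : linear rho0 by move=> a F G; rewrite /rho0 !linearP.
pose rho : {linear R d.+1 -> 'rV[K]_n} := HB.pack rho0 (GRing.isLinear.Build _ _ _ _ rho0 rho_lin).
have hsz (F : R d.+1) : (size (curve_ev M sig F) <= n)%N.
  rewrite /n mulnC; apply: (size_mmap (e := 2) (dhomog_is_dhomog F)) => l.
  apply: leq_trans (size_sum _ _ _) _; apply/bigmax_leqP => k _.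
  rewrite mul_polyC; apply: leq_trans (size_scale_leq _ _) _.
  have sD : (size D <= 2)%N.
    by rewrite size_MXaddC; case: ifP => // _; rewrite ltnS size_polyC_leq1.
  have ssu : (size su <= 2)%N by rewrite /su addrC size_XaddC.
  have ssv : (size sv <= 2)%N.
    apply: leq_trans (size_polyD _ _) _; rewrite geq_max !mul_polyC.
    by rewrite !(leq_trans (size_scale_leq _ _)) ?size_polyX.
  rewrite /sig; case: ifP => _; first exact: leqW.
  by case: ifP => _; [exact: (@size_polyM_leq _ _ _ 1 1) |
    case: ifP => _; [exact: leqW | exact: (@size_polyM_leq _ _ _ 1 1)]].
have rho0E (F : R d.+1) : rho F = 0 -> curve_ev M sig F = 0.
  by move=> /(congr1 (@rVpoly _ _)); rewrite poly_rV_K // linear0.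
have hvan k F m0 : mult (pb (F : R d.+1)) (pt (J k)) m0 -> ('X - (T k)%:P) ^+ m0 %| curve_ev M sig F.
  have [eu nz ev] := TJ k => mF.
  apply: (curve_order (dhomog_is_dhomog F) _ _ _ _ mF).
  - by rewrite /sig /= /D !hornerE.
  - by rewrite /sig /= /D /su !hornerE eu.
  - by rewrite /sig /= /sv /D !hornerE.
  - by rewrite /sig /= [X in _ %| X](_ : _ = 0) ?dvdp0 //; ring.
(* A form vanishing on Q has arbitrarily high contact with the conic at one point, in particular
   more than its degree on the conic. *)
have rhoZ (F : R d.+1) : pb F = 0 -> rho F = 0.
  move=> F0; suff e : curve_ev M sig F = 0 by rewrite /= /rho0 e linear0.
  apply: (dvdp_size_eq0 T_inj (m := fun k => if val k == 0%N then n else 0)%N) => [k|].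
    by apply: hvan; rewrite F0; apply: mult_zero.
  by rewrite (bigD1 ord0) //= (leq_trans (hsz F)) ?leq_addr.
have rhoh (B : R d) : rho (hmul hh B) = 0.
  by rewrite /= /rho0 /curve_ev /= rmorphM /= ev_h mul0r linear0.
have rho_surj j : exists F, rho F = delta_mx 0 j.
  (* These restrict to 1, t and t^2, being (D - c t) / D0, (sv - v0 D) / A and (su - u0) (sv - v0 D)
     / A, with (u0, v0) the first point. *)
  pose L k := if k == 0%N then lf4 M ((1 + c / A * v i0) / D0) 0 (- (c / A / D0)) 0
    else if k == 1%N then lf4 M (- (v i0 / A)) 0 A^-1 0
    else lf4 M (u i0 * v i0 / A) (- (v i0 / A)) (- (u i0 / A)) A^-1.
  have [|k k3|F hF eF] := @quadratic_surj K {poly K} polyC (lincomb M polyC sig) 'X L d.+1 j _ _ (ltn_ord j).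
  - by move=> k; rewrite /L; case: ifP => _; [|case: ifP => _]; apply: lf4_homog.
  - rewrite /L; case: k k3 => [|[|[|//]]] _ /=; rewrite mmap_lf4 // /sig /= /sv /su /D.
    + set P := LHS; have -> : P = (D0 * ((1 + c / A * v i0) / D0) - c / A / D0 * (v i0 * D0))%:P
        + (c * ((1 + c / A * v i0) / D0) - c / A / D0 * (v i0 * c + A))%:P * 'X.
        by rewrite /P; clearbody c D0 A; rewrite !(polyCD, polyCB, polyCM, polyCN); ring.
      rewrite expr0 (_ : _ - _ = 1); last by field; rewrite D00 A0.
      by rewrite (_ : _ - _ = 0) ?mul0r ?addr0 //; field; rewrite D00 A0.
    + set P := LHS; have -> : P = (A^-1 * A)%:P * 'X.
        by rewrite /P; clearbody c D0 A; rewrite !(polyCD, polyCB, polyCM, polyCN); ring.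
      by rewrite mulVf // mul1r.
    + set P := LHS; have -> : P = (A^-1 * A)%:P * 'X^2.
        by rewrite /P; clearbody c D0 A; rewrite !(polyCD, polyCB, polyCM, polyCN); ring.
      by rewrite mulVf // mul1r.
  exists (DHomog hF); rewrite /= /rho0 /curve_ev /= eF poly_rV_Xn.
  by congr delta_mx; apply: val_inj.
have hker := restriction_ker (e := 1) (d := d) uM pbh0 rhoZ rhoh rho_surj.
pose W := (qsys M pt d.+1 m :&: lker (linfun rho))%VS.
have dW : (\dim (qsys M pt d.+1 m) + \sum_k m (J k) <= n + \dim W)%N.
  apply: (dim_poly_vanish T_inj (A := curve_ev M sig)).
  - by move=> F _; apply: hsz.
  - by move=> F k /mem_qsys hF; apply/hvan/hF.
  - move=> F FW F0; rewrite memv_cap FW memv_ker lfunE /= /rho0 F0.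
    by rewrite linear0.
  - by rewrite !big_ord_recl big_ord0 /J /= addn0 addnA.
have dW' : (\dim W + \dim (kerpb M d) <=
    \dim (kerpb M d.+1) + \dim (qsys M pt d (fun i => (m i).-1)))%N.
  apply: (@qsys_step _ _ _ _ 1 d h hh pbh0 _ _ _ (capvSl _ _)) => [i|i|F].
  - have [iJ|/hm ->//] := boolP (i \in [:: i0; i1; i2]).
    have [k ->] : exists k, i = J k.
      move: iJ; rewrite !inE => /or3P[]/eqP ->; by [exists 0 | exists 1 | exists 2].
    by case: (m (J k)) => // n' _; rewrite subSnn; apply: hmult.
  - exact: leq_pred.
  rewrite memv_cap memv_ker lfunE => /andP[_ /eqP rF]; apply: hker rF.
  by rewrite /n !expnS; clear; lia.
have sJ : (\sum_k m (J k) = m i0 + m i1 + m i2)%N.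
  by rewrite !big_ord_recl big_ord0 /J /= addn0 addnA.
by move: dW dW'; rewrite sJ /n; clear; lia.
Qed.
End Conic.

Lemma dvdp_horner_sub (K : fieldType) (E x y : {poly K}) (Q : {poly {poly K}}) :
  E %| x - y -> E %| Q.[x] - Q.[y].
Proof.
move=> h; have /factor_theorem[q eq] : root (Q - Q.[y]%:P) y.
  by rewrite rootE hornerD hornerN hornerC subrr.
have -> : Q.[x] - Q.[y] = (Q - Q.[y]%:P).[x] by rewrite hornerD hornerN hornerC.
by rewrite eq hornerM hornerXsubC dvdp_mull.
Qed.

Section Elliptic.
Variables (K : fieldType) (M : 'M[K]_4).
Hypothesis uM : M \in unitmx.
Hypothesis two0 : (2 : K) != 0.
Local Notation R d := (dhomog 4 K d).
Local Notation pb := (comp_mpoly (qparam M)).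
Variables (c1 c2 c3 : {poly K}).
Hypotheses (sc1 : (size c1 <= 3)%N) (sc2 : (size c2 <= 3)%N) (sc3 : (size c3 <= 3)%N).
Hypothesis c_span : forall j, (j < 3)%N -> exists a : K * K * K,
  a.1.1 *: c1 + a.1.2 *: c2 + a.2 *: c3 = 'X^j.
Let f := c1 ^+ 2 - 4 * c2 * c3.
Hypothesis f_nsq : forall h : {poly K}, f <> h ^+ 2.

(* The double cover y^2 = f(s) in Segre coordinates. *)
Definition ellsig (A : comNzRingType) (io : {poly K} -> A) (y : A) (k : 'I_4) : A :=
  if val k == 0%N then io c3 else if val k == 1%N then io (2^-1)%:P * (io c1 + y)
  else if val k == 2 then io (2^-1)%:P * (io c1 - y) else io c2.

Definition ell_ev d (F : R d) : {poly {poly K}} :=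
  mmap (polyC \o polyC) (lincomb M (polyC \o polyC) (ellsig polyC 'X)) F.

(* F restricts to ell_a F + y ell_b F on the double cover. *)
Definition ell_a d (F : R d) := (even_poly (ell_ev F)).[f].
Definition ell_b d (F : R d) := (odd_poly (ell_ev F)).[f].

Lemma ell_ev_linear d a (F G : R d) : ell_ev (a *: F + G) = a%:P *: ell_ev F + ell_ev G.
Proof. by rewrite /ell_ev mmapD mmapZ /= mul_polyC. Qed.

Lemma ell_a_linear d : linear (@ell_a d).
Proof.
move=> a F G; rewrite /ell_a ell_ev_linear even_polyD even_polyZ hornerD hornerZ.
by rewrite mul_polyC.
Qed.
HB.instance Definition _ d := GRing.isLinear.Build K (R d) {poly K} _ (@ell_a d) (@ell_a_linear d).

Lemma ell_b_linear d : linear (@ell_b d).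
Proof.
move=> a F G; rewrite /ell_b ell_ev_linear odd_polyD odd_polyZ hornerD hornerZ.
by rewrite mul_polyC.
Qed.
HB.instance Definition _ d := GRing.isLinear.Build K (R d) {poly K} _ (@ell_b d) (@ell_b_linear d).

Lemma f_size : (size f <= 5)%N.
Proof.
rewrite /f; apply: leq_trans (size_polyD _ _) _; rewrite size_polyN geq_max.
rewrite expr2 (@size_polyM_leq _ _ _ 2 2) //=.
rewrite -mulrA mulr_natl -scaler_nat; apply: leq_trans (size_scale_leq _ _) _.
exact: (@size_polyM_leq _ c2 c3 2 2).
Qed.

(** With weight 1 for s and weight 2 for y, all four Segre coordinates have weight at most 2. As f
    has degree at most 4, replacing y^2 by f respects these weights; this is the source of the
    bounds on [ell_a] and [ell_b]. *)
Lemma ell_ev_weight d (F : R d) i : (size ((ell_ev F)`_i)%R <= (2 * d).+1 - 2 * i)%N.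
Proof.
pose Q k (P : {poly {poly K}}) := forall i, (size (P`_i)%R <= k.+1 - 2 * i)%N.
suff : Q (d * 2)%N (ell_ev F) by rewrite mulnC; apply.
have Q0 k : Q k 0 by move=> j; rewrite coef0 size_poly0.
have QD k (p q : {poly {poly K}}) : Q k p -> Q k q -> Q k (p + q).
  by move=> hp hq j; rewrite coefD; apply: leq_trans (size_polyD _ _) _; rewrite geq_max hp hq.
have QZ k c (p : {poly {poly K}}) : Q k p -> Q k ((polyC \o polyC) c * p).
  move=> hp j; rewrite /= coefCM mul_polyC.
  exact: leq_trans (size_scale_leq _ _) _.
have Q1 : Q 0%N 1.
  by move=> [|j]; rewrite coef1 ?size_poly0 // size_poly1.
have QM k l p q : Q k p -> Q l q -> Q (k + l)%N (p * q).
  move=> hp hq j; rewrite coefM.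
  apply: leq_trans (size_sum _ _ _) _; apply/bigmax_leqP => t _.
  have := hp t; have := hq (j - t)%N; have := ltn_ord t.
  have [->|p0] := eqVneq p`_t 0; first by rewrite mul0r size_poly0.
  have [->|q0] := eqVneq q`_(j - t) 0; first by rewrite mulr0 size_poly0.
  rewrite size_mul //; move: p0 q0; rewrite -!size_poly_gt0.
  have arith n1 n2 n3 : (0 < n1 -> 0 < n2 -> n3 < j.+1 -> n2 <= l.+1 - 2 * (j - n3) ->
    n1 <= k.+1 - 2 * n3 -> (n1 + n2).-1 <= (k + l).+1 - 2 * j)%N by clear; lia.
  exact: arith.
have Qx l : Q 2 (lincomb M (polyC \o polyC) (ellsig polyC 'X) l).
  rewrite /lincomb; elim/big_ind: _ => [|p q|k _]; [exact: Q0 | exact: QD | apply: (QZ 2%N)].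
  have QC (p : {poly K}) : (size p <= 3)%N -> Q 2 p%:P.
    by move=> hp [|j]; rewrite coefC ?size_poly0.
  have QX : Q 2 'X by move=> [|[|j]]; rewrite coefX ?size_poly0 // size_poly1.
  have QNX : Q 2 (- 'X) by move=> j; rewrite coefN size_polyN.
  rewrite /ellsig; case: ifP => _; first exact: (QC c3).
  case: ifP => _; first by apply: (QZ 2%N); apply: (QD 2%N) => //; apply: (QC c1).
  case: ifP => _; first by apply: (QZ 2%N); apply: (QD 2%N) => //; apply: (QC c1).
  exact: (QC c2).
exact: (@mmap_graded 4 K _ (polyC \o polyC) (lincomb M (polyC \o polyC) (ellsig polyC 'X))
  Q 2 d F (dhomog_is_dhomog F) Q0 QD QZ Q1 QM Qx).
Qed.

Lemma size_fX j : (size (f ^+ j) <= (4 * j).+1)%N.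
Proof.
elim: j => [|j IH]; first by rewrite expr0 size_poly1.
by rewrite exprS mulnS; apply: size_polyM_leq => //; apply: f_size.
Qed.

Lemma size_mul_fX (p : {poly K}) j n : (size p <= n.+1 - 4 * j)%N ->
  (size (p * f ^+ j)%R <= n.+1)%N.
Proof.
have [->|p0] := eqVneq p 0; first by rewrite mul0r size_poly0.
have := size_fX j; have := size_polyMleq p (f ^+ j); move: p0; rewrite -size_poly_gt0.
by move: (size (p * f ^+ j)%R) (size p) (size (f ^+ j)) => *; lia.
Qed.

Lemma size_ell_a d (F : R d) : (size (ell_a F) <= (2 * d).+1)%N.
Proof.
rewrite /ell_a horner_coef; apply: leq_trans (size_sum _ _ _) _.
apply/bigmax_leqP => j _; rewrite coef_even_poly; apply: size_mul_fX.
by have := ell_ev_weight F j.*2; rewrite -mul2n mulnA.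
Qed.

Lemma size_ell_b d (F : R d) : (size (ell_b F) <= (2 * d).-1)%N.
Proof.
case: d F => [|d] F.
  rewrite muln0 /= leqn0 size_poly_eq0 /ell_b horner_coef big1 // => j _.
  rewrite coef_odd_poly; have := ell_ev_weight F (j.*2).+1.
  have -> : ((2 * 0).+1 - 2 * j.*2.+1 = 0)%N by clear; lia.
  by rewrite leqn0 size_poly_eq0 => /eqP ->; rewrite mul0r.
rewrite /ell_b horner_coef; apply: leq_trans (size_sum _ _ _) _.
apply/bigmax_leqP => j _; rewrite coef_odd_poly.
have -> : (2 * d.+1).-1 = (2 * d).+1 by clear; lia.
apply: size_mul_fX; apply: leq_trans (ell_ev_weight F _) _.
by rewrite -muln2; clear; lia.
Qed.

Lemma ell_ev_horner d (F : R d) (Z : {poly K}) :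
  (ell_ev F).[Z] = mmap polyC (lincomb M polyC (ellsig idfun Z)) F.
Proof.
rewrite -[LHS]/(horner_eval Z _) /ell_ev (rmorph_mmap (horner_eval Z)).
apply: eq_mmap => [c|l] /=; first by rewrite /horner_eval hornerC.
rewrite /lincomb raddf_sum; apply: eq_bigr => k _ /=.
rewrite /horner_eval hornerM hornerC; congr (_ * _); rewrite /ellsig.
case: ifP => _; first by rewrite hornerC.
case: ifP => _; first by rewrite hornerM hornerD !hornerC hornerX.
case: ifP => _; first by rewrite hornerM hornerD hornerN !hornerC hornerX.
by rewrite hornerC.
Qed.

Lemma ell_ev_ab d (F : R d) (E Z : {poly K}) : E %| Z ^+ 2 - f ->
  E %| (ell_ev F).[Z] - (ell_a F + ell_b F * Z).
Proof.
move=> h; rewrite -{1}[ell_ev F]poly_even_odd hornerD hornerM hornerX !horner_comp hornerXn.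
have -> : (even_poly (ell_ev F)).[Z ^+ 2] + (odd_poly (ell_ev F)).[Z ^+ 2] * Z -
   (ell_a F + ell_b F * Z) = ((even_poly (ell_ev F)).[Z ^+ 2] - ell_a F) +
    ((odd_poly (ell_ev F)).[Z ^+ 2] - ell_b F) * Z by ring.
by apply: dvdp_add; [|apply: dvdp_mulr]; apply: dvdp_horner_sub.
Qed.

Lemma ell_vanish d (F : R d) (s0 u0 v0 y0 : K) (Z : {poly K}) m : Z.[s0] = y0 ->
  c3.[s0] != 0 -> 2 * u0 * c3.[s0] = c1.[s0] + y0 -> 2 * v0 * c3.[s0] = c1.[s0] - y0 ->
  ('X - s0%:P) ^+ m %| Z ^+ 2 - f ->
  mult (pb F) (pt2 u0 v0) m -> ('X - s0%:P) ^+ m %| ell_a F + ell_b F * Z.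
Proof.
move=> Zs c30 eu ev hZ mF.
rewrite -[X in _ %| X](subKr (ell_ev F).[Z]); apply: dvdp_sub; last exact: ell_ev_ab.
rewrite ell_ev_horner.
apply: (curve_order (dhomog_is_dhomog F) _ _ _ _ mF).
- by rewrite /ellsig.
- rewrite /ellsig /= hornerM hornerD hornerC Zs -eu; field.
  exact: two0.
- rewrite /ellsig /= hornerM hornerD hornerN hornerC Zs -ev; field.
  exact: two0.
rewrite /ellsig /=.
have -> : (2^-1)%:P * (c1 + Z) * ((2^-1)%:P * (c1 - Z)) - c3 * c2 =
   (- (2^-1 * 2^-1)%:P) * (Z ^+ 2 - f).
  have e4 : (2^-1 * 2^-1)%:P * 4 = 1 :> {poly K}.
    rewrite -[4]/(4%:R) -polyC_natr -polyCM (_ : _ * _ = 1) //; field; exact: two0.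
  have -> : c3 * c2 = ((2^-1 * 2^-1)%:P * 4) * (c3 * c2) by rewrite e4 mul1r.
  by rewrite polyCM /f; ring.
exact: dvdp_mull.
Qed.
Lemma ell_form_surj d k : (k <= 2 * d)%N ->
  exists2 F, F \is d.-homog &
    mmap (polyC \o polyC) (lincomb M (polyC \o polyC) (ellsig polyC 'X)) F = ('X^k)%:P.
Proof.
move=> kd.
have /fin_all_exists [a ea] : forall j : 'I_3, exists a : K * K * K,
    a.1.1 *: c1 + a.1.2 *: c2 + a.2 *: c3 = 'X^j by move=> j; apply: c_span.
(* Equal coefficients on the two middle coordinates cancel y and leave a combination of c1, c2 and
   c3. *)
pose L j := let b := a (inord j) in lf4 M b.2 b.1.1 b.1.1 b.1.2.
have half : (2^-1)%:P + (2^-1)%:P = 1 :> {poly K}.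
  by rewrite -polyCD (_ : _ + _ = 1) //; field.
have [|j j3|F hF eF] := @quadratic_surj K _ (polyC \o polyC)
  (lincomb M (polyC \o polyC) (ellsig polyC 'X)) 'X%:P L d k _ _ kd.
- by move=> j; apply: lf4_homog.
- rewrite /L mmap_lf4 // /ellsig /= -rmorphXn /=.
  have := ea (inord j); rewrite inordK // => <-; move: (a _) => [[b1 b2] b3] /=.
  rewrite !polyCD -!mul_polyC !polyCM.
  have idn (A : comNzRingType) (x1 x2 x3 h y C1 C2 C3 : A) : h + h = 1 ->
      x3 * C3 + x1 * (h * (C1 + y)) + x1 * (h * (C1 - y)) + x2 * C2 = x1 * C1 + x2 * C2 + x3 * C3.
    move=> hh; transitivity (x1 * ((h + h) * C1) + x2 * C2 + x3 * C3); first by ring.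
    by rewrite hh mul1r.
  by apply: idn; rewrite -polyCD half.
by exists F => //; rewrite eF -rmorphXn.
Qed.

Section Step.
Variables (r : nat) (s u v y : 'I_r -> K) (i0 : 'I_r).
Hypotheses (s_inj : injective s) (y_neq0 : forall i, y i != 0)
  (y_sqr : forall i, y i ^+ 2 = f.[s i]) (c3_neq0 : forall i, c3.[s i] != 0)
  (u_def : forall i, 2 * u i * c3.[s i] = c1.[s i] + y i)
  (v_def : forall i, 2 * v i * c3.[s i] = c1.[s i] - y i).
Variable g : {mpoly K[4]}.
Hypotheses (g_homog : g \is 2.-homog)
  (g_ell : mmap (polyC \o polyC) (lincomb M (polyC \o polyC) (ellsig polyC 'X)) g = 0)
  (g_mult : forall i, ~ mult (pb g) (pt2 (u i) (v i)) 2).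
Let pt i := pt2 (u i) (v i).

(** With N = d + 2, the pairs (a, b) fill a space of dimension (2 N + 1) + (2 N - 1) = 4 N = (d +
    3)^2 - (d + 1)^2. This leaves room in the kernel of the restriction for nothing but multiples of
    g on Q. *)
Lemma elliptic_step d (m : 'I_r -> nat) :
  (\sum_i m i < 4 * d.+2)%N ->
  (\dim (qsys M pt d.+2 m) + \dim (kerpb M d) + \sum_i m i <=
   \dim (kerpb M d.+2) + \dim (qsys M pt d (fun i => (m i).-1)) + 4 * d.+2)%N.
Proof.
move=> lt.
have pbg0 : pb g != 0.
  by apply/eqP => g0; apply: (@g_mult i0); rewrite g0; apply: mult_zero.
pose N := d.+2.
pose rho0 (F : R N) : 'rV[K]_((2 * N).+1 + (2 * N).-1) :=
  row_mx (poly_rV (ell_a F)) (poly_rV (ell_b F)).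
have rho_lin : linear rho0.
  by move=> a F G; rewrite /rho0 !linearP scale_row_mx add_row_mx.
pose rho : {linear R N -> 'rV[K]_((2 * N).+1 + (2 * N).-1)} :=
  HB.pack rho0 (GRing.isLinear.Build _ _ _ _ rho0 rho_lin).
have rho0P (F : R N) : rho F = 0 -> ell_a F = 0 /\ ell_b F = 0.
  rewrite /= /rho0 -row_mx0 => /eq_row_mx[ea eb]; split.
    by rewrite -(poly_rV_K (size_ell_a F)) ea linear0.
  by rewrite -(poly_rV_K (size_ell_b F)) eb linear0.
have rhoP0 (F : R N) : ell_a F = 0 -> ell_b F = 0 -> rho F = 0.
  by move=> ea eb; rewrite /= /rho0 ea eb !linear0 row_mx0.
have lift i n : exists2 Z : {poly K}, ('X - (s i)%:P) ^+ n %| Z ^+ 2 - f & Z.[s i] = y i.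
  exact: sqrt_lift.
have van i n (F : R N) (Z : {poly K}) k : Z.[s i] = y i -> (k <= n)%N ->
    ('X - (s i)%:P) ^+ n %| Z ^+ 2 - f -> mult (pb F) (pt i) k ->
    ('X - (s i)%:P) ^+ k %| ell_a F + ell_b F * Z.
  move=> Zs kn hZ mF; apply: (ell_vanish Zs) mF => //.
  by apply: dvdp_trans hZ; apply: dvdp_exp2l.
(* The norm a^2 - b^2 f has degree at most 4 N but vanishes to order 4 N + 1 at [s i0], so it is
   zero, and then a = b = 0. *)
have rhoZ (F : R N) : pb F = 0 -> rho F = 0.
  move=> F0; have [Z hZ Zs] := lift i0 (4 * N).+1.
  have vF : ('X - (s i0)%:P) ^+ (4 * N).+1 %| ell_a F + ell_b F * Z.
    by apply: (van i0 (4 * N).+1) => //; rewrite F0; apply: mult_zero.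
  suff /(norm_eq0 f_nsq)[ea eb] : ell_a F ^+ 2 = ell_b F ^+ 2 * f by apply: rhoP0.
  apply/eqP; rewrite -subr_eq0; apply/eqP.
  apply: (@dvdp_size_eq0 _ _ s s_inj (fun i => if i == i0 then (4 * N).+1 else 0)%N) => [i|].
    case: eqP => [->|_]; last by rewrite expr0 dvd1p.
    have -> : ell_a F ^+ 2 - ell_b F ^+ 2 * f = (ell_a F + ell_b F * Z) * (ell_a F - ell_b F * Z)
      + ell_b F ^+ 2 * (Z ^+ 2 - f) by ring.
    by apply: dvdp_add; [apply: dvdp_mulr | apply: dvdp_mull].
  rewrite (bigD1 i0) //= eqxx; apply: leq_trans (leq_addr _ _).
  apply: leq_trans (size_polyD _ _) _; rewrite size_polyN geq_max; apply/andP; split.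
    rewrite expr2; apply: leq_trans (size_polyM_leq (size_ell_a F) (size_ell_a F)) _.
    by clear; lia.
  have sb := size_ell_b F; have -> : (4 * N).+1 = ((2 * N).-2 + (2 * N).-2 + 4).+1.
    by rewrite /N; clear; lia.
  apply: size_polyM_leq f_size; rewrite expr2; apply: size_polyM_leq;
    by apply: leq_trans sb _; rewrite /N; clear; lia.
have rhog (B : R d) : rho (hmul g_homog B) = 0.
  have e0 : ell_ev (hmul g_homog B) = 0 by rewrite /ell_ev /= rmorphM /= g_ell mul0r.
  by apply: rhoP0; rewrite /ell_a /ell_b e0 linear0 horner0.
have rho_surj j : exists F, rho F = delta_mx 0 j.
  rewrite -[j]splitK; case: split => k /=.
    have [F hF eF] : exists2 F, F \is N.-homog & mmap (polyC \o polyC)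
      (lincomb M (polyC \o polyC) (ellsig polyC 'X)) F = ('X^k)%:P.
      by apply: ell_form_surj; rewrite -ltnS; apply: ltn_ord.
    have e : ell_ev (DHomog hF) = ('X^k)%:P := eF.
    exists (DHomog hF); rewrite /= /rho0 /ell_a /ell_b e.
    rewrite even_polyC hornerC (_ : odd_poly _ = 0); last first.
      by apply/polyP => i; rewrite coef_odd_poly coefC coef0.
    rewrite horner0 linear0 poly_rV_Xn; apply/rowP => i; rewrite !mxE.
    case: splitP => i' ei; rewrite !mxE -!val_eqE /= ei //.
    by rewrite gtn_eqF // ltn_addr // ltn_ord.
  have [|F hF eF] := @ell_form_surj N.-1 k.
    by have := ltn_ord k; rewrite /N; lia.
  (* The difference of the two middle Segre coordinates restricts to y, so multiplying it by a form
     of degree N - 1 that restricts to s^k gives y s^k. *)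
  have hF' : lf4 M 0 1 (-1) 0 * F \is N.-homog.
    by rewrite -[N]/(1 + N.-1)%N dhomogM // lf4_homog.
  have e : ell_ev (DHomog hF') = ('X^k)%:P * 'X.
    rewrite /ell_ev /= rmorphM /= eF mmap_lf4 // /ellsig /= mulrC; congr (_ * _).
    have half : (2^-1)%:P + (2^-1)%:P = 1 :> {poly K}.
      by rewrite -polyCD (_ : _ + _ = 1) //; field.
    rewrite !(rmorph0, rmorphN1, rmorph1, mul0r, add0r, addr0, mul1r, mulN1r).
    rewrite -mulrBr opprB addrC.
    have idn (A : comNzRingType) (h c x : A) : h + h = 1 -> h * (x - c + (c + x)) = x.
      by move=> hh; transitivity ((h + h) * x); [ring | rewrite hh mul1r].
    by apply: idn; rewrite -polyCD half.
  exists (DHomog hF'); rewrite /= /rho0 /ell_a /ell_b e.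
  rewrite even_polyMX odd_polyMX even_polyC (_ : odd_poly _ = 0); last first.
    by apply/polyP => i; rewrite coef_odd_poly coefC coef0.
  rewrite mul0r horner0 linear0 hornerC poly_rV_Xn; apply/rowP => i; rewrite !mxE.
  case: splitP => i' ei; rewrite !mxE -!val_eqE /= ei.
    by rewrite ltn_eqF // ltn_addr // ltn_ord.
  by rewrite eqn_add2l.
have dims : ((2 + d).+1 ^ 2 <= (2 * N).+1 + (2 * N).-1 + d.+1 ^ 2)%N.
  by rewrite /N !expnS; clear; lia.
have hker := @restriction_ker K M uM 2 d g g_homog pbg0 _ rho rhoZ rhog rho_surj dims.
pose W := (qsys M pt N m :&: lker (linfun rho))%VS.
have /fin_all_exists2 [Z hZ Zs] : forall i, exists2 Z : {poly K},
  ('X - (s i)%:P) ^+ (4 * N) %| Z ^+ 2 - f & Z.[s i] = y i by move=> i; apply: lift.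
have dW : (\dim (qsys M pt N m) + \sum_i m i <= 4 * N + \dim W)%N.
  apply: (@dim_elliptic_vanish K f f_nsq f_size _ s Z s_inj _ (@ell_a N) (@ell_b N)) => //.
  - by move=> F _; apply: size_ell_a.
  - by move=> F _; apply: size_ell_b.
  - move=> F i /mem_qsys hF; apply: (van i (4 * N)%N) (hF i) => //.
    by apply: leq_trans (ltnW lt); rewrite (bigD1 i) //= leq_addr.
  - move=> F FW ea eb; rewrite memv_cap FW memv_ker lfunE; apply/eqP; exact: rhoP0.
  by apply/eqP => /card0_eq/(_ i0).
have dW' : (\dim W + \dim (kerpb M d) <=
    \dim (kerpb M d.+2) + \dim (qsys M pt d (fun i => (m i).-1)))%N.
  apply: (@qsys_step _ _ _ _ 2 d g g_homog pbg0 _ _ _ (capvSl _ _)) => [i|i|F].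
  - by case: (m i) => // n' _; rewrite subSnn; apply: g_mult.
  - exact: leq_pred.
  by rewrite memv_cap memv_ker lfunE => /andP[_ /eqP rF]; apply: hker rF.
by move: dW dW'; rewrite /N; clear; lia.
Qed.
End Step.
End Elliptic.

(** At the origin the generic line is t Z, so the coefficient of t^j is the homogeneous part of
    degree j. *)
Lemma gline_origin_coef (K : fieldType) n (P : {mpoly K[n]}) m j :
  ((gline (fun=> 0) P)`_j)@_m = if mdeg m == j then P@_m else 0.
Proof.
have e : gline (fun=> 0) P = \sum_(m <- msupp P) ((P@_m)%:MP * 'X_[m])%:P * 'X^(mdeg m).
  rewrite /gline /mmap; apply: eq_bigr => k _ /=.
  rewrite polyCM -mulrA; congr (_ * _); rewrite /mmap1.
  rewrite (eq_bigr (fun i => 'X ^+ k i * ('X_i ^+ k i)%:P)) => [|i _]; last first.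
    by rewrite mpolyC0 polyC0 add0r exprMn rmorphXn.
  rewrite big_split /= prodrXr -mdegE mulrC; congr (_ * _).
  by rewrite mpolyXE_id rmorph_prod.
rewrite e coef_sum raddf_sum /= (eq_bigr (fun k => if mdeg m == j then P@_k * ('X_[k])@_m else 0)).
  case: ifP => _; last by rewrite big1.
  rewrite [in RHS](mpolyE P) raddf_sum; apply: eq_bigr => k _.
  by rewrite /= mcoeffZ.
move=> k _; rewrite coefCM coefXn mul_mpolyC.
case: (eqVneq k m) => [->|km].
  rewrite eq_sym; case: eqP => _; last by rewrite mulr0 mcoeff0.
  by rewrite mulr1 mcoeffZ.
by rewrite mulr_natr mcoeffMn mcoeffZ mcoeffX (negPf km) !mulr0 mul0rn if_same.
Qed.

Lemma mult_origin (K : fieldType) n (P : {mpoly K[n]}) k m :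
  mult P (fun=> 0) k -> m \in msupp P -> (k <= mdeg m)%N.
Proof.
move=> [G eG]; rewrite mcoeff_msupp leqNgt; apply: contra => lt.
have := gline_origin_coef P m (mdeg m); rewrite eqxx => <-.
by rewrite eG coefXnM lt mcoeff0.
Qed.

Lemma leq_predn a b : (a <= b)%N -> (a.-1 <= b.-1)%N.
Proof. by lia. Qed.

Section Tangent.
Variables (K : fieldType) (M : 'M[K]_4).
Hypothesis uM : M \in unitmx.
Local Notation R d := (dhomog 4 K d).
Local Notation pb := (comp_mpoly (qparam M)).

(** A translation of (u, v) acts linearly on (1, u, v, uv), so it can be absorbed into the
    matrix. *)
Lemma pb_shift (u0 v0 : K) : exists M', forall F : {mpoly K[4]},
  F \mPo qparam M' = pb F \mPo [tuple (u0%:MP + 'X_0); (v0%:MP + 'X_1)].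
Proof.
pose M' : 'M[K]_4 := \matrix_(k, l)
  (if val k == 0%N then M 0 l + u0 * M 1 l + v0 * M 2 l + u0 * v0 * M 3 l
   else if val k == 1%N then M 1 l + v0 * M 3 l
   else if val k == 2 then M 2 l + u0 * M 3 l else M 3 l).
exists M' => F; rewrite [RHS]mmap_pb.
apply: eq_mmap => // l; rewrite tnth_mktuple /lincomb !big_ord_recl !big_ord0.
rewrite /segreA /segre !mxE /= !(tnth_nth 0) /= -!mul_mpolyC !addr0 !mulr1.
have e1 : lift ord0 ord0 = 1 :> 'I_4 by apply: val_inj.
have e2 : lift ord0 (lift ord0 ord0) = 2 :> 'I_4 by apply: val_inj.
have e3 : lift ord0 (lift ord0 (lift ord0 ord0)) = 3 :> 'I_4 by apply: val_inj.
rewrite !e1 !e2 !e3 !mpolyCD !mpolyCM.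
have idn (A : comNzRingType) (a b c e u v x y : A) :
  a + u * b + v * c + u * v * e + ((b + v * e) * x + ((c + u * e) * y + e * (x * y))) =
  a + (b * (u + x) + (c * (v + y) + e * ((u + x) * (v + y)))) by ring.
exact: idn.
Qed.

(** Centred at the point, every monomial has both exponents at most d and total degree at least d +
    1, so both exponents are positive. *)
Lemma pb_tangent (u0 v0 : K) d (F : R d) :
  mult (pb F) (pt2 u0 v0) d.+1 -> (0 < d)%N ->
  exists B : R d.-1, pb F = ('X_0 - u0%:MP) * ('X_1 - v0%:MP) * pb B.
Proof.
move=> mF d0; have [M' eM'] := pb_shift u0 v0.
set sh := [tuple _; _] in eM'.
pose ush : 2.-tuple {mpoly K[2]} := [tuple ('X_0 - u0%:MP); ('X_1 - v0%:MP)].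
pose P := F \mPo qparam M'.
have P_bideg : bideg d P by apply: (@pb_bideg _ M' d F).
have P_mult m : m \in msupp P -> (d < mdeg m)%N.
  apply: mult_origin; rewrite /P eM'; apply: mult_comp mF => k.
  rewrite /pt2 (tnth_nth 0); case: k => -[|[|//]] lk /=; rewrite mevalD mevalC mevalXU addr0 //.
have eP : pb F = P \mPo ush.
  rewrite /P eM' /comp_mpoly (rmorph_mmap (mmap _ (tnth ush))) /= -[LHS](comp_mpoly_id).
  apply: eq_mmap => [c|k] /=; first by rewrite mmapC.
  rewrite tnth_mktuple !(tnth_nth 0).
  case: k => -[|[|//]] lk /=; rewrite mmapD mmapC mmapX mmap1U (tnth_nth 0) /= addrC subrK;
    by congr ('X_ _); apply: val_inj.
have hB (m : 'X_{1..2}) : m \in msupp P -> exists B : R d.-1,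
    'X_[m] \mPo ush = ('X_0 - u0%:MP) * ('X_1 - v0%:MP) * pb B.
  move=> mP; have := P_mult m mP; have := P_bideg m mP; rewrite mdegE !big_ord_recl big_ord0.
  rewrite addn0 => bd dm.
  have e1 : lift ord0 ord0 = 1 :> 'I_2 by apply: val_inj.
  have e0 : ord0 = 0 :> 'I_2 by apply: val_inj.
  rewrite e1 e0 in dm.
  have [m0 m1] : (m 0%R <= d)%N /\ (m 1%R <= d)%N by [].
  have [m0p m1p] : (0 < m 0%R)%N /\ (0 < m 1%R)%N.
    by move: dm m0 m1; move: (m 0%R) (m 1%R); clear; lia.
  pose c k := if k == 0%N then lf4 M 1 0 0 0 else if k == 1%N then lf4 M (- u0) 1 0 0
    else if k == 2 then lf4 M (- v0) 0 1 0 else lf4 M (u0 * v0) (- v0) (- u0) 1.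
  have hc k : c k \is 1.-homog.
    by rewrite /c; case: ifP => _; [|case: ifP => _; [|case: ifP => _]]; apply: lf4_homog.
  have cval : [/\ pb (c 0%N) = 1, pb (c 1%N) = 'X_0 - u0%:MP, pb (c 2) = 'X_1 - v0%:MP &
      pb (c 3) = ('X_0 - u0%:MP) * ('X_1 - v0%:MP)].
    rewrite /c /= !pb_lf4 // -!mul_mpolyC !(mpolyC0, mpolyCN, mpolyC1, mpolyCM).
    rewrite !(mul0r, mul1r, addr0).
    have idn (A : comNzRingType) (a b x y : A) : a * b + - b * x + - a * y + x * y = (x - a) * (y - b).
      by ring.
    by rewrite idn ![- _ + _]addrC.
  have [B eB] := segre_surj uM hc cval (leq_predn m0) (leq_predn m1).
  exists B; rewrite eB comp_mpolyX !big_ord_recl big_ord0 mulr1 e1 !(tnth_nth 0) /=.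
  rewrite mulrACA -!exprS !prednK //.
rewrite eP comp_mpolyE big_seq.
pose Q x := exists B : R d.-1, x = ('X_0 - u0%:MP) * ('X_1 - v0%:MP) * pb B.
rewrite -/(Q _); elim/big_ind: _ => [|x y [B ->] [B' ->]|m mP].
- by exists 0; rewrite comp_mpoly0 mulr0.
- by exists (B + B'); rewrite /= comp_mpolyD [RHS]mulrDr.
have [B] := hB m mP; rewrite comp_mpolyX => ->; exists (P@_m *: B).
by rewrite /= comp_mpolyZ scalerAr.
Qed.

(* A form whose multiplicity at a point exceeds its degree contains the two
   lines of the quadric through that point. *)
Lemma tangent_step r (u v : 'I_r -> K) (pt := fun i => pt2 (u i) (v i)) (i0 : 'I_r) d
    (m : 'I_r -> nat) :
  (forall i, i != i0 -> u i != u i0 /\ v i != v i0) -> m i0 = d.+2 ->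
  (\dim (qsys M pt d.+1 m) + \dim (kerpb M d) <= \dim (kerpb M d.+1) +
   \dim (qsys M pt d (fun i => if i == i0 then d else m i)))%N.
Proof.
move=> uv mi0; set u0 := u i0; set v0 := v i0.
pose T := lf4 M (u0 * v0) (- v0) (- u0) 1.
have hT : T \is 1.-homog by apply: lf4_homog.
have pbT : pb T = ('X_0 - u0%:MP) * ('X_1 - v0%:MP).
  rewrite /T pb_lf4 // -!mul_mpolyC !(mpolyCN, mpolyC1, mpolyCM).
  have idn (A : comNzRingType) (a b x y : A) : a * b + - b * x + - a * y + 1 * (x * y) = (x - a) * (y - b).
    by ring.
  exact: idn.
have pbT0 : pb T != 0.
  have XC (k : 'I_2) a : 'X_k - a%:MP != 0 :> {mpoly K[2]}.
    apply/eqP => /(congr1 (mcoeff U_(k))); rewrite mcoeffB mcoeffXU eqxx mcoeffC mnm1_eq0.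
    by rewrite mulr0 subr0 mcoeff0 => /eqP; rewrite oner_eq0.
  by rewrite pbT mulf_neq0.
apply: (@qsys_step _ _ _ _ 1 d T hT pbT0 _ m _ (subvv _)) => [i|i|F].
(* At its own point (u - u0) (v - v0) has order 2, seen along the diagonal direction; at the other
   points it does not vanish because both parameters differ. *)
- case: eqP => [-> _|/eqP ii0 _].
    rewrite mi0 (_ : (d.+2 - d).+1 = 3); last by clear; lia.
    rewrite pbT => /mult_eval - /(_ (fun=> 1)).
    rewrite rmorphM /= !mmapB !mmapC !mmapX !mmap1U /pt /pt2 /= !mulr1 ![_ + 'X]addrC !addrK.
    move=> /(@dvdp_leq _ _ _ (mulf_neq0 (negbT (polyX_eq0 _)) (negbT (polyX_eq0 _)))).
    by rewrite size_polyXn -expr2 size_polyXn.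
  rewrite subnn pbT => /mult_eval - /(_ (fun=> 0)).
  rewrite rmorphM /= !mmapB !mmapC !mmapX !mmap1U /pt /pt2 /= !mulr0 !addr0 -!polyCB -polyCM.
  rewrite expr1 => /dvdpP[q] /(congr1 (fun p : {poly K} => p`_0)).
  rewrite coefMX coefC /= => /eqP; have [uu vv] := uv i ii0.
  by rewrite mulf_eq0 !subr_eq0 (negPf uu) (negPf vv).
- by case: eqP => [->|//]; rewrite mi0; clear; lia.
move=> /mem_qsys/(_ i0); rewrite mi0 => mF; rewrite pbT.
by have [//|B eB] := pb_tangent mF; exists B.
Qed.
End Tangent.

(** * Monomials and forms vanishing at the coordinate points *)

Lemma ord4_ind (P : 'I_4 -> Prop) : P 0 -> P 1 -> P 2 -> P 3 -> forall k, P k.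
Proof.
move=> h0 h1 h2 h3 [[|[|[|[|//]]]] lk].
- by rewrite (_ : Ordinal lk = 0) //; apply: val_inj.
- by rewrite (_ : Ordinal lk = 1) //; apply: val_inj.
- by rewrite (_ : Ordinal lk = 2) //; apply: val_inj.
by rewrite (_ : Ordinal lk = 3) //; apply: val_inj.
Qed.

Section Monomials.
Variables (K : fieldType) (d : nat).
Local Notation R d := (dhomog 4 K d).
Implicit Types (P : pred 'X_{1..4}).

Definition monset P : {set 'X_{1..4 < d.+1}} := [set a : 'X_{1..4 < d.+1} | (mdeg a == d) && P a].

Lemma supp_lin P : (fun F : R d => forall a, a \in msupp F -> P a) 0 /\
  forall c (F G : R d), (forall a, a \in msupp F -> P a) ->
    (forall a, a \in msupp G -> P a) -> forall a, a \in msupp (c *: F + G) -> P a.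
Proof.
split=> [a|c F G hF hG a]; first by rewrite msupp0.
by move=> /msuppD_le; rewrite mem_cat => /orP[/msuppZ_le/hF|/hG].
Qed.

Definition supp_space P : {vspace R d} := pred_space (supp_lin P).

Lemma mem_supp_space P (F : R d) :
  F \in supp_space P <-> forall a, a \in msupp F -> P a.
Proof. exact: mem_pred_space. Qed.

Lemma dim_supp_space P : \dim (supp_space P) = #|monset P|.
Proof.
pose N := #|monset P|.
pose am (j : 'I_N) : 'X_{1..4} := bmnm (enum_val (A := monset P) j).
pose xm (j : 'I_N) : R d := insubd (0 : R d) 'X_[am j].
have xmE j : xm j = 'X_[am j] :> {mpoly K[4]}.
  rewrite [LHS]val_insubd dhomogX /=.
  by have := enum_valP j; rewrite inE => /andP[/eqP -> _]; rewrite eqxx.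
pose g0 (r : 'rV[K]_N) : R d := \sum_j r 0 j *: xm j.
have g_lin : linear g0.
  move=> c r s; rewrite /g0 scaler_sumr -big_split; apply: eq_bigr => j _.
  by rewrite !mxE scalerDl scalerA.
pose g : {linear 'rV[K]_N -> R d} := HB.pack g0 (GRing.isLinear.Build _ _ _ _ g0 g_lin).
have gE r : g r = \sum_j r 0 j *: 'X_[am j] :> {mpoly K[4]}.
  rewrite [LHS](raddf_sum (@mpoly_of_dhomog 4 K d)); apply: eq_bigr => j _.
  by rewrite -xmE.
have gcoef r j : (g r : {mpoly K[4]})@_(am j) = r 0 j.
  rewrite gE raddf_sum (bigD1 j) //= mcoeffZ mcoeffX eqxx mulr1 big1 ?addr0 // => i ij.
  rewrite mcoeffZ mcoeffX (_ : (_ == _) = false) ?mulr0 //.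
  by apply/negP => /eqP e; case/eqP: ij; apply: enum_val_inj; apply: val_inj.
have ginj : injective g.
  by move=> r s e; apply/rowP => j; rewrite -!gcoef e.
have gsupp r a : a \in msupp (g r : {mpoly K[4]}) -> exists j, a = am j.
  rewrite gE mcoeff_msupp raddf_sum => /eqP h; apply: NNPP => nj; apply: h.
  rewrite big1 // => j _; rewrite /= mcoeffZ mcoeffX (_ : (_ == _) = false) ?mulr0 //.
  by apply/negP => /eqP e; apply: nj; exists j.
have <- : limg (linfun g) = supp_space P.
  apply/vspaceP => F; apply/memv_imgP/idP => [[r _ ->]|/mem_supp_space hF].
    apply/mem_supp_space => a; rewrite lfunE => /gsupp[j ->].
    by have := enum_valP j; rewrite inE => /andP[].
  exists (\row_j (F : {mpoly K[4]})@_(am j)); first exact: memvf.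
  rewrite lfunE; apply/val_inj/mpolyP => a.
  have [aF|aF] := boolP (a \in msupp F); last first.
    rewrite memN_msupp_eq0 //; apply/esym/eqP; rewrite mcoeff_eq0.
    apply/negP => ag; have [j ej] := gsupp _ _ ag.
    by move: ag; rewrite ej mcoeff_msupp gcoef mxE -ej mcoeff_eq0 aF.
  have da : mdeg a = d by have /dhomogP hd := dhomog_is_dhomog F; apply: hd.
  have lt : (mdeg a < d.+1)%N by rewrite da.
  have aA : BMultinom lt \in monset P by rewrite inE /= da eqxx hF.
  have -> : a = am (enum_rank_in aA (BMultinom lt)) by rewrite /am enum_rankK_in.
  by rewrite gcoef mxE.
by rewrite (dim_limg_inj ginj) dimvf /dim /= mul1n.
Qed.

End Monomials.

(** The count is read off a dimension: the monomials divisible by X^b span X^b times the forms of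
    degree d. The field [rat] is an auxiliary choice. *)
Lemma card_monset_ge (b : 'X_{1..4}) d :
  #|monset (mdeg b + d) (fun a => (b <= a)%MM)| = 'C(d + 3, 3).
Proof.
rewrite -(dim_supp_space rat) -(dim_forms rat).
have hX : ('X_[b] : {mpoly rat[4]}) \is (mdeg b).-homog by rewrite dhomogX.
have X0 : ('X_[b] : {mpoly rat[4]}) != 0.
  by apply/eqP => /(congr1 (mcoeff b)); rewrite mcoeffX eqxx mcoeff0 => /eqP; rewrite oner_eq0.
rewrite -(dim_limg_inj (@hmul_inj _ _ _ hX d X0)); congr (\dim _).
apply/vspaceP => F; apply/idP/memv_imgP => [/mem_supp_space hF|[G _ ->]]; last first.
  apply/mem_supp_space => a; rewrite lfunE hmulE mulrC (perm_mem (msuppMX _ _)).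
  by move=> /mapP[c _ ->]; apply: lem_addr.
have hd : {in msupp F, forall a, mdeg a = (mdeg b + d)%N}.
  by have /dhomogP := dhomog_is_dhomog F.
pose G : {mpoly rat[4]} := \sum_(a <- msupp F) F@_a *: 'X_[a - b].
have hG : G \is d.-homog.
  rewrite /G big_seq; apply: rpred_sum => a aF; apply: dhomogZ; rewrite dhomogX /=.
  have := hd a aF; rewrite -{1}(submK (hF a aF)) mdegD addnC => /eqP.
  by rewrite eqn_add2l.
exists (DHomog hG); first exact: memvf.
rewrite lfunE; apply: val_inj; rewrite /= /G mulr_sumr [LHS]mpolyE big_seq [RHS]big_seq.
apply: eq_bigr => a aF; rewrite -scalerAr -mpolyXD; congr (_ *: 'X_[_]).
by rewrite addmC submK // hF.
Qed.

Lemma monset_eq d (P Q : pred 'X_{1..4}) :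
  (forall a, mdeg a = d -> P a = Q a) -> monset d P = monset d Q.
Proof.
move=> h; apply/setP => a; rewrite !inE; case: eqP => //= da.
exact: h.
Qed.

Lemma mnm_le_mdeg (a : 'X_{1..4}) k : (a k <= mdeg a)%N.
Proof. by rewrite mdegE (bigD1 k) //= leq_addr. Qed.

Lemma mnm_le_mdeg2 (a : 'X_{1..4}) k l : k != l -> (a k + a l <= mdeg a)%N.
Proof.
move=> kl; rewrite mdegE (bigD1 k) //= leq_add2l (bigD1 l) ?leq_addr //.
by rewrite eq_sym.
Qed.

Lemma mnm_le_mdeg3 (a : 'X_{1..4}) k l j : uniq [:: k; l; j] -> (a k + a l + a j <= mdeg a)%N.
Proof.
rewrite /= !inE negb_or andbT => /andP[/andP[kl kj] lj].
rewrite mdegE (bigD1 k) //= -addnA leq_add2l (bigD1 l) 1?eq_sym //= leq_add2l.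
by rewrite (bigD1 j) ?leq_addr // [j == k]eq_sym [j == l]eq_sym kj.
Qed.

Section Toric.
Variables (d : nat) (n : 'I_4 -> nat).
Hypothesis n_le : forall k, (n k <= d.+1)%N.
Hypothesis n_le3 : forall k l j, uniq [:: k; l; j] -> (n k + n l + n j <= 2 * d + 2)%N.

(** A monomial of degree d vanishes to order d - a k at the k-th coordinate point; it is bad when
    this is less than n k. *)
Definition badmon k (a : 'X_{1..4}) := (d < a k + n k)%N.

Lemma card_bad1 k : #|monset d (badmon k)| = 'C(n k + 2, 3).
Proof.
have := n_le k; case nk: (n k) => [|c] cd.
  apply: eq_card0 => a; rewrite !inE /badmon nk addn0; apply/negP => /andP[/eqP da h].
  by have := mnm_le_mdeg a k; rewrite da leqNgt h.
pose b := (U_(k) *+ (d - c))%MM.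
have mb : mdeg b = (d - c)%N by rewrite mdegMn mdeg1 mul1n.
have ed : d = (mdeg b + c)%N by rewrite mb subnK.
have -> : (c.+1 + 2 = c + 3)%N by clear; lia.
rewrite -(card_monset_ge b c) -ed; congr #|pred_of_set _|; apply: monset_eq => a da.
rewrite /badmon nk; apply/idP/mnm_lepP => [h l|/(_ k)].
  rewrite mulmnE mnm1E; case: eqP => [<-|_] //; rewrite mul1n.
  by move: h; clear; lia.
by rewrite mulmnE mnm1E eqxx mul1n; move: cd; clear; lia.
Qed.

Lemma card_bad2 k l : k != l ->
  #|monset d (fun a => badmon k a && badmon l a)| = 'C(n k + n l - d + 1, 3).
Proof.
move=> kl; have [le|lt] := leqP (d + 2) (n k + n l); last first.
  rewrite bin_small; last by move: lt; clear; lia.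
  apply: eq_card0 => a; rewrite !inE /badmon; apply/negP => /andP[/eqP da /andP[h1 h2]].
  by have := mnm_le_mdeg2 a kl; rewrite da; move: h1 h2 lt; clear; lia.
pose b := (U_(k) *+ (d.+1 - n k) + U_(l) *+ (d.+1 - n l))%MM.
pose c := (n k + n l - d - 2)%N.
have mb : mdeg b = ((d.+1 - n k) + (d.+1 - n l))%N by rewrite mdegD !mdegMn !mdeg1 !mul1n.
have ed : d = (mdeg b + c)%N.
  by rewrite mb /c; have := n_le k; have := n_le l; move: le; clear; lia.
have -> : (n k + n l - d + 1 = c + 3)%N by rewrite /c; move: le; clear; lia.
rewrite -(card_monset_ge b c) -ed; congr #|pred_of_set _|; apply: monset_eq => a da.
rewrite /badmon; apply/andP/mnm_lepP => [[h1 h2] j|h].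
  rewrite mnmDE !mulmnE !mnm1E; case: (eqVneq k j) => [<-|kj].
    by rewrite eq_sym (negPf kl) mul1n mul0n addn0; move: h1; clear; lia.
  rewrite mul0n add0n; case: eqP => [<-|//]; rewrite mul1n; move: h2; clear; lia.
have := h k; have := h l; rewrite !mnmDE !mulmnE !mnm1E !eqxx (negPf kl) [l == k]eq_sym (negPf kl).
rewrite !mul1n !mul0n addn0 add0n; have := n_le k; have := n_le l.
by clear; split; lia.
Qed.

Lemma card_monset_sum P : #|monset d P| = (\sum_(a in monset d predT) (P (bmnm a) : nat))%N.
Proof.
rewrite -sum1_card [LHS]big_mkcond [RHS]big_mkcond /=; apply: eq_bigr => a _.
by rewrite !inE andbT; case: (_ == _) => //=; case: (P _).
Qed.

(** Inclusion-exclusion stops at pairs: a monomial bad at three points would have degree at least 3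
    (d + 1) - (2 d + 2) > d. The identity therefore holds for each monomial separately. *)
Lemma card_good : (#|monset d (fun a => [forall k, a k + n k <= d])| +
    ('C(n 0%R + 2, 3) + 'C(n 1%R + 2, 3) + 'C(n 2%R + 2, 3) + 'C(n 3%R + 2, 3)) =
  'C(d + 3, 3) + ('C(n 0%R + n 1%R - d + 1, 3) + 'C(n 0%R + n 2%R - d + 1, 3) +
    'C(n 0%R + n 3%R - d + 1, 3) + 'C(n 1%R + n 2%R - d + 1, 3) +
    'C(n 1%R + n 3%R - d + 1, 3) + 'C(n 2%R + n 3%R - d + 1, 3)))%N.
Proof.
have -> : 'C(d + 3, 3) = #|monset d predT|.
  rewrite -(card_monset_ge 0%MM d) mdeg0 add0n; congr #|pred_of_set _|; apply: monset_eq => a _.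
  by apply/mnm_lepP => k; rewrite mnm0E.
rewrite -!card_bad1 -!card_bad2 // !card_monset_sum -!big_split /=.
apply: eq_bigr => a; rewrite inE andbT => /eqP da.
have -> : [forall k, a k + n k <= d]%N =
    [&& ~~ badmon 0 a, ~~ badmon 1 a, ~~ badmon 2 a & ~~ badmon 3 a].
  rewrite /badmon -!leqNgt; apply/forallP/and4P => [h|[h0 h1 h2 h3] k]; first by split; apply: h.
  by apply: (@ord4_ind (fun k => a k + n k <= d)%N).
have tri k l j : uniq [:: k; l; j] -> ~~ [&& badmon k a, badmon l a & badmon j a].
  move=> u; apply/and3P => -[]; rewrite /badmon => h1 h2 h3.
  have := mnm_le_mdeg3 a u; have := n_le3 u; rewrite da.
  by move: h1 h2 h3; clear; lia.
have := tri 0 1 2 isT; have := tri 0 1 3 isT; have := tri 0 2 3 isT; have := tri 1 2 3 isT.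
by do 4!case: badmon.
Qed.
End Toric.

Section MultMore.
Variables (K : fieldType) (n : nat).

Lemma multM (F G : {mpoly K[n]}) x a b : mult F x a -> mult G x b -> mult (F * G) x (a + b).
Proof.
move=> [A eA] [B eB]; exists (A * B).
by rewrite rmorphM /= eA eB exprD mulrACA.
Qed.

Lemma mult_exp (F : {mpoly K[n]}) x a k : mult F x a -> mult (F ^+ k) x (k * a).
Proof.
move=> hF; elim: k => [|k IH]; first exact: mult0.
by rewrite exprS mulSn; apply: multM.
Qed.

Lemma mult_coord (x : 'I_n -> K) l : x l = 0 -> mult ('X_l : {mpoly K[n]}) x 1.
Proof.
move=> xl; exists ('X_l)%:P.
by rewrite /gline mmapX mmap1U xl mpolyC0 polyC0 add0r expr1.
Qed.

Lemma mult_monomial (x : 'I_n -> K) (a : 'X_{1..n}) k :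
  (forall l, l != k -> x l = 0) -> mult ('X_[a] : {mpoly K[n]}) x (mdeg a - a k).
Proof.
move=> hx; have -> : (mdeg a - a k = \sum_(l | l != k) a l)%N.
  by rewrite mdegE (bigD1 k) //= addKn.
rewrite mpolyXE_id (bigD1 k) //=.
apply: mult_mul.
elim: (index_enum _) => [|l s IH]; first by rewrite !big_nil; apply: mult0.
rewrite !big_cons; case: ifP => lk //; apply: multM IH.
by rewrite -[X in mult _ _ X]muln1; apply/mult_exp/mult_coord/hx.
Qed.

(** F(x + t Z) has degree at most d in t, so it vanishes; t = 1 and Z = X - x recover F. *)
Lemma mult_gt_deg (F : {mpoly K[n]}) d x : F \is d.-homog -> mult F x d.+1 -> F = 0.
Proof.
move=> hF [G eG].
have sz : (size (gline x F) <= d.+1)%N.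
  have Qx i : (size ((x i)%:MP%:P + 'X * ('X_i : {mpoly K[n]})%:P)%R <= 2)%N.
    rewrite addrC [_ * _%:P]mulrC size_MXaddC; case: ifP => // _.
    by rewrite ltnS size_polyC_leq1.
  rewrite -(muln1 d).
  have step := @mmap_graded n K _ (polyC \o @mpolyC n K)
    (fun i => (x i)%:MP%:P + 'X * ('X_i)%:P) (fun k (p : {poly {mpoly K[n]}}) => (size p <= k.+1)%N)
    1 d F hF.
  apply: step => //.
  - by move=> k; rewrite size_poly0.
  - by move=> k a b ha hb; apply: leq_trans (size_polyD _ _) _; rewrite geq_max ha.
  - by move=> k c a ha; rewrite /= mul_polyC; apply: leq_trans (size_scale_leq _ _) _.
  - by rewrite size_poly1.
  - by move=> k l a b; apply: size_polyM_leq.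
have g0 : gline x F = 0.
  apply/eqP; apply: contraTT sz => nz; rewrite -ltnNge eG.
  have G0 : G != 0 by apply: contraNneq nz => G0; rewrite eG G0 mulr0.
  by rewrite mulrC size_mulXn // -[X in (X < _)%N]addn0 ltn_add2l size_poly_gt0.
rewrite -(comp_mpoly_id F) /comp_mpoly.
rewrite (eq_mmap (f' := @mpolyC n K) (h' := fun i => (x i)%:MP + 1 * ('X_i - (x i)%:MP))) //.
  by rewrite (gline_eval F x (@mpolyC n K) 1) g0 rmorph0 horner0.
by move=> i; rewrite tnth_mktuple mul1r subrKC.
Qed.
End MultMore.

Section Coordinates.
Variable K : fieldType.
Local Notation R d := (dhomog 4 K d).

Definition unitpt (k l : 'I_4) : K := (l == k)%:R.

Lemma mult_unitpt d (P : R d) k m :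
  mult P (unitpt k) m <-> forall a, a \in msupp P -> (a k + m <= d)%N.
Proof.
have /dhomogP hd := dhomog_is_dhomog P.
split=> [mP a aP|h]; last first.
  rewrite (mpolyE P) big_seq.
  elim/big_rec: _ => [|a Q aP mQ]; first exact: mult_zero.
  apply: mult_lin mQ; apply: multW (mult_monomial a (k := k) _).
    by have := h a aP; rewrite -(hd a aP) /=; clear; lia.
  by move=> l lk; rewrite /unitpt (negPf lk).
(* Setting X_k = 1 moves the point to the origin. Forgetting the k-th exponent is injective on
   monomials of degree d, so no terms cancel. *)
pose sub : 4.-tuple {mpoly K[4]} := [tuple if l == k then 1 else 'X_l | l < 4].
pose low (c : 'X_{1..4}) : 'X_{1..4} := [multinom if l == k then 0%N else c l | l < 4].
have subX c : 'X_[c] \mPo sub = 'X_[low c].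
  rewrite comp_mpolyX mpolyXE_id; apply: eq_bigr => l _.
  rewrite tnth_mktuple mnmE; case: eqP => // _; first by rewrite expr1n expr0.
have lowdeg c : (mdeg (low c) + c k = mdeg c)%N.
  rewrite !mdegE (bigD1 k) //= [in RHS](bigD1 k) //= mnmE eqxx add0n addnC; congr (_ + _)%N.
  by apply: eq_bigr => l /negPf lk; rewrite mnmE lk.
have lowI c : c \in msupp P -> low c = low a -> c = a.
  move=> cP e; have ck : c k = a k.
    by have := lowdeg c; have := lowdeg a; rewrite e (hd c cP) (hd a aP) /=; clear; lia.
  apply/mnmP => l; case: (eqVneq l k) => [->//|lk].
  by have /mnmP/(_ l) := e; rewrite !mnmE (negPf lk).
have mP' : mult (P \mPo sub) (fun=> 0) m.
  apply: mult_comp mP => l; rewrite tnth_mktuple /unitpt.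
  by case: eqP => _; rewrite ?meval1 ?mevalXU.
have : low a \in msupp (P \mPo sub).
  rewrite mcoeff_msupp comp_mpolyEX raddf_sum /=.
  rewrite (bigD1_seq a) //= ?msupp_uniq // big_seq_cond big1 ?addr0 => [|c /andP[cP ca]].
    by rewrite subX mcoeffZ mcoeffX eqxx mulr1 -mcoeff_msupp.
  rewrite subX mcoeffZ mcoeffX (_ : (_ == _) = false) ?mulr0 //.
  by apply/negP => /eqP/(lowI _ cP) e; rewrite e eqxx in ca.
move=> /(mult_origin mP'); have := lowdeg a; rewrite (hd a aP) /=; clear; lia.
Qed.

Variable W : 'M[K]_4.

Definition chg (V : 'M[K]_4) : 4.-tuple {mpoly K[4]} := [tuple \sum_k V k l *: 'X_k | l < 4].

Lemma chg_homog V d (F : R d) : F \mPo chg V \is d.-homog.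
Proof.
have Qx l : tnth (chg V) l \is 1.-homog.
  by rewrite tnth_mktuple; apply: rpred_sum => k _; rewrite dhomogZ // dhomogX /= mdeg1.
have step := @mmap_graded 4 K _ (@mpolyC 4 K) (tnth (chg V))
  (fun k (p : {mpoly K[4]}) => p \is k.-homog) 1 d F (dhomog_is_dhomog F).
rewrite muln1 in step; apply: step => //.
- by move=> k; apply: dhomog0.
- by move=> k a b; apply: dhomogD.
- by move=> k c a ha; rewrite mul_mpolyC dhomogZ.
- exact: dhomog1.
- by move=> k l a b; apply: dhomogM.
Qed.

Lemma chg_comp V U F : (F \mPo chg V) \mPo chg U = F \mPo chg (U *m V).
Proof.
rewrite /comp_mpoly (rmorph_mmap (mmap _ _)); apply: eq_mmap => [c|l] /=.
  by rewrite mmapC.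
rewrite !tnth_mktuple raddf_sum /=.
under eq_bigr do rewrite mmapZ mmapX mmap1U tnth_mktuple mulr_sumr.
rewrite exchange_big; apply: eq_bigr => j _ /=; rewrite mxE scaler_suml.
by apply: eq_bigr => k _; rewrite mul_mpolyC scalerA mulrC.
Qed.

Lemma chg1 F : F \mPo chg 1%:M = F.
Proof.
rewrite -[RHS]comp_mpoly_id; apply: eq_mmap => // l; rewrite !tnth_mktuple.
rewrite (bigD1 l) //= big1 ?addr0 => [|k kl]; first by rewrite mxE eqxx scale1r.
by rewrite mxE (negPf kl) scale0r.
Qed.

Hypothesis uW : W \in unitmx.

Lemma mult_chg F k m : mult F (W k) m <-> mult (F \mPo chg W) (unitpt k) m.
Proof.
split=> h.
  apply: mult_comp h => l; rewrite tnth_mktuple raddf_sum (bigD1 k) //=.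
  rewrite mevalZ mevalXU /unitpt eqxx mulr1 big1 ?addr0 // => j jk.
  by rewrite mevalZ mevalXU (negPf jk) mulr0.
rewrite -[F]chg1 -(mulVmx uW) -chg_comp; apply: mult_comp h => l.
rewrite tnth_mktuple raddf_sum /unitpt.
have := congr1 (fun B : 'M[K]_4 => B k l) (mulmxV uW); rewrite !mxE eq_sym => <-.
by apply: eq_bigr => j _; rewrite /= mevalZ mevalXU mulrC.
Qed.

Section System.
Variables (d : nat) (n : 'I_4 -> nat).

Lemma xs4_lin : (fun F : R d => forall k, mult F (W k) (n k)) 0 /\
  forall a (F G : R d), (forall k, mult F (W k) (n k)) -> (forall k, mult G (W k) (n k)) ->
    forall k, mult (a *: F + G : R d) (W k) (n k).
Proof.
by split=> [k|a F G hF hG k]; [apply: mult_zero | apply: mult_lin].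
Qed.

Definition xs4 : {vspace R d} := pred_space xs4_lin.

Lemma mem_xs4 (F : R d) : F \in xs4 <-> forall k, mult F (W k) (n k).
Proof. exact: mem_pred_space. Qed.

Lemma dim_xs4 : \dim xs4 = #|monset d (fun a => [forall k, a k + n k <= d])%N|.
Proof.
rewrite -(dim_supp_space K).
pose g0 (F : R d) : R d := DHomog (chg_homog W F).
have g_lin : linear g0.
  by move=> a F G; apply: val_inj; rewrite /= comp_mpolyD comp_mpolyZ.
pose g : {linear R d -> R d} := HB.pack g0 (GRing.isLinear.Build _ _ _ _ g0 g_lin).
have ginj : injective g.
  move=> F G /(congr1 val) /= /(congr1 (comp_mpoly (chg (invmx W)))).
  by rewrite !chg_comp mulVmx // !chg1 => e; apply: val_inj.
rewrite -(dim_limg_inj ginj); congr (\dim _); apply/vspaceP => F.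
apply/memv_imgP/idP => [[G /mem_xs4 hG ->]|/mem_supp_space hF].
  rewrite lfunE; apply/mem_supp_space => a aG; apply/forallP => k.
  by move/mult_chg/(@mult_unitpt d (g G)): (hG k); apply.
exists (DHomog (chg_homog (invmx W) F)).
  apply/mem_xs4 => k; apply/mult_chg; rewrite /= chg_comp mulmxV // chg1.
  by apply/mult_unitpt => a /hF/forallP.
by rewrite lfunE; apply: val_inj; rewrite /= chg_comp mulmxV // chg1.
Qed.
End System.
End Coordinates.

(** * Forms vanishing at points of the quadric *)

Section PointSystem.
Variables (K : fieldType) (r : nat).
Implicit Types (x : 'I_r -> 'I_4 -> K) (m : 'I_r -> nat).
Local Notation R d := (dhomog 4 K d).

Lemma xsys_lin x d m : (fun F : R d => forall i, mult F (x i) (m i)) 0 /\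
  forall a (F G : R d), (forall i, mult F (x i) (m i)) -> (forall i, mult G (x i) (m i)) ->
    forall i, mult (a *: F + G : R d) (x i) (m i).
Proof.
by split=> [i|a F G hF hG i]; [apply: mult_zero | apply: mult_lin].
Qed.

Definition xsys x d m : {vspace R d} := pred_space (xsys_lin x d m).

Lemma mem_xsys x d m (F : R d) : F \in xsys x d m <-> forall i, mult F (x i) (m i).
Proof. exact: mem_pred_space. Qed.

Lemma eq_mult n (F : {mpoly K[n]}) y z k : y =1 z -> mult F y k -> mult F z k.
Proof.
move=> e [G eG]; exists G; rewrite -eG; apply: eq_mmap => [c|i]; first exact: erefl.
rewrite e; exact: erefl.
Qed.

Lemma toric_xs4 (W : 'M[K]_4) (n : 'I_4 -> nat) d : W \in unitmx ->
  (forall k, n k <= d.+1)%N ->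
  (forall k l j, uniq [:: k; l; j] -> n k + n l + n j <= 2 * d + 2)%N ->
  (\dim (xs4 W d n) + ('C(n 0%R + 2, 3) + 'C(n 1%R + 2, 3) + 'C(n 2%R + 2, 3) + 'C(n 3%R + 2, 3)) =
  'C(d + 3, 3) + ('C(n 0%R + n 1%R - d + 1, 3) + 'C(n 0%R + n 2%R - d + 1, 3) +
    'C(n 0%R + n 3%R - d + 1, 3) + 'C(n 1%R + n 2%R - d + 1, 3) +
    'C(n 1%R + n 3%R - d + 1, 3) + 'C(n 2%R + n 3%R - d + 1, 3)))%N.
Proof. by move=> uW h1 h3; rewrite dim_xs4 //; apply: card_good. Qed.

Variable x : 'I_r -> 'I_4 -> K.

Lemma xsys_toric (W : 'M[K]_4) d n : W \in unitmx ->
  (forall (k : 'I_4) (i : 'I_r), k = i :> nat -> W k =1 x i) ->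
  multseq r n -> n 4 = 0%N -> std d n -> (n 0 <= d.+1)%N ->
  (\dim (xsys x d (fun i => n i)) +
    ('C(n 0 + 2, 3) + 'C(n 1 + 2, 3) + 'C(n 2 + 2, 3) + 'C(n 3 + 2, 3)) =
  'C(d + 3, 3) + ('C(n 0 + n 1 - d + 1, 3) + 'C(n 0 + n 2 - d + 1, 3) +
    'C(n 0 + n 3 - d + 1, 3) + 'C(n 1 + n 2 - d + 1, 3) +
    'C(n 1 + n 3 - d + 1, 3) + 'C(n 2 + n 3 - d + 1, 3)))%N.
Proof.
move=> uW eW hn n4 hs n0.
have -> : xsys x d (fun i => n i) = xs4 W d (fun k : 'I_4 => n k).
  apply/vspaceP => F; apply/idP/idP => [/mem_xsys hF|/mem_xs4 hF].
    apply/mem_xs4 => k; have [kr|rk] := ltnP k r; last by rewrite (proj2 hn _ rk); apply: mult0.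
    by apply: eq_mult (hF (Ordinal kr)) => l; rewrite (eW k (Ordinal kr)).
  apply/mem_xsys => i; have [i4|i4] := ltnP i 4.
    by apply: eq_mult (hF (Ordinal i4)) => l; rewrite (eW (Ordinal i4) i).
  by have := multseq_le hn i4; rewrite n4 leqn0 => /eqP ->; apply: mult0.
apply: (toric_xs4 (n := fun k : 'I_4 => n k)) => // [k|k l j u].
  by apply: leq_trans (multseq_le hn (leq0n k)) n0.
apply: leq_trans (leq_addr _ _); apply: leq_trans hs.
have -> : (n 0 + n 1 + n 2 + n 3 = \sum_(i < 4) n i)%N.
  by rewrite !big_ord_recl big_ord0 /= !addnA addn0.
move: u; rewrite /= !inE negb_or andbT => /andP[/andP[kl kj] lj].
rewrite (bigD1 k) //= -addnA leq_add2l (bigD1 l) 1?eq_sym //= leq_add2l.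
by rewrite (bigD1 j) ?leq_addr // [j == k]eq_sym [j == l]eq_sym kj.
Qed.

Lemma xsys_large d n : multseq r n -> n 0 = d.+1 -> \dim (xsys x d (fun i => n i)) = 0%N.
Proof.
move=> hn n0; have r0 : (0 < r)%N.
  by rewrite lt0n; apply: contra_eqN n0 => /eqP r0; rewrite (proj2 hn) ?r0.
apply/eqP; rewrite dimv_eq0; apply/eqP/vspaceP => F; rewrite memv0; apply/idP/eqP => [/mem_xsys h|->].
  apply: val_inj; apply: (mult_gt_deg (x := x (Ordinal r0)) (dhomog_is_dhomog F)).
  by have := h (Ordinal r0); rewrite /= n0.
exact: mem0v.
Qed.

Lemma xsys_ext d n n' : (forall i, (i < r)%N -> n i = n' i) ->
  \dim (xsys x d (fun i => n i)) = \dim (xsys x d (fun i => n' i)).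
Proof.
move=> e; congr (\dim _); apply/vspaceP => F; apply/idP/idP => /mem_xsys h; apply/mem_xsys => i.
  by rewrite -e.
by rewrite e.
Qed.

(* V_S + V_i is contained in V_0 + V_i, so that adding the i-th point to the
   previous ones costs at most as much as adding it to the 0-th one alone. *)
Lemma xsys_add (i0 i : 'I_r) (W : 'M[K]_4) d n : i0 = 0%N :> nat -> W \in unitmx ->
  W 0 =1 x i0 -> W 1 =1 x i -> multseq r n -> (0 < i)%N -> (n 0 <= d.+1)%N ->
  (\dim (xsys x d (fun j => trunc i n j)) + 'C(n 0 + n i - d + 1, 3) <=
   \dim (xsys x d (fun j => trunc i.+1 n j)) + 'C(n i + 2, 3))%N.
Proof.
move=> e0 uW W0 W1 hn ipos n0.
(* Rows 0 and 1 of [W] are the two points; the other rows only complete a basis and carry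
   multiplicity 0. *)
pose nn (a b : nat) (k : 'I_4) := if k == 0 then a else if k == 1 then b else 0%N.
have ni : (n i <= d.+1)%N by apply: leq_trans (multseq_le hn (leq0n i)) n0.
have dimT a b : (a <= d.+1)%N -> (b <= d.+1)%N ->
    (\dim (xs4 W d (nn a b)) + ('C(a + 2, 3) + 'C(b + 2, 3)) = 'C(d + 3, 3) + 'C(a + b - d + 1, 3))%N.
  move=> ha hb; have := @toric_xs4 W (nn a b) d uW.
  have small c : (c <= d.+1)%N -> 'C(c - d + 1, 3) = 0%N.
    by move=> hc; rewrite bin_small //; move: hc; clear; lia.
  rewrite /nn /= !addn0 ?(small _ ha) ?(small _ hb) !addn0; apply.
    by elim/ord4_ind.
  move=> k l j; elim/ord4_ind: k; elim/ord4_ind: l; elim/ord4_ind: j => //= _;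
    move: ha hb; clear; lia.
set S := xsys x d (fun j => trunc i n j).
have memW a b (F : R d) : F \in xs4 W d (nn a b) <-> mult F (x i0) a /\ mult F (x i) b.
  split=> [/mem_xs4 h|[h0 h1]].
    by split; [apply: eq_mult (h 0) | apply: eq_mult (h 1)].
  apply/mem_xs4; elim/ord4_ind; rewrite /nn /=; try exact: mult0.
    by apply: eq_mult h0 => l; rewrite W0.
  by apply: eq_mult h1 => l; rewrite W1.
have cap1 : (S :&: xs4 W d (nn 0%N (n i)))%VS = xsys x d (fun j => trunc i.+1 n j).
  apply/vspaceP => F; rewrite memv_cap; apply/andP/idP.
    move=> [/mem_xsys hS /memW[_ hi]]; apply/mem_xsys => j.
    have := hS j; rewrite /trunc ltnS; by case: ltngtP => // /val_inj ->.
  move=> /mem_xsys h; split; last first.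
    by apply/memW; split; [exact: mult0 | have := h i; rewrite /trunc ltnSn].
  apply/mem_xsys => j; have := h j; rewrite /trunc ltnS.
  by case: ltnP => [/ltnW ->|] // *; apply: mult0.
have cap2 : (xs4 W d (nn (n 0%N) 0%N) :&: xs4 W d (nn 0%N (n i)))%VS = xs4 W d (nn (n 0%N) (n i)).
  apply/vspaceP => F; rewrite memv_cap; apply/andP/idP.
    by move=> [/memW[h0 _] /memW[_ h1]]; apply/memW.
  by move=> /memW[h0 h1]; split; apply/memW; split=> //; apply: mult0.
have sub : (S + xs4 W d (nn 0%N (n i)) <= xs4 W d (nn (n 0%N) 0%N) + xs4 W d (nn 0%N (n i)))%VS.
  apply: addvS => //; apply/subvP => F /mem_xsys hS; apply/memW; split; last exact: mult0.
  by have := hS i0; rewrite /trunc e0 ipos.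
have := dimvS sub.
have := dimv_sum_cap S (xs4 W d (nn 0%N (n i))).
have := dimv_sum_cap (xs4 W d (nn (n 0%N) 0%N)) (xs4 W d (nn 0%N (n i))).
rewrite cap1 cap2.
have := dimT (n 0%N) 0%N n0 isT; have := dimT (n 0%N) (n i) n0 ni.
have -> : ('C(n 0 + 0 - d + 1, 3) = 0)%N by rewrite bin_small //; move: n0; clear; lia.
have -> : ('C(0 + 2, 3) = 0)%N by [].
have := dimT 0%N (n i) isT ni.
have -> : ('C(0 + n i - d + 1, 3) = 0)%N by rewrite bin_small //; move: ni; clear; lia.
have -> : ('C(0 + 2, 3) = 0)%N by [].
clear; move: (\dim _) (\dim _) (\dim _) (\dim _) (\dim _) (\dim _) (\dim _).
by move: 'C(_, _)%N 'C(_, _)%N 'C(_, _)%N 'C(_, _)%N; lia.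
Qed.
End PointSystem.

Lemma big_ord4 (V : nmodType) (F : 'I_4 -> V) : \sum_k F k = F 0 + F 1 + F 2 + F 3.
Proof.
rewrite !big_ord_recl big_ord0 addr0 !addrA.
by do !congr (_ + _); congr (F _); apply: val_inj.
Qed.

Section QuadricSection.
Variables (K : fieldType) (M : 'M[K]_4).
Hypothesis uM : M \in unitmx.
Hypothesis two0 : (2 : K) != 0.
Local Notation R d := (dhomog 4 K d).
Local Notation pb := (comp_mpoly (qparam M)).
Variables (c1 c2 c3 : {poly K}).
Hypotheses (sc1 : (size c1 <= 3)%N) (sc2 : (size c2 <= 3)%N) (sc3 : (size c3 <= 3)%N).
Hypothesis c_span : forall j, (j < 3)%N -> exists a : K * K * K,
  a.1.1 *: c1 + a.1.2 *: c2 + a.2 *: c3 = 'X^j.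
Hypothesis f_nsq : forall h : {poly K}, c1 ^+ 2 - 4 * c2 * c3 <> h ^+ 2.
Variables (r : nat) (s u v y : 'I_r -> K).
Hypotheses (s_inj : injective s) (u_inj : injective u) (v_inj : injective v)
  (y_neq0 : forall i, y i != 0)
  (y_sqr : forall i, y i ^+ 2 = (c1 ^+ 2 - 4 * c2 * c3).[s i])
  (c3_neq0 : forall i, c3.[s i] != 0)
  (u_def : forall i, 2 * u i * c3.[s i] = c1.[s i] + y i)
  (v_def : forall i, 2 * v i * c3.[s i] = c1.[s i] - y i).
Variables q g : {mpoly K[4]}.
Let pt i := pt2 (u i) (v i).
Let x i := lincomb M idfun (segreA (u i) (v i)).
Hypotheses (g_homog : g \is 2.-homog)
  (g_ell : mmap (polyC \o polyC) (lincomb M (polyC \o polyC) (ellsig c1 c2 c3 polyC 'X)) g = 0)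
  (g_mult : forall i, ~ mult (pb g) (pt2 (u i) (v i)) 2).
Hypotheses (q_homog : q \is 2.-homog) (q_neq0 : q != 0) (q_pb : pb q = 0)
  (q_mult : forall i, ~ mult q (x i) 2).

Lemma eq_qsys d m m' : m =1 m' -> qsys M pt d m = qsys M pt d m'.
Proof.
move=> e; apply/vspaceP => F; apply/idP/idP => /mem_qsys h; apply/mem_qsys => i.
  by rewrite -e.
by rewrite e.
Qed.

Lemma dim_qsys0 m : (\dim (qsys M pt 0 m) <= 1)%N.
Proof. by apply: leq_trans (dimvS (subvf _)) _; rewrite dim_forms. Qed.

Lemma dim_qsys0_eq0 m i : (0 < m i)%N -> \dim (qsys M pt 0 m) = 0%N.
Proof.
move=> mi; have := dim_kerpb uM 0; rewrite exp1n addn1 => -[k0].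
suff sub : (qsys M pt 0 m <= kerpb M 0)%VS.
  by apply/eqP; have := dimvS sub; rewrite k0 leqn0.
apply/subvP => F /mem_qsys hF.
apply/mem_kerpb; apply: (mult_gt_deg (d := 0) (x := pt i)).
  apply/dhomogP => a aF /=; rewrite mdegE big1 // => k _.
  by have := pb_bideg aF k; rewrite leqn0 => /eqP.
exact: multW mi (hF i).
Qed.

(** The multiples of q are contained in the kernel and, by [bin3_sq], have the same dimension. *)
Lemma mem_kerpb_quadric d (F : R (2 + d)) : pb F = 0 -> exists B : R d, F = q * B :> {mpoly K[4]}.
Proof.
pose mu : {linear R d -> R (2 + d)} := @hmul K 2 q q_homog d.
have sub : (linfun mu @: fullv <= kerpb M (2 + d))%VS.
  apply/subvP => _ /memv_imgP[B _ ->]; rewrite lfunE; apply/mem_kerpb.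
  by rewrite /= rmorphM /= q_pb mul0r.
have e : (linfun mu @: fullv)%VS = kerpb M (2 + d).
  apply/eqP; rewrite eqEdim sub /= (@dim_limg_inj _ _ _ mu (hmul_inj q_neq0)) dim_forms.
  have h : ('C(2 + d + 3, 3) = 'C(d + 3, 3) + (2 + d).+1 ^ 2)%N := bin3_sq d.
  by have := dim_kerpb uM (2 + d); rewrite h; move: (\dim _) 'C(_, _)%N (_ ^ _)%N; clear; lia.
move=> /mem_kerpb; rewrite -e => /memv_imgP[B _ ->]; exists B.
by rewrite lfunE.
Qed.

(** The part of the system vanishing on Q is divided by q, which has order at most 1 at each point;
    the rest embeds into the system induced on Q. *)
Lemma xsys_quadric_step d m :
  (\dim (xsys x d.+2 m) + \dim (kerpb M d.+2) <=
   \dim (xsys x d (fun i => (m i).-1)) + \dim (qsys M pt d.+2 m))%N.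
Proof.
have sub : (xsys x d.+2 m + kerpb M d.+2 <= qsys M pt d.+2 m)%VS.
  rewrite subv_add kerpb_qsys andbT; apply/subvP => F /mem_xsys hF; apply/mem_qsys => i.
  apply: mult_comp (hF i) => l; rewrite tnth_mktuple raddf_sum; apply: eq_bigr => k _ /=.
  rewrite mevalZ; congr (_ * _); rewrite /segre /segreA.
  by do !case: ifP => _; rewrite ?meval1 ?mevalM ?mevalXU.
have cap : (\dim (xsys x d.+2 m :&: kerpb M d.+2) + 0 <= 0 + \dim (xsys x d (fun i => (m i).-1)))%N.
  have := @dim_extension _ _ _ (@hmul K 2 q q_homog d) (hmul_inj q_neq0)
    (xsys x d.+2 m :&: kerpb M d.+2)%VS 0%VS (xsys x d (fun i => (m i).-1)) 0%VS.
  rewrite !dimv0; apply.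
  - move=> F; rewrite memv_cap => /andP[/mem_xsys hF /mem_kerpb /mem_kerpb_quadric[B eB]].
    exists B; last by rewrite memv0; apply/eqP/val_inj; rewrite /= eB subrr.
    apply/mem_xsys => i; rewrite -subn1; apply: (mult_div (@q_mult i)).
    by rewrite -eB; apply: hF.
  - exact: sub0v.
  by move=> B; rewrite !memv0 => /eqP ->; rewrite linear0.
have := dimv_sum_cap (xsys x d.+2 m) (kerpb M d.+2); have := dimvS sub; move: cap.
by move: (\dim _) (\dim _) (\dim _) (\dim _) (\dim _) (\dim _); clear; lia.
Qed.

Lemma xsys_quadric d n : multseq r n -> (0 < n 4)%N -> std d.+2 n -> (n 0 <= d.+2)%N ->
  (msum r n < 4 * d.+2)%N ->
  (\dim (xsys x d.+2 (fun i => n i)) + \sum_(i < r) 'C(n i + 1, 2) <=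
   \dim (xsys x d (fun i => (n i).-1)) + d.+3 ^ 2)%N.
Proof.
move=> hn n4 hs n0 lt.
have r4 : (4 < r)%N by rewrite ltnNge; apply/negP => /(proj2 hn) e; rewrite e in n4.
have r2 : (2 < r)%N by apply: leq_trans r4.
have r1 : (1 < r)%N by apply: leq_trans r4.
have r0 : (0 < r)%N by apply: leq_trans r4.
have := @quadric_bound r (fun d n => \dim (qsys M pt d (fun i => n i))) (fun d => \dim (kerpb M d)).
move=> /(_ (fun n => dim_qsys0 _)).
move=> /(_ (fun n => @dim_qsys0_eq0 (fun i => n i) (Ordinal r0))) hb.
suff : (\dim (qsys M pt d.+2 (fun i => n i)) + \sum_(i < r) 'C(n i + 1, 2) <=
    \dim (kerpb M d.+2) + d.+3 ^ 2)%N.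
  have := xsys_quadric_step d (fun i => n i).
  by move: (\dim _) (\dim _) (\dim _) (\dim _) (\sum_(i < r) _)%N (d.+3 ^ 2)%N; clear; lia.
apply: hb => //.
- move=> e k hk; apply: (@conic_step _ _ uM r u v (Ordinal r0) (Ordinal r1) (Ordinal r2)).
  + by rewrite /= !inE !(inj_eq u_inj).
  + by rewrite /= !inE !(inj_eq v_inj).
  move=> i; rewrite !inE !negb_or -!val_eqE /= => /and3P[i0 i1 i2]; apply: hk.
  by move: i0 i1 i2; case: (val i) => [|[|[|]]].
- move=> e k hk; exact: (@elliptic_step _ _ uM two0 _ _ _ sc1 sc2 sc3 c_span f_nsq r s u v y
    (Ordinal r0) s_inj y_neq0 y_sqr c3_neq0 u_def v_def g g_homog g_ell g_mult).
move=> e k ke; have := @tangent_step _ _ uM r u v (Ordinal r0) e (fun i => k i) _ ke.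
rewrite (@eq_qsys e _ (fun i => if i == 0%N :> nat then e else k i)) // => h.
by apply: h => i i0; rewrite (inj_eq u_inj) (inj_eq v_inj).
Qed.

Variable W : 'M[K]_4.
Hypotheses (uW : W \in unitmx)
  (W_row : forall (k : 'I_4) (i : 'I_r), k = i :> nat -> W k =1 x i).

(** In Segre coordinates the rows (1, u, v, uv) of the two points are completed by the last two unit
    vectors; the determinant is u j - u i. *)
Lemma pair_unit (i j : 'I_r) : i != j ->
  exists2 V : 'M[K]_4, V \in unitmx & V 0 =1 x i /\ V 1 =1 x j.
Proof.
move=> ij; have uij : u j - u i != 0 by rewrite subr_eq0 (inj_eq u_inj) eq_sym.
pose S : 'M[K]_4 := \matrix_(k, l)
  (if val k == 0%N then segreA (u i) (v i) l
   else if val k == 1%N then segreA (u j) (v j) l else (l == k)%:R).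
exists (S *m M); last first.
  by split=> l; rewrite mxE; apply: eq_bigr => k _; rewrite mxE mulrC.
rewrite unitmx_mul uM andbT -row_free_unit -kermx_eq0; apply/eqP/row_matrixP => k.
have := mulmx_ker S => /(congr1 (row k)); rewrite row_mul row0.
move: (row k _) => a ea.
have ec l := congr1 (fun b : 'rV[K]_4 => b 0 l) ea.
have := ec 3; have := ec 2; have := ec 1; have := ec 0.
rewrite !mxE !big_ord4 !mxE /= /segreA /= !(mulr0, mulr1, addr0).
move=> e0 e1 e2 e3.
have z1 : a 0 1 = 0.
  apply/eqP; rewrite -(mulIr_eq0 _ (mulIf uij)); apply/eqP.
  by rewrite -[RHS](subrr 0) -{1}e1 -(mulr0 (u i)) -e0; ring.
have z0 : a 0 0 = 0 by move: e0; rewrite z1 addr0.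
have z2 : a 0 2 = 0 by move: e2; rewrite z0 z1 !mul0r !add0r.
have z3 : a 0 3 = 0 by move: e3; rewrite z0 z1 !mul0r !add0r.
by apply/rowP; elim/ord4_ind; rewrite mxE.
Qed.

Theorem dim_xsys d n : multseq r n -> std d n -> (n 0 <= d.+1)%N -> (msum r n < 4 * d)%N ->
  (\dim (xsys x d (fun i => n i)) + \sum_(i < r) 'C(n i + 2, 3) =
   'C(d + 3, 3) + \sum_(i < r) 'C(excess n d i + 1, 3))%N.
Proof.
move=> hn hs n0 lt; apply/eqP; rewrite eqn_leq.
pose X d n := \dim (xsys x d (fun i => n i)).
have tor := xsys_toric uW W_row.
rewrite (@space_upper r X tor (@xsys_large _ _ x) xsys_quadric) //; last by right.
rewrite (@space_lower r X tor (@xsys_ext _ _ x)) // => e k t hk t3 tr k0.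
have r0 : (0 < r)%N by apply: leq_trans tr.
have [|V uV [V0 V1]] := @pair_unit (Ordinal r0) (Ordinal tr).
  by rewrite -val_eqE /= eq_sym -lt0n (leq_trans _ t3).
apply: (@xsys_add _ _ x (Ordinal r0) (Ordinal tr) V) => //=.
by apply: leq_trans t3.
Qed.
End QuadricSection.

(** * Simultaneous normal form of the quadric and the curve *)

Section Congruence.
Variable K : closedFieldType.
Hypothesis two0 : (2 : K) != 0.

Lemma closed_sqrt (a : K) : exists b, b ^+ 2 = a.
Proof.
have [b eb] := @solve_monicpoly K 2 (fun i => if i == 0%N then a else 0) isT.
by exists b; rewrite eb !big_ord_recl big_ord0 /= mul0r mulr1 !addr0.
Qed.

Lemma complete_row n (v : 'rV[K]_(1 + n)) : v != 0 ->
  exists2 U : 'M[K]_(1 + n), U \in unitmx & usubmx U = v.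
Proof.
move=> v0; pose a := col_ebase v 0 0.
have ua : a != 0.
  have := col_ebase_unit v; rewrite [col_ebase v]mx11_scalar -/a unitmxE det_scalar1.
  by rewrite unitfE.
exists (a *: row_ebase v); first by rewrite unitmxZ ?unitfE // row_ebase_unit.
have rk : \rank v = 1%N by rewrite rank_rV v0.
have := mulmx_ebase v; rewrite rk [col_ebase v]mx11_scalar -/a => {2}<-.
rewrite -[in RHS](vsubmxK (row_ebase v)) mul_scalar_mx -scalemxAl.
rewrite [pid_mx 1](_ : _ = row_mx 1%:M 0) ?mul_row_col ?mul1mx ?mul0mx ?addr0 ?linearZ //.
apply/matrixP => i j; rewrite !mxE ord1; case: splitP => k ek; rewrite !mxE ek.
  by rewrite andbT.
by rewrite add1n.
Qed.

(** One Gram-Schmidt step: [v] is completed to a basis and its projections are subtracted from the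
    other basis vectors. *)
Lemma split_form n (A : 'M[K]_(1 + n)) (v : 'rV[K]_(1 + n)) : A^T = A ->
  v *m A *m v^T = 1%:M ->
  exists U : 'M[K]_(1 + n), [/\ U \in unitmx, usubmx U = v &
    exists2 D, D^T = D & U *m A *m U^T = block_mx 1%:M 0 0 D].
Proof.
move=> sA vA; have v0 : v != 0.
  apply: contra_eq_neq vA => ->; rewrite !mul0mx.
  by apply/eqP => /matrixP/(_ 0 0); rewrite !mxE eqxx => /eqP; rewrite eq_sym oner_eq0.
have [U uU eU] := complete_row v0.
pose B := dsubmx U; pose b := v *m A *m B^T.
pose E : 'M[K]_(1 + n) := block_mx 1%:M 0 (- b^T) 1%:M.
have sym (x y : nat) (X : 'M[K]_(x, 1 + n)) (Y : 'M[K]_(y, 1 + n)) :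
    (X *m A *m Y^T)^T = Y *m A *m X^T by rewrite !trmx_mul trmxK sA mulmxA.
exists (E *m U); split.
- by rewrite unitmx_mul uU andbT unitmxE det_lblock !det1 mulr1 unitr1.
- by rewrite -(vsubmxK U) eU mul_block_col mul1mx mul0mx addr0 col_mxKu.
exists (B *m A *m B^T - b^T *m b).
  by rewrite linearB /= sym trmx_mul trmxK.
have -> : E *m U *m A *m (E *m U)^T = E *m (U *m A *m U^T) *m E^T.
  by rewrite trmx_mul !mulmxA.
have -> : U *m A *m U^T = block_mx 1%:M b b^T (B *m A *m B^T).
  rewrite -{1 2}(vsubmxK U) eU mul_col_mx tr_col_mx mul_col_row -/B vA.
  by rewrite -/b [b^T]sym.
rewrite /E tr_block_mx !trmx1 trmx0 linearN /= trmxK !mulmx_block.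
rewrite !(mul1mx, mulmx1, mul0mx, mulmx0, addr0, add0r) ?mulmxN ?mulNmx.
by rewrite !addNr mul0mx oppr0 add0r addrC.
Qed.

(** Polarisation: if the relevant diagonal entries vanish, the sum of two unit vectors has value 2 A
    i j. A square root then normalises the value to 1. *)
Lemma nonisotropic n (A : 'M[K]_n.+1) : A^T = A -> A != 0 ->
  exists v : 'rV[K]_n.+1, v *m A *m v^T = 1%:M.
Proof.
move=> sA A0.
have [v vn0] : exists v : 'rV[K]_n.+1, (v *m A *m v^T) 0 0 != 0.
  have bil (i j : 'I_n.+1)  : ((delta_mx 0 i : 'rV[K]_n.+1) *m A *m (delta_mx 0 j : 'rV[K]_n.+1)^T) 0 0 = A i j.
    by rewrite trmx_delta -rowE -colE !mxE.
  have [i [j Aij]] : exists i j, A i j != 0.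
    have [/existsP[i /existsP[j Aij]]|/existsPn h] := boolP [exists i, exists j, A i j != 0].
      by exists i, j.
    case/eqP: A0; apply/matrixP => i j; rewrite mxE; apply/eqP.
    by have /existsPn/(_ j) := h i; rewrite negbK.
  have [ii|] := eqVneq (A i i) 0; last by exists (delta_mx 0 i); rewrite bil.
  have [jj|] := eqVneq (A j j) 0; last by exists (delta_mx 0 j); rewrite bil.
  exists (delta_mx 0 i + delta_mx 0 j).
  rewrite linearD /= !mulmxDl !mulmxDr mxE [X in X + _]mxE [X in _ + X]mxE !bil.
  have -> : A j i = A i j by rewrite -{1}sA mxE.
  by rewrite ii jj add0r addr0 -mulr2n -mulr_natl mulf_neq0.
have [c ec] := closed_sqrt ((v *m A *m v^T) 0 0)^-1.
exists (c *: v); rewrite linearZ /= -!scalemxAl -scalemxAr scalerA -expr2 ec.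
by move: (v *m A *m v^T) vn0 => X X0; rewrite {2}[X]mx11_scalar scale_scalar_mx mulVf.
Qed.

Lemma unitmx_congr n (U A : 'M[K]_n) : U \in unitmx -> (U *m A *m U^T \in unitmx) = (A \in unitmx).
Proof. by move=> uU; rewrite !unitmx_mul uU unitmx_tr uU andbT. Qed.

Lemma unitmx_diag n m (A : 'M[K]_n) (B : 'M[K]_m) :
  (block_mx A 0 0 B \in unitmx) = (A \in unitmx) && (B \in unitmx).
Proof. by rewrite !unitmxE det_lblock unitrM. Qed.

Lemma sym_diag n (A : 'M[K]_n) : A^T = A -> A \in unitmx ->
  exists2 P, P \in unitmx & P *m A *m P^T = 1%:M.
Proof.
elim: n A => [|n IH] A sA uA; first by exists 1%:M; rewrite ?unitmx1 // [LHS]flatmx0 [RHS]flatmx0.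
have [|v ev] := nonisotropic sA.
  by apply: contraTneq uA => ->; rewrite unitmxE det0 unitr0.
have [U [uU _ [D sD eD]]] := @split_form n A v sA ev.
have : U *m A *m U^T \in unitmx by rewrite unitmx_congr.
rewrite eD unitmx_diag => /andP[_ uD].
have [P uP eP] := IH D sD uD.
pose E : 'M[K]_(1 + n) := block_mx 1%:M 0 0 P.
have uE : E \in unitmx by rewrite unitmx_diag unitmx1.
exists (E *m U); first by rewrite unitmx_mul uE.
have -> : E *m U *m A *m (E *m U)^T = E *m (U *m A *m U^T) *m E^T.
  by rewrite trmx_mul !mulmxA.
rewrite eD /E tr_block_mx !trmx0 trmx1 !mulmx_block.
rewrite !(mul1mx, mulmx1, mul0mx, mulmx0, addr0, add0r) eP.
by rewrite -(@scalar_mx_block _ 1 n 1).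
Qed.

Lemma sym_congr n (A B : 'M[K]_n) : A^T = A -> A \in unitmx -> B^T = B -> B \in unitmx ->
  exists2 P, P \in unitmx & P *m A *m P^T = B.
Proof.
move=> sA uA sB uB; have [P uP eP] := sym_diag sA uA; have [R uR eR] := sym_diag sB uB.
exists (invmx R *m P); first by rewrite unitmx_mul unitmx_inv uR.
have -> : invmx R *m P *m A *m (invmx R *m P)^T = invmx R *m (P *m A *m P^T) *m (invmx R)^T.
  by rewrite trmx_mul !mulmxA.
by rewrite eP -eR !mulmxA mulVmx // mul1mx -mulmxA -trmx_mul mulVmx // trmx1 mulmx1.
Qed.
End Congruence.

Section NormalForm.
Variable K : closedFieldType.
Hypothesis two0 : (2 : K) != 0.

Lemma congrC n m (U A : 'M[K]_n) (V : 'M[K]_(m, n)) :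
  V *m U *m A *m (V *m U)^T = V *m (U *m A *m U^T) *m V^T.
Proof. by rewrite trmx_mul !mulmxA. Qed.

Lemma mulmx_congr n m (U A : 'M[K]_n) (V : 'M[K]_(m, n)) :
  V *m U *m A *m U^T = V *m (U *m A *m U^T).
Proof. by rewrite !mulmxA. Qed.

(** An eigenvector of G Q^(-1), that is, a vertex of the singular member G - lam Q of the pencil. *)
Lemma generalized_eigenvector n (Q G : 'M[K]_n.+1) : Q \in unitmx ->
  exists lam (v : 'rV[K]_n.+1), v != 0 /\ v *m (G - lam *: Q) = 0.
Proof.
move=> uQ; pose p := char_poly (G *m invmx Q).
have [lam] : exists lam, root p lam.
  by apply/closed_rootP; rewrite size_char_poly.
rewrite -eigenvalue_root_char => /eigenvalueP[v ev v0].
exists lam, v; split=> //.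
have := congr1 (fun X => X *m Q) ev; rewrite mulmxA mulmxKV // => e.
by rewrite mulmxBr e -scalemxAr scalemxAl subrr.
Qed.

Lemma normalize_scalar (X : 'M[K]_1) : X != 0 -> exists c, c ^+ 2 *: X = 1%:M.
Proof.
move=> X0; have [c ec] := closed_sqrt (X 0 0)^-1.
exists c; rewrite ec {2}[X]mx11_scalar scale_scalar_mx mulVf //.
by apply: contra_neq X0 => e; rewrite [X]mx11_scalar e raddf0.
Qed.

Variables Q G : 'M[K]_(1 + 3).
Hypotheses (sQ : Q^T = Q) (sG : G^T = G).
Hypothesis smoothQ : forall x : 'rV[K]_(1 + 3), x != 0 -> x *m Q *m x^T = 0 -> x *m Q != 0.
Hypothesis smoothB : forall x : 'rV[K]_(1 + 3), x != 0 -> x *m Q *m x^T = 0 ->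
  x *m G *m x^T = 0 -> forall a b, a *: (x *m Q) + b *: (x *m G) = 0 -> a = 0 /\ b = 0.

Lemma quadric_unit : Q \in unitmx.
Proof.
rewrite -row_free_unit -kermx_eq0; apply/eqP/row_matrixP => k.
have := mulmx_ker Q => /(congr1 (row k)); rewrite row_mul !row0 => e.
apply/eqP; apply: contraTT isT => nz.
by have := smoothQ nz; rewrite e mul0mx eqxx => /(_ erefl).
Qed.

(** If the vertex lay on Q it would lie on B, where the two gradients would be proportional. *)
Lemma no_isotropic_eigenvector lam (x : 'rV[K]_(1 + 3)) : x != 0 ->
  x *m (G - lam *: Q) = 0 -> x *m Q *m x^T != 0.
Proof.
move=> x0; rewrite mulmxBr -scalemxAr => e; apply/eqP => iso.
have eG : x *m G = lam *: (x *m Q) by apply/eqP; rewrite -subr_eq0 e.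
have gx : x *m G *m x^T = 0 by rewrite eG -scalemxAl iso scaler0.
have [] := smoothB x0 iso gx (a := lam) (b := -1).
  by rewrite eG scaleN1r subrr.
by move=> _ /eqP; rewrite oppr_eq0 oner_eq0.
Qed.

Variables Dz Dw : 'M[K]_3.
Hypotheses (sDz : Dz^T = Dz) (uDz : Dz \in unitmx) (sDw : Dw^T = Dw) (uDw : Dw \in unitmx).

(** The vertex splits off orthogonally: Q becomes x^2 + Q3, and the singular member becomes a cone
    over the conic G3. The ternary forms Q3 and G3 are normalised in two different bases, related by
    R; [Qw] is Q3 in the basis where the conic is [Dw]. The last clause, transversality of these two
    conics, is what remains of the smoothness of B. *)
Lemma normal_form : exists (M : 'M[K]_(1 + 3)) (R Qw : 'M[K]_3) lam,
  [/\ M \in unitmx /\ R \in unitmx,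
     M *m Q *m M^T = block_mx 1%:M 0 0 (- Dz),
     M *m (G - lam *: Q) *m M^T = block_mx 0 0 0 (R *m Dw *m R^T),
     R *m Qw *m R^T = - Dz &
     forall (w : 'rV[K]_3) mu, w != 0 -> w *m Dw *m w^T = 0 -> w *m Qw <> mu *: (w *m Dw)].
Proof.
have [lam [v0 [v0n ev0]]] := @generalized_eigenvector _ Q G quadric_unit.
have [v vQ ev] : exists2 v : 'rV[K]_(1 + 3), v *m Q *m v^T = 1%:M & v *m (G - lam *: Q) = 0.
  have [c ec] := normalize_scalar (no_isotropic_eigenvector v0n ev0).
  exists (c *: v0); last by rewrite -scalemxAl ev0 scaler0.
  by rewrite linearZ /= -!scalemxAl -scalemxAr scalerA -expr2.
have [U [uU eU [Q3 sQ3 eQ3]]] := split_form sQ vQ.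
pose G' := G - lam *: Q.
have sG' : G'^T = G' by rewrite /G' linearB linearZ /= sQ sG.
pose B := dsubmx U.
have eUvB : U = col_mx v B by rewrite -eU vsubmxK.
pose G3 := B *m G' *m B^T.
have eG3 : U *m G' *m U^T = block_mx 0 0 0 G3.
  have G'v : G' *m v^T = 0 by rewrite -[G']trmxK sG' -trmx_mul ev trmx0.
  rewrite eUvB mul_col_mx tr_col_mx mul_col_row ev !mul0mx.
  by rewrite -mulmxA G'v mulmx0.
have sG3 : G3^T = G3 by rewrite /G3 !trmx_mul trmxK sG' mulmxA.
have uQ3 : Q3 \in unitmx.
  have : U *m Q *m U^T \in unitmx by rewrite unitmx_congr ?quadric_unit.
  by rewrite eQ3 unitmx_diag => /andP[].
have uG3 : G3 \in unitmx.
  rewrite -row_free_unit -kermx_eq0; apply/eqP/row_matrixP => k.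
  have := mulmx_ker G3 => /(congr1 (row k)); rewrite row_mul !row0.
  move: (row k _) => w ew; apply/eqP; apply: contraTT isT => w0.
  (* A kernel vector w of G3 would lift to (a, w) with a^2 = - Q3(w), an isotropic vector killed by
     G'. *)
  have [a ea] := closed_sqrt (- (w *m Q3 *m w^T) 0 0).
  pose x := row_mx (a%:M : 'M_1) w *m U.
  have x0 : x != 0.
    apply: contra_neq w0 => /(congr1 (fun X => X *m invmx U)).
    rewrite mulmxK // mul0mx => /(congr1 rsubmx); rewrite row_mxKr => ->.
    by apply/matrixP => i j; rewrite !mxE.
  have xG : x *m G' = 0.
    apply: (can_inj (mulmxK (_ : U^T \in unitmx))); first by rewrite unitmx_tr.
    by rewrite mul0mx mulmx_congr eG3 mul_row_block !mulmx0 ew !addr0 row_mx0.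
  have := no_isotropic_eigenvector x0 xG; rewrite /x congrC eQ3.
  rewrite mul_row_block !mulmx0 addr0 add0r mulmx1 tr_row_mx mul_row_col.
  rewrite tr_scalar_mx -scalar_mxM -expr2; move: (w *m Q3 *m w^T) ea => X ->.
  by rewrite {2}[X]mx11_scalar -raddfD /= addNr raddf0 eqxx.
have [P uP eP] := sym_congr two0 sG3 uG3 sDw uDw.
pose Qw := P *m Q3 *m P^T.
have sQw : Qw^T = Qw by rewrite /Qw !trmx_mul trmxK sQ3 mulmxA.
have uQw : Qw \in unitmx by rewrite unitmx_congr.
have [||R uR eR] := @sym_congr _ two0 _ Qw (- Dz) sQw uQw.
- by rewrite linearN /= sDz.
- by rewrite -scaleN1r unitmxZ ?unitrN ?unitr1.
pose E (X : 'M[K]_3) : 'M[K]_(1 + 3) := block_mx 1%:M 0 0 X.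
have uE X : X \in unitmx -> E X \in unitmx by move=> uX; rewrite unitmx_diag unitmx1.
have cE X (a : 'M_1) A : E X *m block_mx a 0 0 A *m (E X)^T = block_mx a 0 0 (X *m A *m X^T).
  rewrite /E tr_block_mx !trmx0 trmx1 !mulmx_block.
  by rewrite !(mul1mx, mulmx1, mul0mx, mulmx0, addr0, add0r).
exists (E R *m (E P *m U)), R, Qw, lam; split=> //.
- by rewrite !unitmx_mul !uE.
- by rewrite congrC congrC eQ3 !cE eR.
- by rewrite congrC congrC eG3 !cE eP.
move=> w mu w0 wD wQ.
pose V := E P *m U; have uV : V \in unitmx by rewrite unitmx_mul uE.
have eVQ : V *m Q *m V^T = block_mx 1%:M 0 0 Qw by rewrite congrC eQ3 cE.
have eVG : V *m G' *m V^T = block_mx 0 0 0 Dw by rewrite congrC eG3 cE eP.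
(* A tangency point w of the two conics gives the point (0, w) of B, at which B would be
   singular. *)
pose x := row_mx (0 : 'M_1) w *m V.
have x0 : x != 0.
  apply: contra_neq w0 => /(congr1 (fun X => X *m invmx V)).
  rewrite mulmxK // mul0mx => /(congr1 rsubmx); rewrite row_mxKr => ->.
  by apply/matrixP => i j; rewrite !mxE.
have xQ : x *m Q = mu *: (x *m G').
  apply: (can_inj (mulmxK (_ : V^T \in unitmx))); first by rewrite unitmx_tr.
  rewrite -scalemxAl /x.
  rewrite !mulmx_congr eVQ eVG !mul_row_block !mulmx0 !mul0mx !addr0 !add0r wQ.
  by rewrite scale_row_mx scaler0.
have qx : x *m Q *m x^T = 0.
  rewrite /x congrC eVQ mul_row_block !mulmx0 !mul0mx !addr0 !add0r wQ.
  by rewrite tr_row_mx mul_row_col mul0mx add0r -scalemxAl wD scaler0.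
have g'x : x *m G' *m x^T = 0.
  rewrite /x congrC eVG mul_row_block !mulmx0 ?mul0mx !addr0 !add0r.
  by rewrite tr_row_mx mul_row_col mul0mx add0r wD.
have gx : x *m G *m x^T = 0.
  by move: g'x; rewrite /G' mulmxBr mulmxBl -scalemxAr -scalemxAl qx scaler0 subr0.
have [] := smoothB x0 qx gx (a := 1 + mu * lam) (b := - mu).
  rewrite scalerDl scale1r {1}xQ /G' mulmxBr -scalemxAr scalerBr scalerA.
  by rewrite scaleNr subrK subrr.
move=> e /eqP; rewrite oppr_eq0 => /eqP mu0; move: e; rewrite mu0 mul0r addr0.
by move=> /eqP; rewrite oner_eq0.
Qed.
End NormalForm.

(** * Quadratic forms as symmetric matrices *)

Section QuadraticForm.
Variable K : fieldType.
Implicit Types (Q M : 'M[K]_4) (x : 'rV[K]_4).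

Definition qform Q : {mpoly K[4]} := \sum_i \sum_j Q i j *: ('X_i * 'X_j).

Lemma mmap_qform (A : comNzRingType) (f : {rmorphism K -> A}) (w : 'I_4 -> A) Q :
  mmap f w (qform Q) = ((\row_i w i) *m map_mx f Q *m (\row_i w i)^T) 0 0.
Proof.
rewrite -mulmxA mxE raddf_sum; apply: eq_bigr => i _ /=.
rewrite raddf_sum mxE [in RHS]mxE mulr_sumr; apply: eq_bigr => j _ /=.
by rewrite mmapZ rmorphM /= !mmapX !mmap1U !mxE mulrCA.
Qed.

Lemma lincomb_row (A : comNzRingType) (f : {rmorphism K -> A}) (w : 'I_4 -> A) M :
  \row_l lincomb M f w l = (\row_i w i) *m map_mx f M.
Proof.
by apply/rowP => l; rewrite !mxE; apply: eq_bigr => k _; rewrite !mxE mulrC.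
Qed.

Lemma mmap_qform_lincomb (A : comNzRingType) (f : {rmorphism K -> A}) (w : 'I_4 -> A) M Q :
  mmap f (lincomb M f w) (qform Q) =
  ((\row_i w i) *m map_mx f (M *m Q *m M^T) *m (\row_i w i)^T) 0 0.
Proof.
rewrite mmap_qform lincomb_row trmx_mul !map_mxM !map_trmx !mulmxA //.
Qed.

Lemma meval_qform Q x : (qform Q).@[x 0] = (x *m Q *m x^T) 0 0.
Proof.
have := mmap_qform idfun (x 0) Q; rewrite mmap_meval => ->.
have -> : \row_i x 0 i = x by apply/rowP => i; rewrite mxE.
by rewrite map_mx_id.
Qed.

Lemma grad_qform Q x : Q^T = Q -> grad (qform Q) x = 2 *: (x *m Q).
Proof.
move=> sQ; apply/rowP => k; rewrite !mxE.
have dX (i : 'I_4) : ('X_i : {mpoly K[4]})^`M(k) = (i == k)%:R%:MP.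
  rewrite mderivX mnmE; case: eqP => [->|_]; last by rewrite scale0r mpolyC0.
  have -> : (U_(k) - U_(k) = 0 :> 'X_{1..4})%MM by apply/mnmP => l; rewrite mnmBE mnm0E subnn.
  by rewrite mpolyX0 scale1r mpolyC1.
have term i j : (('X_i * 'X_j : {mpoly K[4]})^`M(k)).@[x 0] =
    (i == k)%:R * x 0 j + x 0 i * (j == k)%:R.
  by rewrite mderivM !dX mevalD !mevalM !mevalC !mevalXU.
have -> : ((qform Q)^`M(k)).@[x 0] = \sum_i \sum_j Q i j * ((i == k)%:R * x 0 j + x 0 i * (j == k)%:R).
  rewrite /qform (raddf_sum (mderiv k)) (raddf_sum (meval (x 0))).
  apply: eq_bigr => i _; rewrite /= (raddf_sum (mderiv k)) (raddf_sum (meval (x 0))).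
  by apply: eq_bigr => j _; rewrite /= mderivZ mevalZ term.
have -> : \sum_i \sum_j Q i j * ((i == k)%:R * x 0 j + x 0 i * (j == k)%:R) =
    \sum_j Q k j * x 0 j + \sum_i Q i k * x 0 i.
  under eq_bigr do (under eq_bigr do rewrite mulrDr; rewrite big_split /=).
  rewrite big_split; congr (_ + _) => /=.
    rewrite (bigD1 k) //= [X in _ + X]big1 ?addr0 => [|i /negPf ik]; last first.
      by rewrite big1 // => j _; rewrite ik mul0r mulr0.
    by apply: eq_bigr => j _; rewrite eqxx mul1r.
  apply: eq_bigr => i _; rewrite (bigD1 k) //= eqxx mulr1 big1 ?addr0 // => j /negPf jk.
  by rewrite jk !mulr0.
rewrite mulr2n mulrDl mul1r; congr (_ + _); apply: eq_bigr => j _.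
  by rewrite -{1}sQ mxE mulrC.
by rewrite mulrC.
Qed.

Lemma exists_qform (q : {mpoly K[4]}) : (2 : K) != 0 -> q \is 2.-homog ->
  exists2 Q, Q^T = Q & q = qform Q.
Proof.
move=> two0 /dhomogP hq; rewrite (mpolyE q) big_seq.
elim/big_rec: _ => [|m p mq [Q sQ ->]].
  exists 0; first by rewrite trmx0.
  by rewrite /qform big1 // => i _; rewrite big1 // => j _; rewrite mxE scale0r.
have [i [j em]] : exists i j, m = (U_(i) + U_(j))%MM.
  have dm := hq m mq; have [i mi] : exists i, m i != 0%N.
    apply/existsP; apply: contraT; rewrite negb_exists => /forallP h.
    by move: dm; rewrite /= mdegE big1 // => i _; apply/eqP; have := h i; rewrite negbK.
  have le : (U_(i) <= m)%MM.
    apply/mnm_lepP => k; rewrite mnmE; case: eqP => [<-|//].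
    by rewrite lt0n.
  have : mdeg (m - U_(i))%MM == 1%N.
    by move: dm; rewrite -{1}(submK le) /= mdegD mdeg1 addn1 => -[->].
  by move=> /mdeg1P[j /eqP ej]; exists i, j; rewrite -ej addmC submK.
pose D i j : 'M[K]_4 := delta_mx i j.
exists ((q@_m / 2) *: (D i j + D j i) + Q).
  by rewrite linearD linearZ linearD /= !trmx_delta sQ addrC [D j i + _]addrC addrC.
have dq (a b : 'I_4) : qform (D a b) = 'X_a * 'X_b.
  rewrite /qform (bigD1 a) //= (bigD1 b) //= big1 => [|k kb]; last by rewrite mxE (negPf kb) andbF scale0r.
  rewrite big1 => [|k ka]; last by rewrite big1 // => l _; rewrite mxE (negPf ka) scale0r.
  by rewrite mxE !eqxx scale1r !addr0.
have lin (c : K) (X Y : 'M[K]_4) : qform (c *: X + Y) = c *: qform X + qform Y.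
  rewrite /qform scaler_sumr -big_split; apply: eq_bigr => k _ /=.
  by rewrite scaler_sumr -big_split; apply: eq_bigr => l _; rewrite /= !mxE scalerDl scalerA.
rewrite lin -[D i j]scale1r lin scale1r !dq em mpolyXD; congr (_ + _).
rewrite ['X_j * 'X_i]mulrC; move: ('X_i * 'X_j) (q@_ _) => X c.
by rewrite scalerDr -scalerDl; congr (_ *: _); field.
Qed.

Lemma qform_lin c Q M : qform (Q - c *: M) = qform Q - c *: qform M.
Proof.
rewrite /qform scaler_sumr -sumrB; apply: eq_bigr => k _ /=.
rewrite scaler_sumr -sumrB; apply: eq_bigr => l _.
by rewrite /= !mxE scalerBl scalerA.
Qed.
End QuadraticForm.

Lemma ord3_ind (P : 'I_3 -> Prop) : P 0 -> P 1 -> P 2 -> forall k, P k.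
Proof.
move=> h0 h1 h2 [[|[|[|//]]] lk].
- by rewrite (_ : Ordinal lk = 0) //; apply: val_inj.
- by rewrite (_ : Ordinal lk = 1) //; apply: val_inj.
by rewrite (_ : Ordinal lk = 2) //; apply: val_inj.
Qed.

Lemma big_ord3 (V : nmodType) (F : 'I_3 -> V) : \sum_k F k = F 0 + F 1 + F 2.
Proof.
rewrite !big_ord_recl big_ord0 addr0 !addrA.
by do !congr (_ + _); congr (F _); apply: val_inj.
Qed.

Section Matrices.
Variable K : fieldType.
Hypothesis two0 : (2 : K) != 0.

Definition seqmx n (s : seq (seq K)) : 'M[K]_n := \matrix_(i, j) (nth [::] s i)`_j.

(* The quadric z0^2 - z1^2 + 4 z2 z3 in Segre coordinates, and the conics
   z1^2 - 4 z2 z3 and w1^2 - w0 w2. *)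
Definition segre_mx : 'M[K]_4 :=
  seqmx 4 [:: [:: 0; 0; 0; 1]; [:: 1; 1; 0; 0]; [:: -1; 1; 0; 0]; [:: 0; 0; 1; 0]].
Definition disc_mx : 'M[K]_3 := seqmx 3 [:: [:: 1; 0; 0]; [:: 0; 0; -2]; [:: 0; -2; 0]].
Definition conic_mx : 'M[K]_3 :=
  seqmx 3 [:: [:: 0; 0; - 2^-1]; [:: 0; 1; 0]; [:: - 2^-1; 0; 0]].

Lemma segre_mx_unit : segre_mx \in unitmx.
Proof.
pose T' := seqmx 4 [:: [:: 0; 2^-1; - 2^-1; 0]; [:: 0; 2^-1; 2^-1; 0]; [:: 0; 0; 0; 1]; [:: 1; 0; 0; 0]].
have e : segre_mx *m T' = 1%:M.
  apply/matrixP; elim/ord4_ind; elim/ord4_ind; rewrite !mxE big_ord4 !mxE /=; by field.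
by case/mulmx1_unit: e.
Qed.

Lemma disc_mx_unit : disc_mx \in unitmx.
Proof.
pose T' := seqmx 3 [:: [:: 1; 0; 0]; [:: 0; 0; - 2^-1]; [:: 0; - 2^-1; 0]].
have e : disc_mx *m T' = 1%:M.
  apply/matrixP; elim/ord3_ind; elim/ord3_ind; rewrite !mxE big_ord3 !mxE /=; by field.
by case/mulmx1_unit: e.
Qed.

Lemma conic_mx_unit : conic_mx \in unitmx.
Proof.
pose T' := seqmx 3 [:: [:: 0; 0; -2]; [:: 0; 1; 0]; [:: -2; 0; 0]].
have e : conic_mx *m T' = 1%:M.
  apply/matrixP; elim/ord3_ind; elim/ord3_ind; rewrite !mxE big_ord3 !mxE /=; by field.
by case/mulmx1_unit: e.
Qed.

Lemma disc_mx_sym : disc_mx^T = disc_mx.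
Proof. by apply/matrixP; elim/ord3_ind; elim/ord3_ind; rewrite !mxE. Qed.

Lemma conic_mx_sym : conic_mx^T = conic_mx.
Proof. by apply/matrixP; elim/ord3_ind; elim/ord3_ind; rewrite !mxE. Qed.

Section Eval.
Variables (A : comNzRingType) (f : {rmorphism K -> A}).

Lemma disc_eval (z : 'rV[A]_3) :
  (z *m map_mx f disc_mx *m z^T) 0 0 = z 0 0 ^+ 2 - 4 * (z 0 1 * z 0 2).
Proof.
rewrite mxE big_ord3 !mxE !big_ord3 !mxE /= !(rmorph0, rmorph1, rmorphN) /= rmorph_nat.
ring.
Qed.

Lemma conic_eval (w : 'rV[A]_3) :
  (w *m map_mx f conic_mx *m w^T) 0 0 = w 0 1 ^+ 2 - w 0 0 * w 0 2.
Proof.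
have h : f 2^-1 + f 2^-1 = 1 by rewrite -rmorphD -[2^-1]mul1r -mulrDl divff // rmorph1.
rewrite mxE big_ord3 !mxE !big_ord3 !mxE /= !(rmorph0, rmorph1, rmorphN) /=.
transitivity (w 0 1 ^+ 2 - (f 2^-1 + f 2^-1) * (w 0 0 * w 0 2)); first by ring.
by rewrite h mul1r.
Qed.

Variable sig : 'I_4 -> A.
(** The coordinates of the projection from the vertex of the cone; the coordinate lost is sig 1 -
    sig 2. *)
Definition plane_coords : 'rV[A]_3 := \row_j nth 0 [:: sig 1 + sig 2; sig 3; sig 0] j.

Lemma segre_coords : (\row_i sig i) *m map_mx f segre_mx =
  row_mx (sig 1 - sig 2)%:M plane_coords :> 'rV[A]_(1 + 3).
Proof.
rewrite -[LHS](@hsubmxK _ 1 1 3); congr row_mx.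
  apply/rowP => i; rewrite ord1 mxE mxE big_ord4 !mxE /= !(rmorph0, rmorph1, rmorphN) /=.
  ring.
apply/rowP; elim/ord3_ind; rewrite mxE mxE big_ord4 !mxE /= !(rmorph0, rmorph1, rmorphN) /=;
  ring.
Qed.
End Eval.
End Matrices.

Section EllipticNormalForm.
Variable K : closedFieldType.
Hypothesis two0 : (2 : K) != 0.

Lemma mx11_eq0 (A : nmodType) (X : 'M[A]_1) : X = 0 <-> X 0 0 = 0.
Proof.
split=> [->|e]; first by rewrite mxE.
by apply/matrixP => i j; rewrite !ord1 e mxE.
Qed.

(** The hypotheses are the vanishing at s of the quartic obtained from the ternary form at (1, s,
    s^2) and of its derivative. The vector k (s^2, -2 s, 1) is a multiple of the gradient of w_1^2 -
    w_0 w_2 at that point. *)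
Lemma double_root_tangent (F : fieldType) (a00 a01 a02 a11 a12 a22 s : F) : (2 : F) != 0 ->
  a00 + 2 * a01 * s + (2 * a02 + a11) * s ^+ 2 + 2 * a12 * s ^+ 3 + a22 * s ^+ 4 = 0 ->
  2 * a01 + 2 * (2 * a02 + a11) * s + 6 * a12 * s ^+ 2 + 4 * a22 * s ^+ 3 = 0 ->
  let k := a02 + s * a12 + s ^+ 2 * a22 in
  a00 + s * a01 + s ^+ 2 * a02 = s ^+ 2 * k /\
  a01 + s * a11 + s ^+ 2 * a12 = - 2 * s * k.
Proof.
move=> t0 e0 e1 k.
have eb : a01 + s * a11 + s ^+ 2 * a12 = - 2 * s * k.
  by apply: (mulfI t0); apply/eqP; rewrite -subr_eq0; apply/eqP; rewrite -[RHS]e1 /k; ring.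
split=> //; apply/eqP; rewrite -subr_eq0; apply/eqP; rewrite -[RHS]e0.
transitivity (a00 + 2 * a01 * s + (2 * a02 + a11) * s ^+ 2 + 2 * a12 * s ^+ 3 + a22 * s ^+ 4
  - s * (a01 + s * a11 + s ^+ 2 * a12 - - 2 * s * k)); first by rewrite /k; ring.
by rewrite eb subrr mulr0 subr0.
Qed.

(* A double root of f would be a singular point of the curve; a constant f means
   that the point at infinity is one. *)
Lemma disc_not_square (Qw : 'M[K]_3) (h : {poly K}) : Qw^T = Qw ->
  (forall (w : 'rV[K]_3) mu, w != 0 -> w *m conic_mx K *m w^T = 0 ->
     w *m Qw <> mu *: (w *m conic_mx K)) ->
  ((\row_j 'X^j) *m map_mx polyC Qw *m (\row_j 'X^j)^T) 0 0 <> - h ^+ 2.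
Proof.
move=> sQ sing eh.
have [q01 q02 q12] : [/\ Qw 1 0 = Qw 0 1, Qw 2 0 = Qw 0 2 & Qw 2 1 = Qw 1 2].
  by split; rewrite -[in LHS]sQ mxE.
move: eh; rewrite mxE big_ord3 !mxE !big_ord3 !mxE q01 q02 q12.
set F := (X in X = _); have eF : F = (Qw 0 0)%:P + (2 * Qw 0 1) *: 'X +
    (2 * Qw 0 2 + Qw 1 1) *: 'X^2 + (2 * Qw 1 2) *: 'X^3 + Qw 2 2 *: 'X^4.
  by rewrite /F -!mul_polyC !(polyCD, polyCM) /=; ring.
rewrite {F}eF => eh.
have wn0 (w : 'rV[K]_3) k : w 0 k != 0 -> w != 0.
  by apply: contra_neq => ->; rewrite mxE.
have wD (w : 'rV[K]_3) : w 0 1 ^+ 2 = w 0 0 * w 0 2 -> w *m conic_mx K *m w^T = 0.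
  move=> e; apply/mx11_eq0; have := conic_eval two0 idfun w; rewrite map_mx_id // => ->.
  by rewrite e subrr.
have wDE (w : 'rV[K]_3) : w *m conic_mx K = \row_j [:: - w 0 2 / 2; w 0 1; - w 0 0 / 2]`_j.
  by apply/rowP; elim/ord3_ind; rewrite !mxE big_ord3 !mxE /=; ring.
have wQE (w : 'rV[K]_3) : w *m Qw = \row_j [:: w 0 0 * Qw 0 0 + w 0 1 * Qw 0 1 + w 0 2 * Qw 0 2;
    w 0 0 * Qw 0 1 + w 0 1 * Qw 1 1 + w 0 2 * Qw 1 2;
    w 0 0 * Qw 0 2 + w 0 1 * Qw 1 2 + w 0 2 * Qw 2 2]`_j.
  by apply/rowP; elim/ord3_ind; rewrite !mxE big_ord3 ?q01 ?q02 ?q12.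
(* If h is a non-zero constant, the coefficients of s^3 and s^4 vanish and (0, 0, 1) is the tangency
   point; in all other cases h has a root. *)
have [sh|] := eqVneq (size h) 1%N.
  have /size_poly1P[c _ ec] : size h == 1%N by rewrite sh.
  have co k : (k > 0)%N -> (- h ^+ 2)`_k = 0 by rewrite ec -polyC_exp -polyCN coefC; case: k.
  have := co 4 isT; have := co 3 isT; rewrite -eh !coefD !coefZ !coefXn !coefX !coefC /=.
  rewrite !mulr0 !mulr1 !addr0 !add0r => /eqP; rewrite mulf_eq0 (negPf two0) /= => /eqP a12 a22.
  pose w : 'rV[K]_3 := \row_j [:: 0; 0; 1]`_j.
  apply: (sing w (- 2 * Qw 0 2)).
  - by apply: (wn0 w 2); rewrite mxE oner_eq0.
  - by apply: wD; rewrite !mxE /= expr0n mul0r.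
  rewrite wQE wDE; apply/rowP; elim/ord3_ind; rewrite !mxE /= ?a12 ?a22 ?mul0r ?mulr0 ?add0r ?oppr0 ?mul0r ?mulr0 ?mul1r //.
  by field.
move=> /closed_rootP[s /eqP hs].
have e0 : (- h ^+ 2).[s] = 0 by rewrite hornerN horner_exp hs expr0n oppr0.
have e1 : (- h ^+ 2)^`().[s] = 0.
  by rewrite expr2 derivN derivM hornerN hornerD !hornerM hs mul0r mulr0 addr0 oppr0.
move: e0 e1; rewrite -eh !derivD !derivZ derivC derivX !derivXn.
rewrite !hornerD !hornerZ !hornerMn !hornerXn ?hornerX !hornerC /= => e0 e1.
pose w : 'rV[K]_3 := \row_j [:: 1; s; s ^+ 2]`_j.
have [||ea eb] := @double_root_tangent K (Qw 0 0) (Qw 0 1) (Qw 0 2) (Qw 1 1) (Qw 1 2) (Qw 2 2) s two0.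
- by rewrite -[RHS]e0; ring.
- by rewrite -[RHS]e1; ring.
apply: (sing w (- 2 * (Qw 0 2 + s * Qw 1 2 + s ^+ 2 * Qw 2 2))).
- by apply: (wn0 w 0); rewrite mxE oner_eq0.
- by apply: wD; rewrite !mxE /= mul1r.
rewrite wQE wDE; apply/rowP; elim/ord3_ind; rewrite !mxE /= !mul1r ?ea ?eb; by field.
Qed.

(** In these coordinates q is the Segre quadric, and [w] projects to the plane of the cone w_1^2 =
    w_0 w_2. Conversely [c] gives the plane coordinates of (1, s, s^2), and c_0^2 - 4 c_1 c_2 is the
    value that (sig 1 - sig 2)^2 takes on Q above it. The identities are stated over every algebra
    because they are used at points, at polynomials and on generic lines. *)
Lemma elliptic_normal_form (q g : {mpoly K[4]}) :
  smooth_quadric q -> smooth_anticanonical_curve q g ->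
  exists (M : 'M[K]_4) (R : 'M[K]_3) lam, [/\ M \in unitmx, R \in unitmx,
    forall (A : comNzRingType) (f : {rmorphism K -> A}) (sig : 'I_4 -> A),
      mmap f (lincomb M f sig) q = 4 * (sig 0 * sig 3 - sig 1 * sig 2),
    forall (A : comNzRingType) (f : {rmorphism K -> A}) (sig : 'I_4 -> A),
      let w j := f (R 0 j) * (sig 1 + sig 2) + f (R 1 j) * sig 3 + f (R 2 j) * sig 0 in
      mmap f (lincomb M f sig) (g - lam *: q) = w 1 ^+ 2 - w 0 * w 2 &
    let c l := \sum_j invmx R j l *: 'X^j in
    forall h : {poly K}, c 0 ^+ 2 - 4 * c 1 * c 2 <> h ^+ 2].
Proof.
move=> [hq smq] [hg smB].
have [Q sQ eq_q] := exists_qform two0 hq; have [G sG eq_g] := exists_qform two0 hg.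
rewrite {}eq_q {}eq_g {hq hg q g} in smq smB *.
have smoothQ (x : 'rV[K]_(1 + 3)) : x != 0 -> x *m Q *m x^T = 0 -> x *m Q != 0.
  move=> x0 /mx11_eq0; rewrite -meval_qform => /(smq x x0).
  by rewrite grad_qform //; apply: contra_neq => ->; rewrite scaler0.
have smoothB (x : 'rV[K]_(1 + 3)) : x != 0 -> x *m Q *m x^T = 0 ->
    x *m G *m x^T = 0 -> forall a b, a *: (x *m Q) + b *: (x *m G) = 0 -> a = 0 /\ b = 0.
  move=> x0 /mx11_eq0; rewrite -meval_qform => qx /mx11_eq0; rewrite -meval_qform => gx a b e.
  have := smB x x0 qx gx; rewrite !grad_qform // => rk.
  have fr : row_free (col_mx (2 *: (x *m Q)) (2 *: (x *m G))) by rewrite /row_free rk.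
  have : row_mx (a%:M : 'M_1) (b%:M : 'M_1) *m col_mx (2 *: (x *m Q)) (2 *: (x *m G)) == 0.
    by rewrite mul_row_col !mul_scalar_mx !scalerA ![_ * 2]mulrC -!scalerA -scalerDr e scaler0.
  rewrite mulmx_free_eq0 // row_mx_eq0 => /andP[/eqP/mx11_eq0 a0 /eqP/mx11_eq0 b0].
  by move: a0 b0; rewrite !mxE !mulr1n.
have [Mz [R [Qw [lam [[uMz uR] eQ eG eQw sing]]]]] := normal_form two0 sQ sG smoothQ smoothB
  (disc_mx_sym K) (disc_mx_unit two0) (conic_mx_sym K) (conic_mx_unit two0).
exists (segre_mx K *m Mz), R, lam.
have ev (A : comNzRingType) (f : {rmorphism K -> A}) (sig : 'I_4 -> A) (a : 'M_1) D X :
    Mz *m X *m Mz^T = block_mx a 0 0 D ->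
    mmap f (lincomb (segre_mx K *m Mz) f sig) (qform X) =
    f (a 0 0) * (sig 1 - sig 2) ^+ 2 +
    (plane_coords sig *m map_mx f D *m (plane_coords sig)^T) 0 0.
  move=> eX; rewrite mmap_qform_lincomb congrC eX !map_mxM -map_trmx !mulmxA segre_coords.
  rewrite -[_ *m _ *m (\row_i sig i)^T]mulmxA -trmx_mul segre_coords.
  set z := row_mx _ _; rewrite -[LHS]/((z *m map_mx f (block_mx a 0 0 D) *m z^T) 0 0).
  rewrite map_block_mx !map_mx0 /z mul_row_block !mulmx0 addr0 add0r tr_row_mx mul_row_col mxE.
  congr (_ + _).
  by rewrite mul_scalar_mx mxE big_ord1 !mxE eqxx mulr1n expr2; ring.
have oppE (A : zmodType) (X : 'M[A]_1) : (- X) 0 0 = - X 0 0 by rewrite mxE.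
split=> //.
- by rewrite unitmx_mul segre_mx_unit.
- move=> A f sig; rewrite (ev _ _ _ _ _ _ eQ) map_mxN mulmxN mulNmx oppE disc_eval !mxE /= rmorph1.
  ring.
- move=> A f sig w; rewrite -qform_lin (ev _ _ _ _ _ _ eG) !map_mxM -map_trmx !mulmxA.
  rewrite [X in f X]mxE rmorph0 mul0r add0r -[_ *m _ *m (plane_coords sig)^T]mulmxA -trmx_mul conic_eval //.
  have ew j : (plane_coords sig *m map_mx f R) 0 j = w j.
    by rewrite mxE big_ord3 !mxE /= /w; congr (_ + _ + _); rewrite mulrC.
  by rewrite !ew.
move=> c h eh; have sQw : Qw^T = Qw.
  apply: (can_inj (mulKmx uR)); apply: (can_inj (mulmxK (_ : R^T \in unitmx))).
    by rewrite unitmx_tr.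
  have <- : (R *m Qw *m R^T)^T = R *m Qw^T *m R^T by rewrite !trmx_mul trmxK mulmxA.
  by rewrite eQw linearN /= disc_mx_sym.
apply: (disc_not_square (h := h) sQw sing).
have ez l : ((\row_j 'X^j) *m map_mx polyC (invmx R)) 0 l = c l.
  by rewrite mxE; apply: eq_bigr => j _; rewrite !mxE mulrC mul_polyC.
have eD : map_mx polyC (invmx R) *m map_mx polyC (disc_mx K) *m (map_mx polyC (invmx R))^T =
    - map_mx polyC Qw.
  rewrite map_trmx -!map_mxM -map_mxN; congr (map_mx _ _).
  have -> : disc_mx K = - (R *m Qw *m R^T) by rewrite eQw opprK.
  rewrite mulmxN mulNmx !mulmxA mulVmx // mul1mx -mulmxA -trmx_mul mulVmx //.
  by rewrite trmx1 mulmx1.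
have := disc_eval (@polyC K) ((\row_j 'X^j) *m map_mx polyC (invmx R)).
rewrite !ez mulrA eh => <-; rewrite -oppE; congr (fun_of_matrix _ _ _).
by rewrite -[map_mx polyC Qw]opprK -eD trmx_mul mulmxN mulNmx !mulmxA.
Qed.
End EllipticNormalForm.

(** * General points of the curve *)

Definition plane_lin (K : fieldType) (R : 'M[K]_3) (A : comNzRingType) (f : K -> A) (sig : 'I_4 -> A) j :=
  f (R 0 j) * (sig 1 + sig 2) + f (R 1 j) * sig 3 + f (R 2 j) * sig 0.

(** The quadratic polynomials that parametrise the conic, as the coordinates of (1, s, s^2) times
    the inverse of R. *)
Definition conic_param (K : fieldType) (R : 'M[K]_3) l : {poly K} := \sum_j invmx R j l *: 'X^j.

Lemma dvdp_X2_coef1 (K : fieldType) (a b : K) (C : {poly K}) :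
  'X^2 %| a%:P + 'X * b%:P + 'X^2 * C -> b = 0.
Proof.
move=> /dvdpP[Q] /(congr1 (fun P : {poly K} => P`_1)).
by rewrite coefMXn !coefD coefC coefXM coefXnM coefC /= add0r addr0.
Qed.

Section Multihomogeneous.
Variables (K : fieldType) (r : nat).
Implicit Types (f g : {mpoly K[r * 4]}) (e : 'I_r -> nat).

Definition mhom e f := forall (c : 'X_{1..r * 4}) i, c \in msupp f ->
  (\sum_(j < 4) c (mxvec_index i j))%N = e i.

Lemma mhom_multihomogeneous e f : mhom e f -> multihomogeneous f.
Proof. by move=> h; exists e. Qed.

Lemma mhom0 e : mhom e 0.
Proof. by move=> c i; rewrite msupp0. Qed.

Lemma mhomD e f g : mhom e f -> mhom e g -> mhom e (f + g).
Proof. by move=> hf hg c i /msuppD_le; rewrite mem_cat => /orP[/hf|/hg]. Qed.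

Lemma mhomZ e a f : mhom e f -> mhom e (a *: f).
Proof. by move=> hf c i /msuppZ_le /hf. Qed.

Lemma mhomN e f : mhom e f -> mhom e (- f).
Proof. by rewrite -scaleN1r; apply: mhomZ. Qed.

Lemma mhom_sum e (I : Type) (s : seq I) (P : pred I) (F : I -> {mpoly K[r * 4]}) :
  (forall i, P i -> mhom e (F i)) -> mhom e (\sum_(i <- s | P i) F i).
Proof.
move=> h; elim/big_rec: _ => [|i f Pi hf]; first exact: mhom0.
by apply: mhomD => //; apply: h.
Qed.

Lemma mhomC a : mhom (fun=> 0%N) a%:MP.
Proof.
move=> c i; rewrite msuppC; case: eqP => // _; rewrite inE => /eqP ->.
by rewrite big1 // => j _; rewrite mnm0E.
Qed.

Lemma mhomM e e' f g : mhom e f -> mhom e' g -> mhom (fun i => e i + e' i)%N (f * g).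
Proof.
move=> hf hg c i /msuppM_le /allpairsP[[a b] /= [ha hb ->]].
rewrite -(hf a i ha) -(hg b i hb) -big_split /=.
by apply: eq_bigr => j _; rewrite mnmDE.
Qed.

Lemma mhom_prod (I : Type) (s : seq I) (e : I -> 'I_r -> nat) (F : I -> {mpoly K[r * 4]}) :
  (forall k, mhom (e k) (F k)) -> mhom (fun i => \sum_(k <- s) e k i)%N (\prod_(k <- s) F k).
Proof.
move=> h; elim: s => [|k s IH] c i.
  by rewrite !big_nil -mpolyC1; apply: mhomC.
by rewrite !big_cons => hc; apply: (mhomM (h k) IH).
Qed.

Lemma multihomM f g : multihomogeneous f -> multihomogeneous g -> multihomogeneous (f * g).
Proof.
move=> [e hf] [e' hg]; apply: (mhom_multihomogeneous (e := fun i => e i + e' i)%N).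
exact: mhomM.
Qed.

Lemma multihom1 : multihomogeneous (1 : {mpoly K[r * 4]}).
Proof. by rewrite -mpolyC1; exists (fun=> 0%N) => c i; apply: mhomC. Qed.

Lemma multihom_prod (I : Type) (s : seq I) (P : pred I) (F : I -> {mpoly K[r * 4]}) :
  (forall i, P i -> multihomogeneous (F i)) -> multihomogeneous (\prod_(i <- s | P i) F i).
Proof.
move=> h; elim/big_rec: _ => [|i f Pi hf]; first exact: multihom1.
by apply: multihomM => //; apply: h.
Qed.

Definition coordvar (i : 'I_r) (l : 'I_4) : {mpoly K[r * 4]} := 'X_(mxvec_index i l).

Lemma mhom_coordvar i l : mhom (fun i' => (i == i') : nat) (coordvar i l).
Proof.
move=> c i'; rewrite msuppX inE => /eqP ->.
have inj j : (mxvec_index i l == mxvec_index i' j) = (i == i') && (l == j).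
  apply/eqP/andP => [e|[/eqP -> /eqP -> //]].
  by have /enum_rank_inj[-> ->] := cast_ord_inj e; rewrite !eqxx.
rewrite (bigD1 l) //= mnm1E inj eqxx andbT big1 ?addn0 // => j jl.
by rewrite mnm1E inj [l == j]eq_sym (negPf jl) andbF.
Qed.

Lemma meval_coordvar (P : 'M[K]_(r, 4)) i l : (coordvar i l).@[mxvec P 0] = P i l.
Proof. by rewrite mevalXU mxvecE. Qed.

Definition formpoly (a : 'cV[K]_4) i := \sum_l a l 0 *: coordvar i l.

Lemma mhom_formpoly a i : mhom (fun i' => (i == i') : nat) (formpoly a i).
Proof. by apply: mhom_sum => l _; apply/mhomZ/mhom_coordvar. Qed.

Definition lval (x : 'rV[K]_4) (a : 'cV[K]_4) := (x *m a) 0 0.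

Lemma meval_formpoly P a i : (formpoly a i).@[mxvec P 0] = lval (row i P) a.
Proof.
rewrite raddf_sum /lval mxE; apply: eq_bigr => l _ /=.
by rewrite mevalZ meval_coordvar mxE mulrC.
Qed.

(** The determinant that compares the ratio of the two forms at [x] with their ratio at [y]. *)
Definition bil (ab : 'cV[K]_4 * 'cV[K]_4) x y := lval x ab.1 * lval y ab.2 - lval y ab.1 * lval x ab.2.

Definition bilpoly (ab : 'cV[K]_4 * 'cV[K]_4) i j :=
  formpoly ab.1 i * formpoly ab.2 j - formpoly ab.1 j * formpoly ab.2 i.

Lemma multihom_bilpoly ab i j : multihomogeneous (bilpoly ab i j).
Proof.
apply: (mhom_multihomogeneous (e := fun i' => (i == i') + (j == i'))%N).
apply: mhomD; first by apply: mhomM; apply: mhom_formpoly.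
by apply: mhomN; rewrite mulrC; apply: mhomM; apply: mhom_formpoly.
Qed.

Lemma meval_bilpoly P ab i j : (bilpoly ab i j).@[mxvec P 0] = bil ab (row i P) (row j P).
Proof. by rewrite mevalB !mevalM !meval_formpoly. Qed.

(* The first four points, completed by coordinate points when there are fewer. *)
Definition frame (P : 'M[K]_(r, 4)) : 'M[K]_4 := \matrix_(k, l)
  if insub (k : nat) is Some i then P i l else (k == l)%:R.

Definition framepoly : {mpoly K[r * 4]} := \det (\matrix_(k < 4, l < 4)
  if insub (k : nat) is Some i then coordvar i l else (k == l)%:R%:MP).

Lemma meval_framepoly P : framepoly.@[mxvec P 0] = \det (frame P).
Proof.
rewrite -[LHS]det_map_mx; congr (\det _); apply/matrixP => k l; rewrite !mxE.
by case: insubP => [i _ _|_] /=; rewrite ?meval_coordvar ?mevalC.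
Qed.

Lemma multihom_framepoly : multihomogeneous framepoly.
Proof.
pose e (k : 'I_4) (i' : 'I_r) := if insub (k : nat) is Some i then (i == i') : nat else 0%N.
apply: (mhom_multihomogeneous (e := fun i' => \sum_k e k i')%N).
apply: mhom_sum => s _.
have -> : (-1) ^+ perm.odd_perm s = ((-1) ^+ perm.odd_perm s)%:MP :> {mpoly K[r * 4]}.
  by rewrite rmorphXn rmorphN rmorph1.
rewrite mul_mpolyC; apply: mhomZ; apply: mhom_prod => k; rewrite mxE /e.
case: insubP => [i _ _|_]; first exact: mhom_coordvar.
exact: mhomC.
Qed.
End Multihomogeneous.

Section CurvePoints.
Variable K : closedFieldType.
Hypothesis two0 : (2 : K) != 0.
Variables (q g : {mpoly K[4]}) (M : 'M[K]_4) (R : 'M[K]_3) (lam : K).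
Hypotheses (uM : M \in unitmx) (uR : R \in unitmx).
Hypothesis q_ev : forall (A : comNzRingType) (f : {rmorphism K -> A}) (sig : 'I_4 -> A),
  mmap f (lincomb M f sig) q = 4 * (sig 0 * sig 3 - sig 1 * sig 2).
Hypothesis g_ev : forall (A : comNzRingType) (f : {rmorphism K -> A}) (sig : 'I_4 -> A),
  mmap f (lincomb M f sig) (g - lam *: q) =
    plane_lin R f sig 1 ^+ 2 - plane_lin R f sig 0 * plane_lin R f sig 2.
Local Notation c := (conic_param R).
Hypothesis f_nsq : forall h : {poly K}, c 0 ^+ 2 - 4 * c 1 * c 2 <> h ^+ 2.

Lemma four_neq0 : (4 : K) != 0.
Proof.
have -> : (4 : K) = 2 * 2 by ring.
exact: mulf_neq0.
Qed.

Lemma conic_param_plane (A : comNzRingType) (io : {rmorphism {poly K} -> A}) j :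
  io (R 0 j)%:P * io (c 0) + io (R 1 j)%:P * io (c 1) + io (R 2 j)%:P * io (c 2) = io 'X^j.
Proof.
rewrite -!rmorphM -!rmorphD; congr (io _).
have -> : 'X^j = \sum_i (i == j)%:R *: 'X^i :> {poly K}.
  rewrite (bigD1 j) //= eqxx scale1r big1 ?addr0 // => i /negPf ->.
  by rewrite scale0r.
have -> : (R 0 j)%:P * c 0 + (R 1 j)%:P * c 1 + (R 2 j)%:P * c 2 = \sum_l (R l j)%:P * c l.
  by rewrite big_ord3.
rewrite /c; under eq_bigr do rewrite mulr_sumr; rewrite exchange_big /=.
apply: eq_bigr => i _; under eq_bigr do rewrite mul_polyC scalerA; rewrite -scaler_suml.
congr (_ *: _); have := congr1 (fun X : 'M[K]_3 => X i j) (mulVmx uR); rewrite !mxE => <-.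
by apply: eq_bigr => l _; rewrite mulrC.
Qed.

Lemma conic_param_span j : (j < 3)%N -> exists a : K * K * K,
  a.1.1 *: c 0 + a.1.2 *: c 1 + a.2 *: c 2 = 'X^j.
Proof.
move=> j3; exists (R 0 (Ordinal j3), R 1 (Ordinal j3), R 2 (Ordinal j3)).
have := conic_param_plane idfun (Ordinal j3); rewrite /= !mul_polyC //.
Qed.

Lemma conic_param_size l : (size (c l) <= 3)%N.
Proof.
apply: leq_trans (size_sum _ _ _) _; apply/bigmax_leqP => j _.
by apply: leq_trans (size_scale_leq _ _) _; rewrite size_polyXn.
Qed.

Lemma conic_param_free (t : 'I_3 -> K) : \sum_l t l *: c l = 0 -> forall l, t l = 0.
Proof.
move=> e; have z : (\col_l t l) = 0 :> 'cV[K]_3.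
  apply: (can_inj (mulKmx (_ : invmx R \in unitmx))); first by rewrite unitmx_inv.
  rewrite mulmx0; apply/colP => j; have := congr1 (fun p : {poly K} => p`_j) e.
  rewrite coef0 coef_sum !mxE => h; rewrite -[RHS]h; apply: eq_bigr => l _.
  rewrite coefZ coef_sum (bigD1 j) //= coefZ coefXn eqxx mulr1 big1 ?addr0 => [|i ij].
    by rewrite mxE mulrC.
  rewrite coefZ coefXn (_ : (_ == _) = false) ?mulr0 //.
  by apply/negbTE; rewrite eq_sym; exact: ij.
by move=> l; have := congr1 (fun X : 'cV[K]_3 => X l 0) z; rewrite !mxE.
Qed.

Lemma io_half (A : comNzRingType) (io : {rmorphism {poly K} -> A}) : io (2^-1)%:P * 2 = 1.
Proof.
rewrite -(rmorph_nat io 2) -rmorphM -(rmorph_nat (@polyC K) 2) -polyCM mulVf //.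
by rewrite polyC1 rmorph1.
Qed.

Lemma ellsig_plane (A : comNzRingType) (io : {rmorphism {poly K} -> A}) (y : A) j :
  plane_lin R (io \o polyC) (ellsig (c 0) (c 1) (c 2) io y) j = io 'X^j.
Proof.
rewrite -conic_param_plane /plane_lin /ellsig /=; congr (_ * _ + _ + _).
have h := io_half io.
move: (io _) (io (c 0)) h => a c0 h.
by transitivity ((a * 2) * c0); [ring | rewrite h mul1r].
Qed.

Lemma ellsig_quadric (A : comNzRingType) (io : {rmorphism {poly K} -> A}) (y : A) :
  let s := ellsig (c 0) (c 1) (c 2) io y in
  4 * (s 0 * s 3 - s 1 * s 2) = y ^+ 2 - io (c 0 ^+ 2 - 4 * c 1 * c 2).
Proof.
rewrite /ellsig /=.
have h := io_half io.
rewrite rmorphB rmorphXn !rmorphM rmorph_nat.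
move: (io _) (io (c 0)) (io (c 1)) (io (c 2)) h => a c0 c1 c2 h.
transitivity (4 * c2 * c1 - (a * 2) ^+ 2 * (c0 ^+ 2 - y ^+ 2)); first by ring.
by rewrite h; ring.
Qed.

Lemma curve_eval (sig : 'rV[K]_4) :
  q.@[(sig *m M) 0] = 4 * (sig 0 0 * sig 0 3 - sig 0 1 * sig 0 2) /\
  g.@[(sig *m M) 0] = plane_lin R idfun (sig 0) 1 ^+ 2 -
    plane_lin R idfun (sig 0) 0 * plane_lin R idfun (sig 0) 2 + lam * q.@[(sig *m M) 0].
Proof.
have ex l : (sig *m M) 0 l = lincomb M idfun (sig 0) l.
  by rewrite mxE; apply: eq_bigr => k _; rewrite mulrC.
have e (F : {mpoly K[4]}) : F.@[(sig *m M) 0] = mmap idfun (lincomb M idfun (sig 0)) F.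
  by apply: eq_mmap.
split; first by rewrite e q_ev.
rewrite -[in LHS](subrK (lam *: q) g) mevalD mevalZ; congr (_ + _).
by rewrite e g_ev.
Qed.

(** On the double cover a linear form becomes PA + PB y. Its norm is non-zero because f is not a
    square and the conic parameters are linearly independent, so any s outside the roots of finitely
    many norms lifts to a suitable point. *)
Lemma avoid_forms (as_ : seq 'cV[K]_4) : (forall a, a \in as_ -> a != 0) ->
  exists2 x : 'rV[K]_4, on_curve q g x & forall a, a \in as_ -> (x *m a) 0 0 != 0.
Proof.
move=> nz; pose f := c 0 ^+ 2 - 4 * c 1 * c 2.
pose t (a : 'cV[K]_4) k := (M *m a) k 0.
pose PA a : {poly K} := t a 0 *: c 2 + (2^-1 * (t a 1 + t a 2)) *: c 0 + t a 3 *: c 1.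
pose PB a : K := 2^-1 * (t a 1 - t a 2).
pose P := \prod_(a <- as_) (PA a ^+ 2 - (PB a)%:P ^+ 2 * f).
have half0 : (2^-1 : K) != 0 by rewrite invr_eq0.
have [s Ps] : exists s, ~~ root P s.
  apply/closed_nonrootP.
  rewrite /P prodf_seq_neq0; apply/allP => a /nz a0 /=; rewrite subr_eq0.
  apply: contra_neqN a0 => /eqP e; have [A0 B0] := norm_eq0 f_nsq e.
  have tz := @conic_param_free (fun l => if l == 0 then 2^-1 * (t a 1 + t a 2)
    else if l == 1 then t a 3 else t a 0).
  rewrite big_ord3 /= in tz.
  have {}tz : forall l : 'I_3, _ := tz _.
  have h0 := tz _ 0; have h1 := tz _ 1; have h2 := tz _ 2.
  have eA : 2^-1 * (t a 1 + t a 2) *: c 0 + t a 3 *: c 1 + t a 0 *: c 2 = 0.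
    by rewrite -[RHS]A0 addrC addrA.
  have {h0 h1 h2 tz} [h0 h3 h1] := And3 (h0 eA) (h1 eA) (h2 eA).
  have p0 : t a 1 + t a 2 = 0 by apply/eqP; move/eqP: h0; rewrite /= mulf_eq0 (negPf half0).
  have m0 : t a 1 - t a 2 = 0.
    by apply/eqP; move/eqP: B0; rewrite polyC_eq0 mulf_eq0 (negPf half0).
  have t1 : t a 1 = 0.
    apply: (mulfI two0); rewrite mulr0 -[RHS](addr0 0) -{1}p0 -m0; ring.
  have t2 : t a 2 = 0 by move: p0; rewrite t1 add0r.
  apply: (can_inj (mulKmx uM)); rewrite mulmx0; apply/colP.
  by elim/ord4_ind; rewrite [RHS]mxE.
have [y ey] := closed_sqrt f.[s].
pose sig : 'rV[K]_4 := \row_k ellsig (c 0) (c 1) (c 2) (horner_eval s) y k.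
have pl j : plane_lin R idfun (sig 0) j = s ^+ j.
  have := ellsig_plane (horner_eval s) y j; rewrite /= {3}/horner_eval hornerXn => <-.
  by rewrite /plane_lin !mxE /= /horner_eval !hornerC.
have [eq eg] := curve_eval sig.
have q0 : q.@[(sig *m M) 0] = 0.
  rewrite eq !mxE; have := ellsig_quadric (horner_eval s) y => /= ->.
  by rewrite ey /horner_eval subrr.
exists (sig *m M).
  split=> //; last by rewrite eg q0 mulr0 addr0 !pl expr0 mul1r expr1 subrr.
  apply: contraNneq (oner_neq0 K) => e0; have := pl 0; rewrite expr0 => <-.
  have -> : sig = 0 by apply: (can_inj (mulmxK uM)); rewrite mul0mx.
  by rewrite /plane_lin !mxE addr0 !mulr0 !addr0.
move=> a aas; apply: contraNneq Ps => ell0; rewrite /root /P horner_prod.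
have ea : (PA a).[s] = - (PB a * y).
  apply/eqP; rewrite -addr_eq0 -ell0 -mulmxA mxE big_ord4 !mxE /= /ellsig /=; apply/eqP.
  rewrite /PA /PB /horner_eval !hornerD !hornerZ !hornerC /t !mxE.
  ring.
rewrite prodf_seq_eq0; apply/hasP; exists a => //=.
rewrite hornerD hornerN hornerM [(_ * f).[s]]hornerM horner_exp hornerC -ey ea; apply/eqP.
ring.
Qed.

Section Quadratic.
Hypotheses (q_homog : q \is 2.-homog) (g_homog : g \is 2.-homog).
Local Notation pb := (comp_mpoly (qparam M)).

Lemma quadric_neq0 : q != 0.
Proof.
apply: contraNneq four_neq0 => q0.
have := q_ev idfun (fun k => if k == 0 then 1 else if k == 3 then 1 else 0).
by rewrite q0 raddf0 /= mulr0 subr0 mulr1 mulr1 => ->.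
Qed.

Lemma quadric_pb : pb q = 0.
Proof.
have -> : pb q = mmap (@mpolyC 2 K) (lincomb M (@mpolyC 2 K) (segre K)) q.
  apply: eq_mmap => [a|l]; first exact: erefl.
  by rewrite tnth_mktuple; apply: eq_bigr => k _; rewrite mul_mpolyC.
by rewrite q_ev /segre /= mul1r subrr mulr0.
Qed.

Lemma quadric_not_mult (u v : K) : ~ mult q (lincomb M idfun (segreA u v)) 2.
Proof.
move=> /mult_eval - /(_ (fun l => (M 3 l)%:P)).
have -> : mmap polyC (fun l => (lincomb M idfun (segreA u v) l)%:P + 'X * (M 3 l)%:P) q =
    mmap polyC (lincomb M polyC (fun k => (segreA u v k)%:P + 'X * (k == 3)%:R)) q.
  apply: eq_mmap => // l; rewrite /lincomb rmorph_sum /=.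
  under [RHS]eq_bigr do rewrite mulrDr; rewrite big_split /=; congr (_ + _).
    by apply: eq_bigr => k _; rewrite polyCM.
  rewrite (bigD1 3) //= ?eqxx mulr1 big1 ?addr0 1?mulrC // => k /negPf ->.
  by rewrite !mulr0.
rewrite q_ev /segreA /= => h; case/eqP: four_neq0.
apply: (@dvdp_X2_coef1 K 0 4 0); move: h; congr (_ %| _).
by rewrite -(rmorph_nat (@polyC K) 4) polyCM /= !polyC1 !polyC0; ring.
Qed.

Lemma curve_homog : g - lam *: q \is 2.-homog.
Proof. by rewrite rpredB // dhomogZ. Qed.

Lemma curve_ell : mmap (polyC \o polyC)
  (lincomb M (polyC \o polyC) (ellsig (c 0) (c 1) (c 2) polyC 'X)) (g - lam *: q) = 0.
Proof.
rewrite (g_ev (polyC \o polyC)) !(ellsig_plane (@polyC _)).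
by rewrite -polyC_exp -polyCM -polyCB -exprM mul1r subrr.
Qed.

(** [l] is, up to k, the differential of w_1^2 - w_0 w_2 in the plane coordinates. Multiplicity 2
    kills it along the two tangent directions of Q, independent because u differs from v, and
    Euler's relation kills the remaining coordinate. Then R would annihilate the non-zero vector (-
    s^2, 2 s, -1). *)
Lemma curve_not_mult (u v s k : K) : u != v -> k != 0 ->
  (forall j : 'I_3, R 0 j * (u + v) + R 1 j * (u * v) + R 2 j = k * s ^+ j) ->
  ~ mult (pb (g - lam *: q)) (pt2 u v) 2.
Proof.
move=> uv k0 ew mu; pose l (i : 'I_3) := 2 * s * R i 1 - R i 2 - s ^+ 2 * R i 0.
have main a b : k * ((a + b) * l 0 + (a * v + b * u) * l 1) = 0.
  have := mult_eval (fun j : 'I_2 => if val j == 0%N then a%:P else b%:P) mu.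
  rewrite mmap_pb g_ev /plane_lin /segreA /pt2 /= => h.
  pose e j := (R 1 j * (a * b))%:P.
  pose w j := k * s ^+ (j : 'I_3).
  pose z j := R 0 j * (a + b) + R 1 j * (a * v + b * u).
  pose C : {poly K} := (z 1)%:P ^+ 2 + 2 * (w 1)%:P * e 1 + 'X * 2 * (z 1)%:P * e 1 + 'X^2 * e 1 ^+ 2
    - (w 0%R)%:P * e 2 - (w 2)%:P * e 0 - (z 0)%:P * (z 2)%:P
    - 'X * ((z 0)%:P * e 2 + (z 2)%:P * e 0) - 'X^2 * e 0 * e 2.
  have -> : k * ((a + b) * l 0 + (a * v + b * u) * l 1) = 2 * w 1 * z 1 - w 0 * z 2 - w 2 * z 0.
    by rewrite /w /z /l /= expr0 expr1; ring.
  apply: (@dvdp_X2_coef1 K (w 1 ^+ 2 - w 0 * w 2) _ C); move: h; congr (_ %| _).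
  have eW j : (R 0 j)%:P * (u%:P + 'X * a%:P + (v%:P + 'X * b%:P)) +
     (R 1 j)%:P * ((u%:P + 'X * a%:P) * (v%:P + 'X * b%:P)) + (R 2 j)%:P * 1 =
     (w j)%:P + 'X * (z j)%:P + 'X^2 * e j.
    by rewrite /w -ew /z /e !(polyCD, polyCM); ring.
  rewrite !eW /C !(polyCD, polyCM, polyCN, polyC_exp) -(rmorph_nat (@polyC K) 2) /=; ring.
have l1 : l 1 = 0.
  have /eqP := main 1 (-1); rewrite subrr mul0r add0r mul1r mulN1r mulf_eq0 (negPf k0) /=.
  by rewrite mulf_eq0 subr_eq0 eq_sym (negPf uv) => /eqP.
have l0 : l 0 = 0.
  have /eqP := main 1 0; rewrite l1 mulr0 !addr0 mul1r mulf_eq0 (negPf k0) /=.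
  by move/eqP.
have l2 : l 2 = 0.
  transitivity ((u + v) * l 0 + (u * v) * l 1 + l 2); first by rewrite l0 l1; ring.
  have e0 := ew 0; have e1 := ew 1; have e2 := ew 2; rewrite /= ?expr0 ?expr1 in e0 e1 e2.
  transitivity (2 * s * (k * s ^+ 1) - k * s ^+ 2 - s ^+ 2 * (k * 1)); last by ring.
  by rewrite -e0 -e1 -e2 /l; ring.
pose z : 'cV[K]_3 := \col_j [:: - s ^+ 2; 2 * s; -1]`_j.
have : z = 0.
  apply: (can_inj (mulKmx uR)); rewrite mulmx0; apply/colP => i; rewrite mxE big_ord3 !mxE /=.
  have <- : l i = 0 by elim/ord3_ind: i.
  by rewrite /l; ring.
move=> /(congr1 (fun X : 'cV[K]_3 => X 2 0)) /eqP.
by rewrite !mxE /= oppr_eq0 oner_eq0.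
Qed.

Lemma plane_row (z : 'I_4 -> K) :
  \row_j plane_lin R idfun z j = (\row_k [:: z 1 + z 2; z 3; z 0]`_k) *m R.
Proof.
apply/rowP => j; rewrite !mxE big_ord3 !mxE /=.
by rewrite /plane_lin /=; congr (_ + _ + _); rewrite mulrC.
Qed.

Section Points.
Variables (r : nat) (P : 'M[K]_(r, 4)).
Hypothesis P_curve : forall i, on_curve q g (row i P).
Let sg i : 'rV[K]_4 := row i P *m invmx M.
Let w i j := plane_lin R idfun (sg i 0) j.
Hypotheses (sg0 : forall i, sg i 0 0 != 0) (sg12 : forall i, sg i 0 1 != sg i 0 2)
  (w0 : forall i, w i 0 != 0).
Hypotheses (s_gen : forall i j, i != j -> w i 1 * w j 0 != w j 1 * w i 0)
  (u_gen : forall i j, i != j -> sg i 0 1 * sg j 0 0 != sg j 0 1 * sg i 0 0)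
  (v_gen : forall i j, i != j -> sg i 0 2 * sg j 0 0 != sg j 0 2 * sg i 0 0).
Variable D : 'M[K]_4.
Hypotheses (uD : D \in unitmx)
  (D_row : forall (k : 'I_4) (i : 'I_r), k = i :> nat -> D k =1 P i).

Lemma frac_inj (I : eqType) (a b : I -> K) : (forall i, b i != 0) ->
  (forall i j, i != j -> a i * b j != a j * b i) -> injective (fun i => a i / b i).
Proof.
move=> b0 h i j e; apply/eqP; apply: contraT => /h; rewrite -eqr_div ?b0 //.
by rewrite e eqxx.
Qed.

Lemma dim_config d n : multseq r n -> std d n -> (n 0 <= d.+1)%N -> (msum r n < 4 * d)%N ->
  (\dim (xsys (fun i => P i) d (fun i => n i)) + \sum_(i < r) 'C(n i + 2, 3) =
   'C(d + 3, 3) + \sum_(i < r) 'C(excess n d i + 1, 3))%N.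
Proof.
move=> hn hs n0 lt.
(* Two scalings are in play: w_0 = 1 for the point (s, y) of the double cover, and z_0 = 1 for the
   Segre point (1, u, v, uv). *)
pose s i := w i 1 / w i 0; pose u i := sg i 0 1 / sg i 0 0; pose v i := sg i 0 2 / sg i 0 0.
pose y i := (sg i 0 1 - sg i 0 2) / w i 0.
have sgM i : sg i *m M = row i P by rewrite mulmxKV.
have q_rel i : sg i 0 0 * sg i 0 3 = sg i 0 1 * sg i 0 2.
  have [_ qi _] := P_curve i; have [e _] := curve_eval (sg i).
  move: e; rewrite sgM qi => /esym/eqP; rewrite mulf_eq0 (negPf four_neq0) /=.
  by rewrite subr_eq0 => /eqP.
have w_rel i : w i 1 ^+ 2 = w i 0 * w i 2.
  have [_ qi gi] := P_curve i; have [_ e] := curve_eval (sg i).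
  by move: e; rewrite sgM qi gi mulr0 addr0 => /esym/eqP; rewrite subr_eq0 => /eqP.
have ws i (j : 'I_3) : w i j = w i 0 * s i ^+ j.
  elim/ord3_ind: j; rewrite /s /= ?expr0 ?expr1 ?mulr1 //.
    by rewrite mulrCA divff ?mulr1 // w0.
  by rewrite expr_div_n w_rel; field; rewrite w0.
have cs i : [/\ (c 0).[s i] = (sg i 0 1 + sg i 0 2) / w i 0, (c 1).[s i] = sg i 0 3 / w i 0 &
    (c 2).[s i] = sg i 0 0 / w i 0].
  have cl l : (c l).[s i] = ((\row_j w i j) *m invmx R) 0 l / w i 0.
    rewrite mxE mulr_suml horner_sum; apply: eq_bigr => j _.
    by rewrite hornerZ hornerXn mxE ws; field; rewrite w0.
  by split; rewrite cl /w plane_row mulmxK // mxE.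
have c_uv i : 2 * u i * (c 2).[s i] = (c 0).[s i] + y i /\
    2 * v i * (c 2).[s i] = (c 0).[s i] - y i.
  have [-> _ ->] := cs i; have := sg0 i; have := w0 i; rewrite /u /v /y.
  move: (sg i 0 0) (sg i 0 1) (sg i 0 2) (w i 0) => z0 z1 z2 k k0 z00.
  by split; field; rewrite z00 k0.
have y_sq i : y i ^+ 2 = (c 0 ^+ 2 - 4 * c 1 * c 2).[s i].
  rewrite hornerD hornerN horner_exp !hornerM.
  have -> : (4 : {poly K}).[s i] = 4 by rewrite -(rmorph_nat (@polyC K) 4) hornerC.
  have [-> -> ->] := cs i; have := w0 i; have := q_rel i; rewrite /y.
  move: (sg i 0 0) (sg i 0 1) (sg i 0 2) (sg i 0 3) (w i 0) => z0 z1 z2 z3 k e k0.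
  have -> : ((z1 + z2) / k) ^+ 2 - 4 * (z3 / k) * (z0 / k) =
    ((z1 + z2) ^+ 2 - 4 * (z0 * z3)) / k ^+ 2 by field.
  by rewrite e; field.
have y0 i : y i != 0 by rewrite mulf_neq0 ?invr_eq0 ?w0 // subr_eq0.
have c30 i : (c 2).[s i] != 0 by have [_ _ ->] := cs i; rewrite mulf_neq0 ?invr_eq0 ?w0.
have uv i : u i != v i by rewrite /u /v (inj_eq (mulIf _)) ?invr_eq0.
have xE i l : P i l = sg i 0 0 * lincomb M idfun (segreA (u i) (v i)) l.
  have -> : P i l = (sg i *m M) 0 l by rewrite sgM mxE.
  rewrite mxE /lincomb mulr_sumr; apply: eq_bigr => k _.
  rewrite [RHS]mulrCA mulrC; congr (_ * _); have := q_rel i; have := sg0 i; rewrite /u /v /segreA.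
  elim/ord4_ind: k => /=; move: (sg i 0 0) (sg i 0 1) (sg i 0 2) (sg i 0 3) => z0 z1 z2 z3 n00 e.
  - by rewrite mulr1.
  - by rewrite mulrCA divff ?mulr1.
  - by rewrite mulrCA divff ?mulr1.
  by rewrite mulrACA -e; field.
have -> : xsys (fun i => P i) d (fun i => n i) =
    xsys (fun i => lincomb M idfun (segreA (u i) (v i))) d (fun i => n i).
  apply/vspaceP => F; apply/idP/idP => /mem_xsys h; apply/mem_xsys => i.
    apply: (mult_scale (dhomog_is_dhomog F) (c := (sg i 0 0)^-1)) (h i); rewrite ?invr_eq0 //.
    by move=> l; rewrite xE mulKf.
  by apply: (mult_scale (dhomog_is_dhomog F) (sg0 i)) (h i); apply: xE.
(* Rescales the rows of the frame to the representatives with z_0 = 1. *)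
pose dg : 'rV[K]_4 := \row_k (if insub (k : nat) is Some i then (sg i 0 0)^-1 else 1).
have udg : diag_mx dg \in unitmx.
  rewrite unitmxE det_diag unitfE; apply/prodf_neq0 => k _; rewrite mxE.
  by case: insubP => [i _ _|_]; rewrite ?invr_eq0 ?oner_eq0.
apply: (@dim_xsys _ _ uM two0 (c 0) (c 1) (c 2) _ _ _ _ f_nsq r s u v y _ _ _ y0 y_sq c30 _ _ q
  (g - lam *: q) curve_homog curve_ell _ q_homog quadric_neq0 quadric_pb _ (diag_mx dg *m D)) => //.
- exact: conic_param_size.
- exact: conic_param_size.
- exact: conic_param_size.
- exact: conic_param_span.
- exact: frac_inj.
- exact: frac_inj.
- exact: frac_inj.
- by move=> i; case: (c_uv i).
- by move=> i; case: (c_uv i).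
- move=> i; apply: (@curve_not_mult _ _ (s i) (w i 0 / sg i 0 0)) => //.
    by rewrite mulf_neq0 ?invr_eq0.
  move=> j; have := ws i j; rewrite /w {1}/plane_lin /=.
  have := sg0 i; have := q_rel i; rewrite /u /v.
  move: (plane_lin _ _ _ _) (s i ^+ j) (sg i 0 0) (sg i 0 1) (sg i 0 2) (sg i 0 3) => k sj z0 z1 z2 z3 e z00 ek.
  have -> : k / z0 * sj = k * sj / z0 by rewrite mulrAC.
  have -> : z1 / z0 * (z2 / z0) = z1 * z2 / (z0 * z0) by field.
  by rewrite -ek -e; field.
- by move=> i; apply: quadric_not_mult.
- by rewrite unitmx_mul udg.
move=> k i ki l; rewrite mul_diag_mx mxE (D_row ki) xE mxE.
case: insubP => [j _ jk|]; last by rewrite ki ltn_ord.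
have -> : j = i by apply: val_inj; rewrite jk ki.
by rewrite mulKf.
Qed.
End Points.
End Quadratic.

(** * Existence of a configuration in general position *)

Definition scol k : 'cV[K]_4 := col k (invmx M).
Definition wcol j : 'cV[K]_4 := R 0 j *: (scol 1 + scol 2) + R 1 j *: scol 3 + R 2 j *: scol 0.

Lemma lvalD (x : 'rV[K]_4) a b : lval x (a + b) = lval x a + lval x b.
Proof. by rewrite /lval mulmxDr mxE. Qed.
Lemma lvalZ (x : 'rV[K]_4) k a : lval x (k *: a) = k * lval x a.
Proof. by rewrite /lval -scalemxAr mxE. Qed.
Lemma lvalB (x : 'rV[K]_4) a b : lval x (a - b) = lval x a - lval x b.
Proof. by rewrite -scaleN1r lvalD lvalZ mulN1r. Qed.

Lemma lval_scol x k : lval x (scol k) = (x *m invmx M) 0 k.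
Proof. by rewrite /lval /scol !mxE; apply: eq_bigr => j _; rewrite !mxE. Qed.

Lemma lval_wcol x j : lval x (wcol j) = plane_lin R idfun ((x *m invmx M) 0) j.
Proof. by rewrite !(lvalD, lvalZ) !lval_scol. Qed.

(** Their non-vanishing makes s, u and v defined and keeps the point off the branch locus y = 0. *)
Definition nonzero_forms := [:: wcol 0; scol 0; scol 1 - scol 2].
(** The ratios of these pairs are s, u and v, which have to differ from point to point. *)
Definition separating_forms := [:: (wcol 1, wcol 0); (scol 1, scol 0); (scol 2, scol 0)].

Lemma lval_neq0 (x : 'rV[K]_4) a : lval x a != 0 -> a != 0.
Proof. by apply: contraNneq => ->; rewrite /lval mulmx0 mxE. Qed.

Lemma plane_point (t : 'rV[K]_3) : exists x, forall j, lval x (wcol j) = t 0 j.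
Proof.
pose tau := t *m invmx R; pose z : 'rV[K]_4 := \row_k [:: tau 0 2; tau 0 0; 0; tau 0 1]`_k.
exists (z *m M) => j; rewrite lval_wcol mulmxK //.
have := congr1 (fun X : 'rV[K]_3 => X 0 j) (plane_row (z 0)); rewrite mxE => ->.
rewrite (_ : \row_k _ = tau) ?mulmxKV //.
by apply/rowP; elim/ord3_ind; rewrite [LHS]mxE /z !mxE /= ?addr0 ?mxE.
Qed.

Lemma nonzero_forms_neq0 a : a \in nonzero_forms -> a != 0.
Proof.
have [x ex] := plane_point (delta_mx 0 0).
have es k l : lval (delta_mx 0 k *m M) (scol l) = (l == k)%:R.
  by rewrite lval_scol mulmxK // mxE eqxx.
rewrite !inE => /or3P[] /eqP ->.
- by apply: (@lval_neq0 x); rewrite ex mxE !eqxx oner_eq0.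
- by apply: (@lval_neq0 (delta_mx 0 0 *m M)); rewrite es eqxx oner_eq0.
by apply: (@lval_neq0 (delta_mx 0 1 *m M)); rewrite lvalB !es subr0 oner_eq0.
Qed.

Lemma separating_formsP ab : ab \in separating_forms ->
  ab.2 \in nonzero_forms /\ exists2 x, lval x ab.2 = 0 & lval x ab.1 != 0.
Proof.
have [x ex] := plane_point (delta_mx 0 1).
have es k l : lval (delta_mx 0 k *m M) (scol l) = (l == k)%:R.
  by rewrite lval_scol mulmxK // mxE eqxx.
rewrite !inE => /or3P[] /eqP -> /=; rewrite !eqxx ?orbT; split=> //.
- by exists x; rewrite ex mxE ?eqxx ?oner_eq0.
- by exists (delta_mx 0 1 *m M); rewrite es ?oner_eq0.
by exists (delta_mx 0 2 *m M); rewrite es ?oner_eq0.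
Qed.

Definition frame_nat r (p : nat -> 'rV[K]_4) : 'M[K]_4 := \matrix_(k, l)
  if (k < r)%N then p k 0 l else (k == l)%:R.

Definition upd (p : nat -> 'rV[K]_4) r x i := if i == r then x else p i.

(** The new determinant is linear in the new row, with the cofactors as coefficients; they are not
    all zero because the old determinant is one of its values. From the fifth point on the frame no
    longer changes, and any non-zero form will do. *)
Lemma frame_step r p : \det (frame_nat r p) != 0 -> exists2 a : 'cV[K]_4, a != 0 &
  forall x, lval x a != 0 -> \det (frame_nat r.+1 (upd p r x)) != 0.
Proof.
move=> dn; have [r4|r4] := ltnP r 4; last first.
  exists (scol 0); first by apply: nonzero_forms_neq0; rewrite !inE eqxx orbT.
  move=> x _; rewrite (_ : frame_nat _ _ = frame_nat r p) //.
  apply/matrixP => k l; rewrite !mxE /upd.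
  have kr : (k < r)%N by apply: leq_trans (ltn_ord k) r4.
  by rewrite ltnS (ltnW kr) kr (ltn_eqF kr).
pose k0 := Ordinal r4; pose a : 'cV[K]_4 := \col_l cofactor (frame_nat r p) k0 l.
have exp x : \det (frame_nat r.+1 (upd p r x)) = lval x a.
  rewrite (expand_det_row _ k0) /lval mxE; apply: eq_bigr => l _.
  rewrite !mxE /= ltnSn /upd eqxx; congr (_ * _); congr (_ * _); congr (\det _).
  apply/matrixP => i j; rewrite !mxE; have := neq_lift k0 i; rewrite -val_eqE /= => ir.
  by rewrite ltnS leq_eqVlt ![_ == r]eq_sym (negPf ir).
exists a => [|x]; last by rewrite exp.
apply: contraNneq dn => a0; rewrite (expand_det_row _ k0) big1 // => l _.
have := congr1 (fun X : 'cV[K]_4 => X l 0) a0; rewrite !mxE => ->.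
by rewrite mulr0.
Qed.

(** Points are added one at a time. Against fixed earlier points every condition on the new one is
    the non-vanishing of a non-zero linear form, so [avoid_forms] applies. *)
Lemma exists_config r : exists p : nat -> 'rV[K]_4,
  [/\ forall i, (i < r)%N -> on_curve q g (p i) /\ (forall a, a \in nonzero_forms -> lval (p i) a != 0),
     forall i j ab, (i < j < r)%N -> ab \in separating_forms -> bil ab (p i) (p j) != 0 &
     \det (frame_nat r p) != 0].
Proof.
elim: r => [|r [p [h1 h2 h3]]].
  exists (fun=> 0); split=> //; first by move=> i j ab /andP[_]; rewrite ltn0.
  have -> : frame_nat 0 (fun=> 0) = 1%:M by apply/matrixP => k l; rewrite !mxE.
  by rewrite det1 oner_neq0.
have [a a0 ha] := frame_step h3.
pose sep i (ab : 'cV[K]_4 * 'cV[K]_4) := lval (p i) ab.1 *: ab.2 - lval (p i) ab.2 *: ab.1.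
pose forms := a :: nonzero_forms ++ [seq sep i ab | i <- iota 0 r, ab <- separating_forms].
have [|x xB hx] := avoid_forms (as_ := forms).
  move=> b; rewrite inE mem_cat => /predU1P[-> //|/orP[/nonzero_forms_neq0 //|]].
  move=> /allpairsP[[i ab] /= []]; rewrite mem_iota add0n => /= ir /separating_formsP[h [z z2 z1]] ->.
  apply: (@lval_neq0 z); rewrite /sep lvalB !lvalZ z2 mulr0 sub0r oppr_eq0 mulf_neq0 //.
  by apply: (h1 i ir).2.
exists (upd p r x); split.
- move=> i; rewrite ltnS leq_eqVlt /upd; case: eqP => [_ _|_ /= ir]; last exact: h1.
  by split=> // b hb; apply: hx; rewrite inE mem_cat hb orbT.
- move=> i j ab /andP[ij]; rewrite ltnS leq_eqVlt /upd => jr hab.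
  case: eqP jr => [ej _|_ /= jr].
    have ir : (i < r)%N by rewrite -ej.
    rewrite (ltn_eqF ir) /bil.
    have := hx (sep i ab); rewrite /sep -/(lval _ _) lvalB !lvalZ [lval x ab.1 * _]mulrC; apply.
    rewrite inE mem_cat; apply/orP; right; apply/orP; right.
    by apply/allpairsP; exists (i, ab); rewrite mem_iota add0n.
  have ir : (i < r)%N by apply: ltn_trans jr.
  by rewrite (ltn_eqF ir); apply: h2; rewrite ?ij.
by apply: ha; apply: hx; rewrite inE eqxx.
Qed.
End CurvePoints.

(** * The open condition and the conclusion *)

Import Num.Theory.

(** A single polynomial, depending on neither the degree nor the multiplicities, so that one open
    set is good for all systems at once. *)
Definition genericity (K : closedFieldType) (M : 'M[K]_4) (R : 'M[K]_3) r : {mpoly K[r * 4]} :=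
  (\prod_i \prod_(a <- nonzero_forms M R) formpoly a i) *
  (\prod_(i < r) \prod_(j < r | (i < j)%N) \prod_(ab <- separating_forms M R) bilpoly ab i j) *
  framepoly K r.

Lemma multihom_genericity (K : closedFieldType) (M : 'M[K]_4) (R : 'M[K]_3) r :
  multihomogeneous (genericity M R r).
Proof.
apply: multihomM; last exact: multihom_framepoly.
apply: multihomM; apply: multihom_prod => i _.
  apply: multihom_prod => a _; apply: mhom_multihomogeneous; exact: mhom_formpoly.
by apply: multihom_prod => j _; apply: multihom_prod => ab _; apply: multihom_bilpoly.
Qed.

Lemma genericityP (K : closedFieldType) (M : 'M[K]_4) (R : 'M[K]_3) r (P : 'M[K]_(r, 4)) :
  (genericity M R r).@[mxvec P 0] != 0 <->
  [/\ forall i a, a \in nonzero_forms M R -> lval (row i P) a != 0,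
     forall (i j : 'I_r) ab, (i < j)%N -> ab \in separating_forms M R -> bil ab (row i P) (row j P) != 0 &
     \det (frame P) != 0].
Proof.
rewrite !mevalM meval_framepoly !mulf_eq0 !negb_or !rmorph_prod.
split=> [/andP[/andP[/prodf_neq0 h1 /prodf_neq0 h2] h3]|[h1 h2 h3]].
  split=> // [i a ha|i j ab ij hab].
    have := h1 i isT; rewrite /= rmorph_prod prodf_seq_neq0 => /allP/(_ a ha) /=.
    by rewrite meval_formpoly.
  have := h2 i isT; rewrite /= rmorph_prod => /prodf_neq0/(_ j ij).
  rewrite /= rmorph_prod prodf_seq_neq0 => /allP/(_ ab hab) /=.
  by rewrite meval_bilpoly.
rewrite h3 andbT; apply/andP; split; apply/prodf_neq0 => i _ /=.
  rewrite rmorph_prod prodf_seq_neq0; apply/allP => a ha /=.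
  by rewrite meval_formpoly h1.
rewrite rmorph_prod; apply/prodf_neq0 => j ij /=.
rewrite rmorph_prod prodf_seq_neq0; apply/allP => ab hab /=.
by rewrite meval_bilpoly h2.
Qed.

Lemma bil_sym (K : fieldType) (ab : 'cV[K]_4 * 'cV[K]_4) x y : bil ab y x = - bil ab x y.
Proof. by rewrite /bil opprB. Qed.

Lemma sorted_multseq r (m : r.-tuple nat) : sorted geq m -> multseq r (nth 0 m).
Proof.
move=> /(sortedP 0%N) h; split=> [i|i ri]; last by rewrite nth_default ?size_tuple.
have [lt|le] := ltnP i.+1 (size m); first exact: h.
by rewrite (nth_default _ le).
Qed.

Lemma H0_xsys (K : fieldType) r (p : 'M[K]_(r, 4)) d (m : r.-tuple nat) :
  (forall i, row i p != 0) -> H0 p d m = xsys (fun i => p i) d (fun i => nth 0 m i).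
Proof.
move=> p0; have rowE i : (row i p) 0 =1 p i by move=> l; rewrite mxE.
apply/vspaceP => F; apply/idP/idP => [/mem_H0 h|/mem_xsys h].
  apply/mem_xsys => i; rewrite -tnth_nth; apply: eq_mult (rowE i) _.
  exact: vanishes_mult (p0 i) (dhomog_is_dhomog F) (h i).
apply/mem_H0 => i; apply: mult_vanishes; rewrite (tnth_nth 0%N).
by apply: eq_mult (h i) => l; rewrite rowE.
Qed.

Theorem theorem5p1 (K : closedFieldType) (charK : [pchar K] =i pred0)
    (q g : {mpoly K[4]}) (hQ : smooth_quadric q)
    (hB : smooth_anticanonical_curve q g) (r : nat) :
  for_general_points q g (fun p : 'M[K]_(r, 4) =>
    forall (d : nat) (m : r.-tuple nat),
      linsys_nonempty p d m -> standard d m -> 1 <= C_dot_linsys d m ->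
      linsys_dim p d m =
        virtual_dim d m + \sum_(i < r) 'C(line_excess d m i + 1, 3)%:Z).
Proof.
have two0 : (2 : K) != 0 by have := charK 2%N; rewrite !inE /= => ->.
have [M [R [lam [uM uR q_ev g_ev f_nsq]]]] := elliptic_normal_form two0 hQ hB.
exists (fun p => (genericity M R r).@[mxvec p 0] != 0); split.
- exists (eq (genericity M R r)) => [_ <-|p _]; first exact: multihom_genericity.
  by split=> [h|[_ <-] //]; exists (genericity M R r).
- have [p [h1 h2 h3]] := exists_config two0 uM uR q_ev g_ev f_nsq r.
  have rowp i : row i (\matrix_(i < r) p i) = p i by rewrite rowK.
  exists (\matrix_(i < r) p i) => [i|]; first by rewrite rowp; case: (h1 i (ltn_ord i)).
  apply/genericityP; split=> [i a ha|i j ab ij hab|].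
  + by rewrite rowp; case: (h1 i (ltn_ord i)) => _; apply.
  + by rewrite !rowp; apply: h2; rewrite ?ij ?ltn_ord.
  suff -> : frame (\matrix_(i < r) p i) = frame_nat r p by [].
  apply/matrixP => k l; rewrite !mxE; case: insubP => [i kr ik|/negPf ->] //.
  by rewrite kr mxE ik.
move=> p pB /genericityP[g1 g2 g3] d m [F F0 FH] [ms mstd] hC.
have p0 i : row i p != 0 by case: (pB i).
have hn := sorted_multseq ms.
have eH := H0_xsys d m p0.
(* Non-emptiness enters here: a non-zero form has no point of multiplicity greater than its
   degree. *)
have n0 : (nth 0 m 0 <= d.+1)%N.
  have [r0|r0] := posnP r; first by rewrite (proj2 hn) ?r0.
  apply: leqW; rewrite leqNgt; apply/negP => lt; case/eqP: F0; apply: val_inj.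
  move: FH; rewrite eH => /mem_xsys/(_ (Ordinal r0)) /= hF.
  by apply: (mult_gt_deg (dhomog_is_dhomog F)); apply: multW lt hF.
have sumZ (G : 'I_r -> nat) : \sum_(i < r) (G i)%:Z = (\sum_(i < r) G i)%N%:Z.
  by rewrite (big_morph Posz PoszD (erefl _)).
have tE i : tnth m i = nth 0%N m i by apply: tnth_nth.
have lt : (msum r (nth 0 m) < 4 * d)%N.
  move: hC; rewrite /C_dot_linsys sumZ (eq_bigr _ (fun i _ => tE i)) -/(msum r (nth 0%N m)).
  by move: (msum _ _) => s; clear; lia.
have gen ab (i j : 'I_r) : ab \in separating_forms M R -> i != j -> bil ab (row i p) (row j p) != 0.
  move=> hab; rewrite -val_eqE neq_ltn => /orP[ij|ji]; first exact: g2.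
  by rewrite bil_sym oppr_eq0; apply: g2.
have ne (a b : 'cV[K]_4) (i j : 'I_r) : (a, b) \in separating_forms M R -> i != j ->
    lval (row i p) a * lval (row j p) b != lval (row j p) a * lval (row i p) b.
  by move=> hab /(gen _ _ _ hab); rewrite subr_eq0.
have key : (\dim (H0 p d m) + \sum_(i < r) 'C(nth 0 m i + 2, 3) =
    'C(d + 3, 3) + \sum_(i < r) 'C(excess (nth 0 m) d i + 1, 3))%N.
  rewrite eH; apply: (@dim_config K two0 q g M R lam uM uR q_ev g_ev f_nsq hQ.1 hB.1 r p pB
    _ _ _ _ _ _ (frame p)) => //.
  - by move=> i; rewrite -lval_scol; apply: g1; rewrite !inE eqxx ?orbT.
  - move=> i; rewrite -subr_eq0 -!lval_scol -lvalB; apply: g1.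
    by rewrite !inE eqxx ?orbT.
  - by move=> i; rewrite -lval_wcol; apply: g1; rewrite !inE eqxx.
  - by move=> i j ij; rewrite -!lval_wcol; apply: ne; rewrite // !inE eqxx.
  - by move=> i j ij; rewrite -!lval_scol; apply: ne; rewrite // !inE eqxx ?orbT.
  - by move=> i j ij; rewrite -!lval_scol; apply: ne; rewrite // !inE eqxx ?orbT.
  - by rewrite unitmxE unitfE.
  move=> k i ki l; rewrite mxE; case: insubP => [j _ jk|]; last by rewrite ki ltn_ord.
  by have -> : j = i by apply: val_inj; rewrite jk ki.
have eE : (\sum_(i < r) 'C(line_excess d m i + 1, 3) =
    \sum_(i < r) 'C(excess (nth 0 m) d i + 1, 3))%N.
  by apply: eq_bigr => i _; rewrite /line_excess /excess tE.
have mE : (\sum_(i < r) 'C(tnth m i + 2, 3) = \sum_(i < r) 'C(nth 0 m i + 2, 3))%N.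
  by apply: eq_bigr => i _; rewrite tE.
rewrite /linsys_dim /virtual_dim !sumZ eE mE; move: key.
move: (\dim _) 'C(d + 3, 3)%N (\sum_(i < r) _)%N (\sum_(i < r) _)%N => a b c e.
by clear; lia.
Qed.
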